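(* Let $S$ be a Gröbner–Shirshov basis in the free associative $n$-conformal algebra $C=C(B,\mathbf N,D_1,\dots,D_n)$ with fixed constant locality $\mathbf N$. Then the $S$-irreducible normal words form a $k$-linear basis of the $n$-conformal algebra $C(B,\mathbf N,D_1,\dots,D_n\mid S)=C/Id(D^\omega(S))$ with defining relations $S$. If $S$ is D-free, the converse holds as well: if $S\subset C$ is a set of monic D-free polynomials such that the $S$-irreducible normal words form a $k$-linear basis of $C(B,\mathbf N,D_1,\dots,D_n\mid S)$, then $S$ is a Gröbner–Shirshov basis.
   Context: Let $k$ be a field of characteristic $0$, $n\ge 1$, $\mathbb Z_+$ the non-negative integers. For $\mathbf m,\mathbf l\in\mathbb Z_+^n$, $\mathbf m\prec\mathbf l$ means that $m_i\le l_i$ for all $i=1,\dots,n$ and there exists $i_0$ with $m_{i_0}<l_{i_0}$; $\mathbf e_i$ is the $i$-th unit vector; $(-1)^{\mathbf s}=(-1)^{s_1+\cdots+s_n}$; $\binom{\mathbf m}{\mathbf s}=\prod_i\binom{m_i}{s_i}$. An $n$-conformal algebra is a $k$-vector space $C$ with bilinear products $\langle\mathbf m\rangle$ ($\mathbf m\in\mathbb Z_+^n$) and pairwise commuting linear maps $D_1,\dots,D_n$ such that (i) for all $a,b\in C$ there is $\mathbf N(a,b)\in\mathbb Z_+^n$ with $a\langle\mathbf m\rangle b=0$ whenever $\mathbf m\not\prec\mathbf N(a,b)$; (ii) $D_i(a\langle\mathbf m\rangle b)=D_ia\langle\mathbf m\rangle b+a\langle\mathbf m\rangle D_ib$; (iii)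 $D_ia\langle\mathbf m\rangle b=-m_i\,a\langle\mathbf m-\mathbf e_i\rangle b$ (zero if $m_i=0$). It is associative if $(a\langle\mathbf m\rangle b)\langle\mathbf m'\rangle c=\sum_{\mathbf s\in\mathbb Z_+^n}(-1)^{\mathbf s}\binom{\mathbf m}{\mathbf s}a\langle\mathbf m-\mathbf s\rangle(b\langle\mathbf m'+\mathbf s\rangle c)$ for all $a,b,c,\mathbf m,\mathbf m'$ (terms with zero binomial coefficient are omitted). Fix $\mathbf N\in\mathbb Z_+^n$ and a non-empty well-ordered set $B$. $C=C(B,\mathbf N,D_1,\dots,D_n)$ is the free associative $n$-conformal algebra on $B$ with constant locality $\mathbf N$: it is generated by $B$, satisfies $a\langle\mathbf m\rangle b=0$ for $a,b\in B$, $\mathbf m\not\prec\mathbf N$, and any map $\varepsilon$ from $B$ to an associative $n$-conformal algebra with $\varepsilon(a)\langle\mathbf m\rangle\varepsilon(b)=0$ for $a,b\in B$, $\mathbf m\not\prec\mathbf N$, extends uniquely to a homomorphism. Write $D^{\mathbf i}=D_1^{i_1}\cdots D_n^{i_n}$. An associative normal word is a formal expression $u=a_1\langle\mathbf m^{(1)}\rangle a_2\langle\mathbf m^{(2)}\rangle\cdots a_r\langle\mathbf m^{(r)}\rangle D^{\mathbf i}a_{r+1}$ with $r\ge0$, $a_j\in B$, $\mathbf m^{(j)}\prec\mathbf N$, $\mathbf i\in\mathbb Z_+^n$; $|u|=r+1$; $u$ is D-free if $\mathbf i=\mathbf 0$; $T$ is the set of these words. $[u]$ is its right-normed bracketing $a_1\langle\mathbf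 m^{(1)}\rangle(a_2\langle\mathbf m^{(2)}\rangle(\cdots))$, an element of $C$ called a normal word. For $w\in T$, $wD^{\mathbf j}$ is obtained by applying $D^{\mathbf j}$ to the last letter of $w$. The normal words form a $k$-basis of $C$; elements of $C$ are called polynomials, and a polynomial is D-free if all normal words occurring in it are D-free; a set is D-free if all its elements are. Words are ordered by lexicographic comparison of the weights $wt(u)=(|u|,a_1,\mathbf m^{(1)},\dots,a_r,\mathbf m^{(r)},a_{r+1},\mathbf i)$, with $B$ in its given order and $\mathbb Z_+^n$ ordered lexicographically. $\overline f$ is the largest $u$ such that $[u]$ occurs in $f\neq0$; $f$ is monic if its coefficient is $1$. For D-free $a\in T$, $b\in T$, $\mathbf m\prec\mathbf N$, $a\langle\mathbf m\rangle b$ denotes concatenation in $T$; words displayed around a polynomial or leading word may be empty (written $1$), in which case the adjacent product symbol is omitted; all product indices in words and normal $S$-words below are $\prec\mathbf N$. Let $S\subset C$ be a set of monic polynomials. Normal $S$-words: of the first kind, $[a\langle\mathbf m\rangle s\langle\mathbf m'\rangle b]$ with $s\in S$ D-free, $a\in T$ D-free or empty, $b\in T$ or empty; of the second kind, $[a\langle\mathbf m\rangle D^{\mathbf i}s]$ with $s\in S$, $\mathbf i\in\mathbb Z_+^n$, $a\in T$ D-free or empty. Here $[\cdot]$ is right-normed bracketing with $s$, resp. $D^{\mathbf i}s$, treated as one letter. Compositions, for monic $f,g$ and $w\in T$: (inclusion) if $g$ is D-free and $w=\overline f=u\langle\mathbf m\rangle\overline g\langle\mathbf m'\rangle v$ with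 $u$ D-free, $(f,g)_w=f-[u\langle\mathbf m\rangle g\langle\mathbf m'\rangle v]$; (right inclusion) if $w=\overline fD_{j_1}^{i_1}\cdots D_{j_l}^{i_l}=u\langle\mathbf m\rangle\overline gD_{j_{l+1}}^{i_{l+1}}\cdots D_{j_n}^{i_n}$ with $u$ D-free, $i_1,\dots,i_n\in\mathbb Z_+$ and $(j_1,\dots,j_n)$ a permutation of $(1,\dots,n)$, $(f,g)_w=D_{j_1}^{i_1}\cdots D_{j_l}^{i_l}f-[u\langle\mathbf m\rangle D_{j_{l+1}}^{i_{l+1}}\cdots D_{j_n}^{i_n}g]$; (intersection) if $f$ is D-free, $w=\overline f\langle\mathbf m\rangle v=u\langle\mathbf m'\rangle\overline g$ with $u,v\in T$, $u$ D-free, $|\overline f|+|\overline g|>|w|$, $(f,g)_w=[f\langle\mathbf m\rangle v]-[u\langle\mathbf m'\rangle g]$; (left multiplication) $a\langle\mathbf m\rangle f$ with $a\in B$, $\mathbf m\not\prec\mathbf N$; (right multiplication) $f\langle\mathbf m\rangle a$ with $f$ not D-free, $a\in B$, $\mathbf m\in\mathbb Z_+^n$. $(f,g)_w$ is trivial modulo $S$ if it is a (possibly empty) finite linear combination of normal $S$-words $[u_l\langle\mathbf m^{(l)}\rangle s_l\langle\mathbf m'^{(l)}\rangle v_l]$ (first kind) and $[u_j\langle\mathbf m^{(j)}\rangle D^{\mathbf i_j}s_j]$ (second kind) with $u_l\langle\mathbf m^{(l)}\rangle\overline{s_l}\langle\mathbf m'^{(l)}\rangle v_l<w$ and $u_j\langle\mathbf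 m^{(j)}\rangle\overline{s_j}D^{\mathbf i_j}<w$, all these $S$-words being D-free if $f$ and $g$ are both D-free. A left or right multiplication composition $h$ is trivial modulo $S$ if it is such a combination with these leading words of length $\le|\overline h|$ (instead of $<w$), all $S$-words being D-free if $h$ is a right multiplication, or a left multiplication $a\langle\mathbf m\rangle f$ with $f$ D-free. $S$ is a Gröbner–Shirshov basis if all compositions of elements of $S$ are trivial modulo $S$. $Id(D^\omega(S))$ is the ideal of the $n$-conformal algebra $C$ generated by all $D^{\mathbf i}s$, $s\in S$, $\mathbf i\in\mathbb Z_+^n$. A normal word $[u]$ is $S$-irreducible if $u$ is not of the form $a\langle\mathbf m\rangle\overline s\langle\mathbf m'\rangle b$ with $s\in S$ D-free, nor of the form $a\langle\mathbf m\rangle\overline sD^{\mathbf i}$ with $s\in S$ ($a,b\in T$ possibly empty). *)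

(* Defs.v *)
From HB Require Import structures.
From mathcomp Require Import all_boot all_order all_algebra.
From mathcomp Require Import perm boolp.

Set Implicit Arguments.
Unset Strict Implicit.
Unset Printing Implicit Defensive.

Import Order.TTheory GRing.Theory.
Local Open Scope ring_scope.

(* The library makes {ffun 'I_n -> nat} an nmodType: 0 and + are pointwise. *)
Notation mindex n := {ffun 'I_n -> nat}.

Section MultiIndex.
Context {n : nat}.
Implicit Types m l s : mindex n.

Definition mle m l : bool := [forall i, (m i <= l i)%N].

Definition prec m l : bool := mle m l && [exists i, (m i < l i)%N].

Definition mlexlt m l : bool :=
  [exists i : 'I_n, [forall j : 'I_n, (j < i)%N ==> (m j == l j)]
                    && (m i < l i)%N].

Definition munit (i : 'I_n) : mindex n := [ffun j => nat_of_bool (j == i)].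

(* Truncated; only used where s <= m or with a zero coefficient. *)
Definition msub m s : mindex n := [ffun i => (m i - s i)%N].

Definition mdeg m : nat := (\sum_i m i)%N.

Definition mbin m s : nat := (\prod_i 'C(m i, s i))%N.

(* The indices s <= m, i.e. those with mbin m s <> 0. *)
Definition mbelow m : seq (mindex n) :=
  [seq s <- [seq ([ffun i => nat_of_ord (t i)] : mindex n)
            | t : {ffun 'I_n -> 'I_(mdeg m).+1}] | mle s m].

Lemma mem_mbelow m s : (s \in mbelow m) = mle s m.
Proof.
rewrite mem_filter andb_idr // => /forallP sm.
apply/imageP; exists [ffun i => inord (s i)] => //.
apply/ffunP => i; rewrite !ffunE inordK // ltnS (leq_trans (sm i)) //.
by rewrite /mdeg (bigD1 i) //= leq_addr.
Qed.

Lemma mbelow_uniq m : uniq (mbelow m).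
Proof.
rewrite filter_uniq // map_inj_uniq ?enum_uniq // => t t' /ffunP tt'.
by apply/ffunP => i; apply: val_inj; have := tt' i; rewrite !ffunE.
Qed.

Lemma mbin_neq0 m s : (mbin m s != 0%N) = mle s m.
Proof.
apply/idP/forallP => [|sm]; last by rewrite -lt0n prodn_gt0 // => i; rewrite bin_gt0.
move=> ms i; rewrite leqNgt; apply: contra ms => lt_ms.
by rewrite /mbin (bigD1 i) //= bin_small.
Qed.

End MultiIndex.

Record nconformal (k : fieldType) (n : nat) : Type := NConformal {
  carrier :> lmodType k;
  cprod : mindex n -> carrier -> carrier -> carrier;
  cder : 'I_n -> carrier -> carrier;
  cprod_linearl : forall m b, linear (fun a => cprod m a b);
  cprod_linearr : forall m a, linear (cprod m a);
  cder_linear : forall i, linear (cder i);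
  cderC : forall i j a, cder i (cder j a) = cder j (cder i a);
  cprod_locality : forall a b, exists N : mindex n,
    forall m, ~~ prec m N -> cprod m a b = 0;
  cder_prod : forall i m a b,
    cder i (cprod m a b) = cprod m (cder i a) b + cprod m a (cder i b);
  cprod_der : forall i m a b,
    cprod m (cder i a) b = - ((m i)%:R *: cprod (msub m (munit i)) a b)
}.

Notation "a ⟨ m ⟩ b" := (cprod m a b)
  (at level 40, left associativity, format "a  ⟨ m ⟩  b").

Definition cassociative k n (C : nconformal k n) : Prop :=
  forall (a b c : C) (m m' : mindex n),
    (a ⟨m⟩ b) ⟨m'⟩ c =
    \sum_(s <- mbelow m)
      ((-1) ^+ mdeg s * (mbin m s)%:R) *: (a ⟨msub m s⟩ (b ⟨m' + s⟩ c)).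

Definition is_hom k n (C A : nconformal k n) (phi : C -> A) : Prop :=
  [/\ linear phi,
      forall m x y, phi (x ⟨m⟩ y) = phi x ⟨m⟩ phi y
    & forall i x, phi (cder i x) = cder i (phi x)].

Definition is_subspace (k : fieldType) (V : lmodType k) (P : V -> Prop) : Prop :=
  P 0 /\ forall (c : k) x y, P x -> P y -> P (c *: x + y).

Definition is_subalg k n (C : nconformal k n) (P : C -> Prop) : Prop :=
  [/\ is_subspace P,
      forall m x y, P x -> P y -> P (x ⟨m⟩ y)
    & forall i x, P x -> P (cder i x)].

Definition is_ideal k n (C : nconformal k n) (P : C -> Prop) : Prop :=
  [/\ is_subspace P,
      forall m x y, P y -> P (x ⟨m⟩ y),
      forall m x y, P x -> P (x ⟨m⟩ y)
    & forall i x, P x -> P (cder i x)].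

Record cideal k n (C : nconformal k n) := Ideal {
  ideal_mem :> C -> Prop;
  idealP : is_ideal ideal_mem
}.

Definition generated_by k n (C : nconformal k n) (X : C -> Prop) (x : C) : Prop :=
  forall P, is_ideal P -> (forall y, X y -> P y) -> P x.

Lemma generated_by_ideal k n (C : nconformal k n) (X : C -> Prop) :
  is_ideal (generated_by X).
Proof.
split.
- split=> [P [[P0 _] _ _ _] _ //|c x y Xx Xy P iP XP].
  by case: (iP) => -[_ PD] _ _ _; apply: PD; [apply: Xx|apply: Xy].
- by move=> m x y Xy P iP XP; case: (iP) => _ Pr _ _; apply: Pr; apply: Xy.
- by move=> m x y Xx P iP XP; case: (iP) => _ _ Pl _; apply: Pl; apply: Xx.
- by move=> i x Xx P iP XP; case: (iP) => _ _ _ Pd; apply: Pd; apply: Xx.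
Qed.

Definition ideal_gen k n (C : nconformal k n) (X : C -> Prop) : cideal C :=
  Ideal (generated_by_ideal X).

Section Quotient.
Context {k : fieldType} {n : nat} {C : nconformal k n} (I : cideal C).
Local Open Scope quotient_scope.

Definition ideal_equiv (x y : C) : bool := `[< I (x - y) >].

Lemma ideal0 : I 0. Proof. by case: (idealP I) => -[]. Qed.

Lemma idealZD c x y : I x -> I y -> I (c *: x + y).
Proof. by case: (idealP I) => -[_ h] _ _ _; apply: h. Qed.

Lemma idealZ c x : I x -> I (c *: x).
Proof. by move=> Ix; rewrite -[_ *: _]addr0; apply: idealZD ideal0. Qed.

Lemma idealD x y : I x -> I y -> I (x + y).
Proof. by move=> Ix; rewrite -[x]scale1r; apply: idealZD. Qed.

Lemma ideal_equiv_is_equiv : equiv_class_of ideal_equiv.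
Proof.
split=> [x|x y|y x z].
- by apply/asboolP; rewrite subrr; apply: ideal0.
- by apply: asbool_equiv_eq; split=> /(idealZ (-1)); rewrite scaleN1r opprB.
- move=> /asboolP xy /asboolP yz; apply/asboolP.
  by rewrite -(subrKA y); apply: idealD.
Qed.

Canonical ideal_equiv_equiv := EquivRelPack ideal_equiv_is_equiv.

Definition quotient_space := {eq_quot ideal_equiv_equiv}.
HB.instance Definition _ := Choice.on quotient_space.

Definition quo (x : C) : quotient_space := \pi_quotient_space x.

Lemma quo_repr (x : quotient_space) : quo (repr x) = x.
Proof. exact: reprK. Qed.

Lemma quoP x y : quo x = quo y <-> I (x - y).
Proof.
split=> [/eqmodP/asboolP //|h]; apply/eqmodP; exact/asboolP.
Qed.

Lemma repr_quo x : I (repr (quo x) - x).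
Proof. by apply/quoP; rewrite quo_repr. Qed.

Definition qadd (x y : quotient_space) : quotient_space := quo (repr x + repr y).
Definition qopp (x : quotient_space) : quotient_space := quo (- repr x).
Definition qscale (c : k) (x : quotient_space) : quotient_space := quo (c *: repr x).

Lemma qaddE x y : qadd (quo x) (quo y) = quo (x + y).
Proof. by apply/quoP; rewrite opprD addrACA; apply: idealD; apply: repr_quo. Qed.

Lemma qoppE x : qopp (quo x) = quo (- x).
Proof. by apply/quoP; rewrite -opprD -[X in I X]scaleN1r; apply: idealZ; apply: repr_quo. Qed.

Lemma qscaleE c x : qscale c (quo x) = quo (c *: x).
Proof. by apply/quoP; rewrite -scalerBr; apply: idealZ; apply: repr_quo. Qed.

Lemma quo_ind (P : quotient_space -> Prop) : (forall x, P (quo x)) -> forall x, P x.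
Proof. by move=> h x; rewrite -[x]quo_repr. Qed.

Lemma qaddA : associative qadd.
Proof. by do 3!elim/quo_ind=> ?; rewrite !qaddE addrA. Qed.
Lemma qaddC : commutative qadd.
Proof. by do 2!elim/quo_ind=> ?; rewrite !qaddE addrC. Qed.
Lemma qadd0 : left_id (quo 0) qadd.
Proof. by elim/quo_ind=> ?; rewrite !qaddE add0r. Qed.
Lemma qaddN : left_inverse (quo 0) qopp qadd.
Proof. by elim/quo_ind=> ?; rewrite qoppE qaddE addNr. Qed.
HB.instance Definition _ := GRing.isZmodule.Build quotient_space qaddA qaddC qadd0 qaddN.

Lemma qscaleA a b x : qscale a (qscale b x) = qscale (a * b) x.
Proof. by elim/quo_ind: x => x; rewrite !qscaleE scalerA. Qed.
Lemma qscale1 : left_id 1 qscale.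
Proof. by elim/quo_ind=> x; rewrite qscaleE scale1r. Qed.
Lemma quoD x y : quo (x + y) = quo x + quo y. Proof. by rewrite -qaddE. Qed.
Lemma quoN x : quo (- x) = - quo x. Proof. by rewrite -qoppE. Qed.
Lemma qscaleDr : right_distributive qscale +%R.
Proof. by move=> a; do 2!elim/quo_ind=> ?; rewrite -quoD !qscaleE -quoD scalerDr. Qed.
Lemma qscaleDl x : {morph qscale^~ x : a b / a + b}.
Proof. by elim/quo_ind: x => x a b /=; rewrite !qscaleE scalerDl quoD. Qed.
HB.instance Definition _ := GRing.Zmodule_isLmodule.Build k quotient_space
  qscaleA qscale1 qscaleDr qscaleDl.

Lemma quo_linear : linear quo.
Proof. by move=> c x y; rewrite quoD -qscaleE. Qed.

Definition qprod (m : mindex n) (x y : quotient_space) : quotient_space :=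
  quo (repr x ⟨m⟩ repr y).
Definition qder (i : 'I_n) (x : quotient_space) : quotient_space := quo (cder i (repr x)).

Lemma cprodBl m (x x' y : C) : (x - x') ⟨m⟩ y = x ⟨m⟩ y - x' ⟨m⟩ y.
Proof. by rewrite addrC -scaleN1r (cprod_linearl m y) scaleN1r addrC. Qed.
Lemma cprodBr m (x y y' : C) : x ⟨m⟩ (y - y') = x ⟨m⟩ y - x ⟨m⟩ y'.
Proof. by rewrite addrC -scaleN1r (cprod_linearr m x) scaleN1r addrC. Qed.
Lemma cderB i (x y : C) : cder i (x - y) = cder i x - cder i y.
Proof. by rewrite addrC -scaleN1r (cder_linear i) scaleN1r addrC. Qed.

Lemma qprodE m x y : qprod m (quo x) (quo y) = quo (x ⟨m⟩ y).
Proof.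
case: (idealP I) => _ Ir Il _; apply/quoP.
rewrite -(subrKA (x ⟨m⟩ repr (quo y))) -cprodBl -cprodBr.
by apply: idealD; [apply: Il|apply: Ir]; apply: repr_quo.
Qed.

Lemma qderE i x : qder i (quo x) = quo (cder i x).
Proof.
by case: (idealP I) => _ _ _ Id; apply/quoP; rewrite -cderB; apply/Id/repr_quo.
Qed.

Lemma quoZ c x : quo (c *: x) = c *: quo x. Proof. by rewrite -qscaleE. Qed.

Fact qprod_linearl m b : linear (fun a => qprod m a b).
Proof.
elim/quo_ind: b => b c; do 2!elim/quo_ind=> ?.
by rewrite -quo_linear !qprodE (cprod_linearl m b) quo_linear.
Qed.
Fact qprod_linearr m a : linear (qprod m a).
Proof.
elim/quo_ind: a => a c; do 2!elim/quo_ind=> ?.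
by rewrite -quo_linear !qprodE (cprod_linearr m a) quo_linear.
Qed.
Fact qder_linear i : linear (qder i).
Proof.
move=> c; do 2!elim/quo_ind=> ?.
by rewrite -quo_linear !qderE (cder_linear i) quo_linear.
Qed.
Fact qderC i j a : qder i (qder j a) = qder j (qder i a).
Proof. by elim/quo_ind: a => a; rewrite !qderE cderC. Qed.
Fact qprod_locality a b : exists N : mindex n,
  forall m, ~~ prec m N -> qprod m a b = 0.
Proof.
elim/quo_ind: a => a; elim/quo_ind: b => b.
have [N abN] := cprod_locality a b; exists N => m /abN ab0.
by rewrite qprodE ab0.
Qed.
Fact qder_prod i m a b :
  qder i (qprod m a b) = qprod m (qder i a) b + qprod m a (qder i b).
Proof.
elim/quo_ind: a => a; elim/quo_ind: b => b.
by rewrite !(qderE, qprodE) -quoD cder_prod.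
Qed.
Fact qprod_der i m a b :
  qprod m (qder i a) b = - ((m i)%:R *: qprod (msub m (munit i)) a b).
Proof.
elim/quo_ind: a => a; elim/quo_ind: b => b.
by rewrite qderE !qprodE -quoZ -quoN cprod_der.
Qed.

Definition quotient_alg : nconformal k n :=
  NConformal qprod_linearl qprod_linearr qder_linear qderC qprod_locality
    qder_prod qprod_der.

End Quotient.

Definition is_basis (k : fieldType) (V : lmodType k) (T : eqType)
    (P : T -> Prop) (v : T -> V) : Prop :=
  (forall x : V, exists (s : seq T) (c : T -> k),
     (forall t, t \in s -> P t) /\ x = \sum_(t <- s) c t *: v t) /\
  (forall (s : seq T) (c : T -> k),
     uniq s -> (forall t, t \in s -> P t) ->
     \sum_(t <- s) c t *: v t = 0 -> forall t, t \in s -> c t = 0).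

Definition local_on k n (N : mindex n) (B : Type) (C : nconformal k n)
    (e : B -> C) : Prop :=
  forall a b m, ~~ prec m N -> e a ⟨m⟩ e b = 0.

Definition is_free k n (N : mindex n) (B : Type) (C : nconformal k n)
    (iota : B -> C) : Prop :=
  [/\ cassociative C,
      forall P, is_subalg P -> (forall b, P (iota b)) -> forall x, P x,
      local_on N iota
    & forall (A : nconformal k n) (eps : B -> A),
        cassociative A -> local_on N eps ->
        exists phi : C -> A,
          [/\ is_hom phi, forall b, phi (iota b) = eps b
            & forall psi : C -> A, is_hom psi ->
                (forall b, psi (iota b) = eps b) -> psi =1 phi]].

(* a_1<m_1> ... a_r<m_r> D^i a_(r+1) is
   Word [:: (a_1, m_1); ...; (a_r, m_r)] i a_(r+1). *)
Record word (B : Type) (n : nat) := Word {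
  wpre : seq (B * mindex n);
  wexp : mindex n;
  wlast : B
}.

Section WordEqType.
Context {B : choiceType} {n : nat}.

Definition word_tuple (u : word B n) := (wpre u, wexp u, wlast u).
Definition tuple_word (t : seq (B * mindex n) * mindex n * B) :=
  Word t.1.1 t.1.2 t.2.
Lemma word_tupleK : cancel word_tuple tuple_word. Proof. by case. Qed.
HB.instance Definition _ := Choice.copy (word B n) (can_type word_tupleK).

End WordEqType.

Section Words.
Context {d : Order.disp_t} {B : orderType d} {n : nat} (N : mindex n).
Implicit Types (u v : word B n) (p : seq (B * mindex n)).

(* A displayed left factor "a<m>", with a a D-free word of T or empty, is
   flattened to the list of its letters and indices. *)
Definition left_factor p : bool := all (fun am => prec am.2 N) p.

Definition in_T u : bool := left_factor (wpre u).

(* A displayed right factor "<m>b", with b in T, or nothing. *)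
Definition right_factor (t : option (mindex n * word B n)) : bool :=
  if t is Some (m, b) then prec m N && in_T b else true.

Definition wlen u : nat := (size (wpre u)).+1.

(* p v, for a left factor p. *)
Definition lcat p v : word B n := Word (p ++ wpre v) (wexp v) (wlast v).

(* u<m>v; only meaningful for u D-free, as wexp u is dropped. *)
Definition wcat u (m : mindex n) v : word B n :=
  lcat (rcons (wpre u) (wlast u, m)) v.

Definition rcat u (t : option (mindex n * word B n)) : word B n :=
  if t is Some (m, b) then wcat u m b else u.

Definition wD u (i : mindex n) : word B n :=
  Word (wpre u) (wexp u + i) (wlast u).

Fixpoint tuplelt p (a : B) (i : mindex n) q (b : B) (j : mindex n) : bool :=
  match p, q with
  | (a1, m1) :: p', (b1, l1) :: q' =>
      (a1 < b1)%O || (a1 == b1) &&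
        (mlexlt m1 l1 || (m1 == l1) && tuplelt p' a i q' b j)
  | [::], [::] => (a < b)%O || (a == b) && mlexlt i j
  | _, _ => false
  end.

Definition wlt u v : bool :=
  (wlen u < wlen v)%N ||
  (wlen u == wlen v) &&
    tuplelt (wpre u) (wlast u) (wexp u) (wpre v) (wlast v) (wexp v).

End Words.

Section Polynomials.
Context {k : fieldType} {n : nat} (N : mindex n).
Context {d : Order.disp_t} {B : orderType d} {C : nconformal k n}.
Variable iota : B -> C.
Implicit Types (f g h s : C) (u v w : word B n) (S : C -> Prop).

Definition Dpow (i : mindex n) (x : C) : C :=
  foldr (fun j y => iter (i j) (cder j) y) x (enum 'I_n).

(* Right-normed bracketing, with x as the last letter. *)
Definition bracket (p : seq (B * mindex n)) (x : C) : C :=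
  foldr (fun am y => iota am.1 ⟨am.2⟩ y) x p.

Definition nword u : C := bracket (wpre u) (Dpow (wexp u) (iota (wlast u))).

(* The normal words form a basis of the free algebra, so r (up to order) and
   the values of c on r are determined by f. *)
Definition expansion f (r : seq (word B n)) (c : word B n -> k) : Prop :=
  [/\ uniq r, forall u, u \in r -> in_T N u /\ c u != 0
    & f = \sum_(u <- r) c u *: nword u].

Definition occurs f u : Prop := exists r c, expansion f r c /\ u \in r.

Definition leading_term f u (a : k) : Prop :=
  exists r c, [/\ expansion f r c, u \in r,
    forall v, v \in r -> v != u -> wlt v u & c u = a].

Definition leading f u : Prop := exists a, leading_term f u a.

Definition is_monic f : Prop := exists u, leading_term f u 1.

Definition Dfree f : Prop := forall u, occurs f u -> wexp u = 0.

(* [p s <m>b], with s treated as one letter. *)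
Definition sbracket (p : seq (B * mindex n)) s
    (t : option (mindex n * word B n)) : C :=
  bracket p (if t is Some (m, b) then s ⟨m⟩ nword b else s).

(* nSword S x w: x is a normal S-word, and w is the word obtained from it by
   putting the leading word of s in place of s. *)
Variant nSword S : C -> word B n -> Prop :=
| NSword1 p s sb t of S s & Dfree s & leading s sb
    & left_factor N p & right_factor N t :
    nSword S (sbracket p s t) (lcat p (rcat sb t))
| NSword2 p s sb i of S s & leading s sb & left_factor N p :
    nSword S (bracket p (Dpow i s)) (lcat p (wD sb i)).

Definition Sirreducible S u : Prop :=
  [/\ in_T N u,
      ~ exists p s sb t, [/\ S s, Dfree s, leading s sb,
          left_factor N p /\ right_factor N t & u = lcat p (rcat sb t)]
    & ~ exists p s sb i, [/\ S s, leading s sb, left_factor N p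
          & u = lcat p (wD sb i)]].

Definition inclusion_comp f g w h : Prop :=
  exists fb gb p t,
    [/\ leading f fb /\ leading g gb, Dfree g,
        left_factor N p /\ right_factor N t,
        w = fb /\ fb = lcat p (rcat gb t)
      & h = f - sbracket p g t].

(* The exponents of D_(sg 0)^(i 0) ... D_(sg (l-1))^(i (l-1)), resp. of
   D_(sg l)^(i l) ... D_(sg (n-1))^(i (n-1)), for a permutation sg. *)
Definition expo_lo (sg : 'S_n) (l : nat) (i : mindex n) : mindex n :=
  \sum_(t < n | (t < l)%N) munit (sg t) *+ i t.
Definition expo_hi (sg : 'S_n) (l : nat) (i : mindex n) : mindex n :=
  \sum_(t < n | (l <= t)%N) munit (sg t) *+ i t.

Definition right_inclusion_comp f g w h : Prop :=
  exists fb gb p (sg : 'S_n) (l : nat) (i : mindex n),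
    [/\ leading f fb /\ leading g gb, (l <= n)%N, left_factor N p,
        w = wD fb (expo_lo sg l i) /\ w = lcat p (wD gb (expo_hi sg l i))
      & h = Dpow (expo_lo sg l i) f - bracket p (Dpow (expo_hi sg l i) g)].

Definition intersection_comp f g w h : Prop :=
  exists fb gb u v m m',
    [/\ leading f fb /\ leading g gb, Dfree f,
        [/\ in_T N u, in_T N v, wexp u = 0, prec m N & prec m' N],
        [/\ w = wcat fb m v, w = wcat u m' gb
          & (wlen w < wlen fb + wlen gb)%N]
      & h = f ⟨m⟩ nword v - bracket (rcons (wpre u) (wlast u, m')) g].

Definition left_mul_comp f h : Prop :=
  exists a m, ~~ prec m N /\ h = iota a ⟨m⟩ f.

Definition right_mul_comp f h : Prop :=
  ~ Dfree f /\ exists a m, h = f ⟨m⟩ iota a.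

Definition Scombination S h (Q : C -> word B n -> Prop) : Prop :=
  exists r : seq (k * C),
    h = \sum_(ax <- r) ax.1 *: ax.2 /\
    forall ax, ax \in r -> exists w, nSword S ax.2 w /\ Q ax.2 w.

Definition trivial_mod S f g w h : Prop :=
  Scombination S h (fun x w' => wlt w' w /\ (Dfree f -> Dfree g -> Dfree x)).

(* The bound is void for h = 0, which is the empty combination. *)
Definition len_le_leading h w' : Prop :=
  forall hb, leading h hb -> (wlen w' <= wlen hb)%N.

Definition trivial_left_mul S f h : Prop :=
  Scombination S h (fun x w' => len_le_leading h w' /\ (Dfree f -> Dfree x)).

Definition trivial_right_mul S h : Prop :=
  Scombination S h (fun x w' => len_le_leading h w' /\ Dfree x).

Definition GSbasis S : Prop :=
  [/\ forall f g w h, S f -> S g ->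
        inclusion_comp f g w h \/ right_inclusion_comp f g w h \/
        intersection_comp f g w h -> trivial_mod S f g w h,
      forall f h, S f -> left_mul_comp f h -> trivial_left_mul S f h
    & forall f h, S f -> right_mul_comp f h -> trivial_right_mul S h].

(* Id(D^omega(S)) and C(B, N, D_1, ..., D_n | S) *)
Definition Id_Domega S : cideal C :=
  ideal_gen (fun x => exists s i, S s /\ x = Dpow i s).

Definition quotient_by S : nconformal k n := quotient_alg (Id_Domega S).

Definition Sirreducible_basis S : Prop :=
  @is_basis k (quotient_by S) (word B n) (Sirreducible S)
    (fun u => quo (Id_Domega S) (nword u)).

End Polynomials.

(* Main.v *)
(* The free algebra C acts, through the formal distributions a(m) of its
   letters, on the right of the functions of lists of letters a_1(m_1) ... a_r(m_r) that
   satisfy the locality relations. Dually these functions are polynomials in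
   x_1, ..., x_r modulo (x_j - x_(j+1))^l for the forbidden l, with coordinates
   y_j = x_j - x_(j+1); evaluating a normal word in these coordinates is
   triangular for the order on words, so the normal words are independent (this
   is where the characteristic enters, through D^i x^i = i!). They span because
   a<m>(b<m'>x) with m forbidden is a combination of terms a<q>(b<m''>x) with q
   admissible.

   For a Groebner-Shirshov basis S, the span of the normal S-words is an ideal:
   multiplications that leave this span are reduced, by associativity and its
   inverse, to the left and right multiplication compositions, and lengths are
   never increased beyond the sum of the lengths. This length bound makes
   all correction terms smaller in the order, so that two normal S-words with the
   same leading word differ by smaller normal S-words, the overlapping cases
   being the remaining compositions. Hence the leading word of a nonzero element
   of the ideal is reducible. Conversely, for D-free S, a composition lies in the
   ideal, and reducing it leaves a combination of irreducible words, which
   vanishes by independence. *)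

Require Import Defs.
From HB Require Import structures.
From mathcomp Require Import all_boot all_order all_algebra.
From mathcomp Require Import perm boolp functions zify.

Set Implicit Arguments.
Unset Strict Implicit.
Unset Printing Implicit Defensive.

Import Order.TTheory GRing.Theory.
Local Open Scope ring_scope.

(** * Orders on multi-indices and words *)

(** One estimate carries the proof. Associativity turns [(a<m>b)<m'>c] into [a<m>(b<m'>c)] plus
    corrections in which the index after [a] is lexicographically lower. Words are compared by
    length first, so such a correction is smaller only if it is not longer; therefore all spans
    below carry a bound on words, and for the multiplication compositions a bound on the length is
    enough. The obstacle is the derivations. Concatenation on the right drops the exponent of the
    left word, so it respects the order only at D-free words. A composition of D-free polynomials
    may sit inside a longer word and be multiplied on the right, hence its triviality must involve
    D-free S-words only; any other composition sits at the end of a word and is followed by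
    derivations alone. Right multiplications must likewise give D-free S-words, since their results
    are multiplied again. The universal property of [C] is used once, for a homomorphism into an
    algebra of distributions; the locality axiom of that algebra is Dong's lemma. *)

Section MultiIndexTheory.
Context {n : nat}.
Implicit Types (m l s q : mindex n) (i j : 'I_n).

Lemma mindexP m l : (forall i, m i = l i) -> m = l.
Proof. by move=> ml; apply/ffunP. Qed.

Lemma maddE m l i : (m + l) i = (m i + l i)%N.
Proof. by rewrite ffunE. Qed.

Lemma mzeroE i : (0 : mindex n) i = 0%N.
Proof. by rewrite ffunE. Qed.

Lemma msubE m l i : msub m l i = (m i - l i)%N.
Proof. by rewrite ffunE. Qed.

Lemma munitE i j : munit i j = (j == i) :> nat.
Proof. by rewrite ffunE. Qed.

Definition mE := (maddE, mzeroE, msubE, munitE).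

Lemma mleP m l : reflect (forall i, (m i <= l i)%N) (mle m l).
Proof. exact: forallP. Qed.

Lemma mle_refl m : mle m m. Proof. by apply/mleP. Qed.

Lemma mle0 m : mle 0 m. Proof. by apply/mleP => i; rewrite mE. Qed.

Lemma mle_trans l m s : mle m l -> mle l s -> mle m s.
Proof. by move=> /mleP ml /mleP ls; apply/mleP => i; apply: leq_trans (ls i). Qed.

Lemma mle_anti m l : mle m l -> mle l m -> m = l.
Proof.
by move=> /mleP ml /mleP lm; apply: mindexP => i; apply/eqP; rewrite eqn_leq ml lm.
Qed.

Lemma mle_addr m l : mle m (m + l).
Proof. by apply/mleP => i; rewrite mE leq_addr. Qed.

Lemma mle_addl m l : mle m (l + m).
Proof. by apply/mleP => i; rewrite mE leq_addl. Qed.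

Lemma mle_sub m s : mle (msub m s) m.
Proof. by apply/mleP => i; rewrite mE leq_subr. Qed.

Lemma msubK m s : mle s m -> msub m s + s = m.
Proof. by move=> /mleP sm; apply: mindexP => i; rewrite !mE subnK. Qed.

Lemma maddK m s : msub (m + s) s = m.
Proof. by apply: mindexP => i; rewrite !mE addnK. Qed.

Lemma msub0 m : msub m 0 = m.
Proof. by apply: mindexP => i; rewrite !mE subn0. Qed.

Lemma msubA m s q : msub (msub m s) q = msub m (s + q).
Proof. by apply: mindexP => i; rewrite !mE subnDA. Qed.

Lemma madd_eq0 m l : m + l = 0 -> m = 0 /\ l = 0.
Proof.
move=> /ffunP ml0; have h i : (m i = 0 /\ l i = 0)%N.
  by have := ml0 i; rewrite !mE => /eqP; rewrite addn_eq0 => /andP[/eqP-> /eqP->].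
by split; apply: mindexP => i; rewrite mE; case: (h i).
Qed.

Lemma madd_inj s : injective (fun m => m + s).
Proof. by move=> m l /(congr1 (fun q => msub q s)); rewrite !maddK. Qed.

Lemma mdegD m l : mdeg (m + l) = (mdeg m + mdeg l)%N.
Proof. by rewrite /mdeg -big_split; apply: eq_bigr => i _; rewrite /= mE. Qed.

Lemma mdeg0 : mdeg (0 : mindex n) = 0%N.
Proof. by rewrite /mdeg big1 // => i _; rewrite mE. Qed.

Lemma mdeg_eq0 m : (mdeg m == 0%N) = (m == 0).
Proof.
rewrite /mdeg sum_nat_eq0; apply/forallP/eqP => [h|-> i]; last by rewrite mE.
by apply: mindexP => i; rewrite mE; apply/eqP; have := h i.
Qed.

Lemma mdeg_munit i : mdeg (munit i) = 1%N.
Proof.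
rewrite /mdeg (bigD1 i) //= munitE eqxx big1 ?addn0 // => j ji.
by rewrite munitE (negPf ji).
Qed.

Lemma mindex_ind (P : mindex n -> Prop) :
  P 0 -> (forall m i, P m -> P (m + munit i)) -> forall m, P m.
Proof.
move=> P0 PS m; have [k] := ubnP (mdeg m); elim: k m => // k IH m.
rewrite ltnS => mk; have [->//|m0] := eqVneq m 0.
have [i mi|m00] := pickP (fun i => m i != 0%N); last first.
  by case/eqP: m0; apply: mindexP => i; rewrite mE; apply/eqP; have := m00 i; move/negbFE.
have um : mle (munit i) m.
  by apply/mleP => j; rewrite mE; case: eqP => // ->; rewrite lt0n.
rewrite -(msubK um); apply/PS/IH.
by rewrite -[m](msubK um) mdegD mdeg_munit addn1 in mk.
Qed.

Lemma munit_le i m : mle (munit i) m = (0 < m i)%N.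
Proof.
apply/mleP/idP => [/(_ i)|mi j]; first by rewrite mE eqxx.
by rewrite mE; case: eqP => // ->.
Qed.

Lemma mbin_eq0 m s : ~~ mle s m -> mbin m s = 0%N.
Proof. by rewrite -mbin_neq0 negbK => /eqP. Qed.

Lemma msubb m : msub m m = 0.
Proof. by apply: mindexP => i; rewrite !mE subnn. Qed.

Lemma prec_down m l s : mle m l -> prec l s -> prec m s.
Proof.
move=> ml /andP[ls /existsP[i li]]; rewrite /prec (mle_trans ml ls) /=.
by apply/existsP; exists i; apply: leq_ltn_trans li; move/mleP: ml.
Qed.

Lemma prec_sub m s l : prec m l -> prec (msub m s) l.
Proof. exact/prec_down/mle_sub. Qed.

Lemma precF_add m s l : ~~ prec m l -> ~~ prec (s + m) l.
Proof. by apply/contra/prec_down/mle_addl. Qed.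

Lemma precF_add_r m s l : ~~ prec m l -> ~~ prec (m + s) l.
Proof. by rewrite addrC; apply: precF_add. Qed.

Lemma prec_addr m l s : prec m l -> prec m (l + s).
Proof.
case/andP=> ml /existsP[i li]; rewrite /prec (mle_trans ml (mle_addr _ _)) /=.
by apply/existsP; exists i; rewrite mE ltn_addr.
Qed.

Lemma prec_add m l s q : prec m l -> mle s q -> prec (m + s) (l + q).
Proof.
case/andP=> /mleP ml /existsP[i li] /mleP sq; apply/andP; split.
  by apply/mleP => j; rewrite !mE leq_add.
by apply/existsP; exists i; rewrite !mE -addSn leq_add.
Qed.

Lemma mlexltP m l :
  reflect (exists i, (forall j : 'I_n, (j < i)%N -> m j = l j) /\ (m i < l i)%N)
    (mlexlt m l).
Proof.
apply: (iffP existsP) => -[i].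
  case/andP=> /forallP h mi; exists i; split=> // j ji.
  by apply/eqP; move/implyP: (h j); apply.
case=> h mi; exists i; rewrite mi andbT; apply/forallP => j.
by apply/implyP => /h ->.
Qed.

Lemma mlexlt_irr m : mlexlt m m = false.
Proof. by apply/mlexltP => -[i [_]]; rewrite ltnn. Qed.

Lemma mlexlt_trans l m s : mlexlt m l -> mlexlt l s -> mlexlt m s.
Proof.
move=> /mlexltP[i [h mi]] /mlexltP[j [h' lj]]; apply/mlexltP.
case: (ltngtP i j) => ij.
- exists i; split=> [i' i'i|]; first by rewrite h // h' // (ltn_trans i'i).
  by rewrite -h'.
- exists j; split=> [j' j'j|]; first by rewrite h ?h' // (ltn_trans j'j).
  by rewrite h.
- have eij : i = j by apply: val_inj.
  subst j; exists i; split=> [j' j'j|]; first by rewrite h ?h'.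
  exact: ltn_trans lj.
Qed.

Lemma mlexlt_total m l : m != l -> mlexlt m l || mlexlt l m.
Proof.
move=> ml; have /existsP[i0 i0P] : [exists i, m i != l i].
  by rewrite -negb_forall; apply: contra ml => /forallP h; apply/eqP/mindexP => i; apply/eqP.
case: (@arg_minnP _ i0 (fun i => m i != l i) (fun i : 'I_n => val i) i0P) => i mli imin.
have h j : (j < i)%N -> m j = l j.
  by move=> ji; apply/eqP; apply/negPn/negP => /imin; rewrite leqNgt ji.
case: (ltngtP (m i) (l i)) => mli'.
- by apply/orP; left; apply/mlexltP; exists i.
- by apply/orP; right; apply/mlexltP; exists i; split=> // j /h.
- by rewrite mli' eqxx in mli.
Qed.

Lemma mlexlt_add m l s : mlexlt (m + s) (l + s) = mlexlt m l.
Proof.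
apply/mlexltP/mlexltP => -[i [h mi]]; exists i; split.
- by move=> j /h; rewrite !mE => /addIn.
- by move: mi; rewrite !mE ltn_add2r.
- by move=> j /h; rewrite !mE => ->.
- by rewrite !mE ltn_add2r.
Qed.

Lemma mle_mlexlt m l : mle m l -> m != l -> mlexlt m l.
Proof.
move=> ml mNl; case/orP: (mlexlt_total mNl) => // /mlexltP[i [_]].
by move/mleP: ml => /(_ i); rewrite ltnNge => ->.
Qed.

Lemma mlexlt_sub m s : mle s m -> s != 0 -> mlexlt (msub m s) m.
Proof.
move=> sm s0; apply: mle_mlexlt (mle_sub m s) _; apply: contra s0 => /eqP msm.
have := msubK sm; rewrite msm => /ffunP h.
by apply/eqP/mindexP => i; have := h i; rewrite !mE => /eqP;
  rewrite -[X in _ == X]addn0 eqn_add2l => /eqP.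
Qed.

End MultiIndexTheory.

(** Induction on [k]: along [R] either coordinate 0 drops, or it stays and the step belongs to [R'],
    which is well-founded because the remaining coordinates decide it. *)
Lemma lex_nat_wf (k : nat) (A : Type) (P : A -> Prop) (R : A -> A -> Prop) (f : A -> nat -> nat) :
  (forall x y, R x y ->
     exists2 i, (i < k)%N & (forall j, (j < i)%N -> f x j = f y j) /\ (f x i < f y i)%N) ->
  forall x, Acc R x.
Proof.
elim: k A P R f => [|k IH] A P R f Rf x.
  by constructor=> y /Rf[].
have [N] := ubnP (f x 0%N); elim: N x => [x|N IHN x]; [by rewrite ltn0 | rewrite ltnS => xN].
pose R' := fun y z : A => R y z /\ f y 0%N = f z 0%N.
have accR' : Acc R' x.
  apply: (IH A P R' (fun x i => f x i.+1)) => y z [/Rf[[|i] ik [h hi]] yz].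
    by rewrite yz ltnn in hi.
  by exists i => //; split=> // j ji; apply: h.
elim: accR' xN => {}x _ IHx xN; constructor=> y Ryx.
case: (Rf _ _ Ryx) => -[|i] ik [h hi]; first by apply: IHN; apply: leq_trans xN.
by apply: IHx; rewrite ?h //; split=> //; rewrite h.
Qed.

Lemma mlexlt_wf (n : nat) (m : mindex n) : Acc (fun m l : mindex n => mlexlt m l) m.
Proof.
(* Coordinates are addressed by natural numbers; the default 0 is never compared, since only
   positions below [n] matter. *)
pose f (m : mindex n) j := if insub j is Some i then m i else 0%N.
apply: (@lex_nat_wf n _ (fun=> True) _ f) => x y /mlexltP[i [h hi]].
exists i => //; split=> [j ji|]; last by rewrite /f valK.
have jn : (j < n)%N by apply: ltn_trans (ltn_ord i).
by rewrite /f insubT /= h.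
Qed.

(** * The order on words and its compatibility with concatenation and derivations *)

Section WordOrder.
Context {d : Order.disp_t} {B : orderType d} {n : nat}.
Implicit Types (u v w : word B n) (p q : seq (B * mindex n)).

Lemma tuplelt_irr p (a : B) i : tuplelt p a i p a i = false.
Proof.
elim: p => [|[b m] p IH] /=; first by rewrite ltxx eqxx mlexlt_irr.
by rewrite ltxx !eqxx mlexlt_irr IH.
Qed.

Lemma tuplelt_trans p q r (a b c : B) i j l :
  tuplelt p a i q b j -> tuplelt q b j r c l -> tuplelt p a i r c l.
Proof.
elim: p q r => [|[a1 m1] p IH] [|[b1 m2] q] [|[c1 m3] r] //=.
  case/orP=> [ab|/andP[/eqP-> ij]].
    by case/orP=> [bc|/andP[/eqP<- _]]; rewrite ?ab // (lt_trans ab bc).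
  case/orP=> [->//|/andP[-> jl]]; by rewrite (mlexlt_trans ij jl) orbT.
case/orP=> [ab|/andP[/eqP->]].
  by move=> h; have -> // : (a1 < c1)%O; case/orP: h => [/(lt_trans ab)|/andP[/eqP<-]].
move=> h /orP[->//|/andP[->]] /=; case/orP: h => [m12|/andP[/eqP-> h]].
  case/orP=> [m23|/andP[/eqP<- _]]; first by rewrite (mlexlt_trans m12 m23) orbT.
  by rewrite m12 orbT.
by case/orP=> [->|/andP[-> h']]; rewrite ?orbT // (IH _ _ h h') !orbT.
Qed.

Lemma tuplelt_total p q (a b : B) i j : size p = size q ->
  [|| (p == q) && (a == b) && (i == j), tuplelt p a i q b j | tuplelt q b j p a i].
Proof.
elim: p q => [|[a1 m1] p IH] [|[b1 m2] q] //=.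
  case: ltgtP => //= _ _; case: (eqVneq i j) => //= ij; exact: mlexlt_total.
case=> /IH h; rewrite eqseq_cons xpair_eqE.
case: (ltgtP a1 b1) => //= _.
case: (eqVneq m1 m2) => [->|m12] /=; first by rewrite !mlexlt_irr.
by rewrite !orbF; apply: mlexlt_total.
Qed.

Lemma wlt_irr u : wlt u u = false.
Proof. by rewrite /wlt ltnn eqxx tuplelt_irr. Qed.

Lemma wlt_trans v u w : wlt u v -> wlt v w -> wlt u w.
Proof.
rewrite /wlt => /orP[uv|/andP[/eqP-> uv]].
  case/orP=> [vw|/andP[/eqP<- _]]; first by rewrite (ltn_trans uv vw).
  by rewrite uv.
by case/orP=> [->//|/andP[-> vw]]; rewrite (tuplelt_trans uv vw) orbT.
Qed.

Lemma wlt_total u v : [|| u == v, wlt u v | wlt v u].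
Proof.
rewrite /wlt; case: (ltngtP (wlen u) (wlen v)) => h; rewrite /= ?orbT //=.
have := @tuplelt_total (wpre u) (wpre v) (wlast u) (wlast v) (wexp u) (wexp v).
case: h => h /(_ h) /or3P[|->|->]; rewrite ?orbT //.
by case: u v {h} => [p i a] [q j b] /= /andP[/andP[/eqP-> /eqP->] /eqP->]; rewrite eqxx.
Qed.

Lemma wlt_neq u v : wlt u v -> u != v.
Proof. by apply: contraTneq => ->; rewrite wlt_irr. Qed.

Lemma wlt_asym u v : wlt u v -> ~~ wlt v u.
Proof. by move=> uv; apply/negP => /(wlt_trans uv); rewrite wlt_irr. Qed.

Lemma wlt_len u v : wlt u v -> (wlen u <= wlen v)%N.
Proof. by case/orP=> [/ltnW//|/andP[/eqP->]]. Qed.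

Lemma len_wlt u v : (wlen u < wlen v)%N -> wlt u v.
Proof. by rewrite /wlt => ->. Qed.

(** The lexicographic order on sequences of unbounded length is not well-founded in general.
    Comparing lengths first leaves tuples of one fixed length, treated by induction on that
    length. *)
Lemma wlt_wf : well_founded (fun a b : B => (a < b)%O) ->
  forall u, Acc (fun u v : word B n => wlt u v) u.
Proof.
move=> Bwf.
(* Induction along the lexicographic order on pairs of a letter and a multi-index; it serves for the
   pairs of the prefix and for the last letter with its exponent. *)
have acc_last (a : B) (i : mindex n) (X : Prop) :
    forall (P : B * mindex n -> Prop),
    (forall a i, (forall b j, (b < a)%O || (b == a) && mlexlt j i -> P (b, j)) -> P (a, i)) ->
    P (a, i).
  move=> P PS; elim: (Bwf a) i => {}a _ IHa i.
  elim: (mlexlt_wf i) => {}i _ IHi; apply: PS => b j /orP[/IHa//|/andP[/eqP-> /IHi//]].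
have acc_tup r : forall p a i, size p = r ->
    Acc (fun t t' : seq (B * mindex n) * B * mindex n =>
       size t.1.1 = r /\ tuplelt t.1.1 t.1.2 t.2 t'.1.1 t'.1.2 t'.2) (p, a, i).
  elim: r => [|r IHr] p a i.
    move/size0nil=> ->; apply: (acc_last a i True (fun t => Acc _ ([::], t.1, t.2))) => {}a {}i IH.
    by constructor=> -[[q b] j] /= [/size0nil-> /=] /IH.
  case: p => [//|[a1 m1] p [pr]].
  move: p a i pr.
  apply: (acc_last a1 m1 True (fun t => forall p a i, size p = r ->
    Acc _ ((t.1, t.2) :: p, a, i))) => {}a1 {}m1 IH p a i pr.
  have := IHr p a i pr; set t := (p, a, i).
  rewrite -[a]/t.1.2 -[i]/t.2 -[p in (_ :: p)]/t.1.1.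
  elim: (IHr p a i pr : Acc _ t) => -[[{pr t a i}p a] i] /= _ IHt _.
  constructor=> -[[q b] j] /= [].
  case: q => [//|[b1 m2] q [qr] /=].
  case/orP=> [b1a1|/andP[/eqP->]].
    by apply: (IH b1 m2) => //; rewrite b1a1.
  case/orP=> [m21|/andP[/eqP-> h]]; first by apply: (IH a1 m2); rewrite // eqxx m21 orbT.
  exact: (IHt (q, b, j) (conj qr h) (IHr q b j qr)).
move=> u; have [r] := ubnP (wlen u); elim: r u => [u|r IHr u];
  [by rewrite ltn0 | rewrite ltnS => ur].
suff key t : Acc (fun t t' : seq (B * mindex n) * B * mindex n =>
       size t.1.1 = size (wpre u) /\ tuplelt t.1.1 t.1.2 t.2 t'.1.1 t'.1.2 t'.2) t ->
    forall v, size (wpre v) = size (wpre u) -> t = (wpre v, wlast v, wexp v) ->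
    Acc (fun u v : word B n => wlt u v) v.
  exact: (key _ (acc_tup _ (wpre u) (wlast u) (wexp u) erefl) u erefl erefl).
elim=> {}t _ IHt v szv tv; constructor=> w /orP[h|/andP[/eqP[h] wv]].
  by apply: IHr; apply: leq_trans ur; rewrite /wlen -szv.
have szw : size (wpre w) = size (wpre u) by rewrite h.
by apply: (IHt (wpre w, wlast w, wexp w)); rewrite // tv.
Qed.

Lemma tuplelt_cat r p q (a b : B) i j :
  tuplelt (r ++ p) a i (r ++ q) b j = tuplelt p a i q b j.
Proof. by elim: r => [|[c m] r IH] //=; rewrite ltxx !eqxx mlexlt_irr. Qed.

Lemma wlt_lcat p u v : wlt (lcat p u) (lcat p v) = wlt u v.
Proof. by rewrite /wlt /lcat /wlen /= !size_cat !ltnS ltn_add2l !eqSS eqn_add2l tuplelt_cat. Qed.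

Lemma lcatA p q u : lcat p (lcat q u) = lcat (p ++ q) u.
Proof. by rewrite /lcat /= catA. Qed.

Lemma lcat0 u : lcat [::] u = u.
Proof. by case: u. Qed.

Lemma wlen_lcat p u : wlen (lcat p u) = (size p + wlen u)%N.
Proof. by rewrite /wlen /= size_cat addnS. Qed.

Lemma wlen_wcat u m v : wlen (wcat u m v) = (wlen u + wlen v)%N.
Proof. by rewrite wlen_lcat size_rcons. Qed.

Lemma wD0 u : wD u 0 = u.
Proof. by case: u => p i a; rewrite /wD /= addr0. Qed.

Lemma wDD u i j : wD (wD u i) j = wD u (i + j).
Proof. by rewrite /wD /= addrA. Qed.

Lemma wD_lcat p u i : wD (lcat p u) i = lcat p (wD u i).
Proof. by []. Qed.

Lemma wD_wcat u m v i : wD (wcat u m v) i = wcat u m (wD v i).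
Proof. by []. Qed.

Lemma wcat_lcat p u m v : wcat (lcat p u) m v = lcat p (wcat u m v).
Proof. by rewrite /wcat lcatA /= rcons_cat. Qed.

Lemma wcatA u m v m' w : wcat (wcat u m v) m' w = wcat u m (wcat v m' w).
Proof. by rewrite /wcat !lcatA /lcat /= rcons_cat. Qed.

Lemma tuplelt_exp p q (a b : B) i j s : size p = size q ->
  tuplelt p a (i + s) q b (j + s) = tuplelt p a i q b j.
Proof.
elim: p q => [|[a1 m1] p IH] [|[b1 m2] q] //=; first by rewrite mlexlt_add.
by case=> /IH ->.
Qed.

Lemma wlt_wD u v i : wlt u v -> wlt (wD u i) (wD v i).
Proof.
rewrite /wlt /wlen /= => /orP[->//|/andP[h]]; rewrite (eqP h) eqxx /=.
by case/eqP: h => h; rewrite tuplelt_exp // => ->; rewrite orbT.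
Qed.

Lemma tuplelt_rcat p q (a b : B) i j m r c l :
  size p = size q -> ~~ mlexlt i j -> tuplelt p a i q b j ->
  tuplelt (rcons p (a, m) ++ r) c l (rcons q (b, m) ++ r) c l.
Proof.
move=> + /negPf ij; elim: p q => [|[a1 m1] p IH] [|[b1 m2] q] //=.
  by rewrite ij andbF orbF => _ ->.
case=> /IH h /orP[->//|/andP[->]] /orP[->|/andP[-> /h ->]]; by rewrite ?orbT.
Qed.

Lemma mlexlt0 (m : mindex n) : mlexlt m 0 = false.
Proof. by apply/mlexltP => -[i [_]]; rewrite mE. Qed.

(* When [wexp v = 0] a difference between u and v already shows in the part
   that survives the concatenation. *)
Lemma wlt_wcatl u v m w : wexp v = 0 -> wlt u v -> wlt (wcat u m w) (wcat v m w).
Proof.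
move=> v0 /orP[uv|/andP[/eqP h uv]].
  by apply: len_wlt; rewrite !wlen_wcat ltn_add2r.
rewrite /wlt !wlen_wcat h eqxx ltnn /=; case: h => h.
by apply: tuplelt_rcat h _ uv; rewrite v0 mlexlt0.
Qed.

Lemma wlt_wcatr u m v w : wlt v w -> wlt (wcat u m v) (wcat u m w).
Proof. by rewrite wlt_lcat. Qed.

(** The source of the estimates on corrections: a lower index after the first letter outweighs any
    change of the tail, provided that the tail does not get longer. *)
Lemma wlt_head (a : B) m m' u v : (wlen u <= wlen v)%N -> mlexlt m m' ->
  wlt (lcat [:: (a, m)] u) (lcat [:: (a, m')] v).
Proof.
rewrite leq_eqVlt => /orP[/eqP uv|uv] mm'.
  by rewrite /wlt !wlen_lcat uv ltnn eqxx /= ltxx eqxx mm'.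
by apply: len_wlt; rewrite !wlen_lcat ltn_add2l.
Qed.

End WordOrder.

Section Factors.
Context {d : Order.disp_t} {B : orderType d} {n : nat} (N : mindex n).
Implicit Types (u v w : word B n) (p q : seq (B * mindex n)).

Lemma left_factor_cat p q : left_factor N (p ++ q) = left_factor N p && left_factor N q.
Proof. exact: all_cat. Qed.

Lemma left_factor_rcons p a m : left_factor N (rcons p (a, m)) = prec m N && left_factor N p.
Proof. exact: all_rcons. Qed.

Lemma in_T_lcat p u : in_T N (lcat p u) = left_factor N p && in_T N u.
Proof. exact: left_factor_cat. Qed.

Lemma in_T_wcat u m v : in_T N (wcat u m v) = [&& prec m N, in_T N u & in_T N v].
Proof. by rewrite in_T_lcat left_factor_rcons andbA. Qed.

End Factors.

(** * Alternating sums and conformal algebras *)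

Section Subspaces.
Context {k : fieldType} {V : lmodType k}.
Implicit Types (P : V -> Prop) (x y : V).

Lemma subspace0 P : is_subspace P -> P 0. Proof. by case. Qed.

Lemma subspaceZ P c x : is_subspace P -> P x -> P (c *: x).
Proof. by case=> P0 PD Px; rewrite -[_ *: _]addr0; apply: PD. Qed.

Lemma subspaceD P x y : is_subspace P -> P x -> P y -> P (x + y).
Proof. by case=> P0 PD Px Py; rewrite -[x]scale1r; apply: PD. Qed.

Lemma subspaceN P x : is_subspace P -> P x -> P (- x).
Proof. by move=> sP Px; rewrite -scaleN1r; apply: subspaceZ. Qed.

Lemma subspaceB P x y : is_subspace P -> P x -> P y -> P (x - y).
Proof. by move=> sP Px Py; apply: subspaceD => //; apply: subspaceN. Qed.

Lemma subspace_trans P x y z : is_subspace P -> P (x - y) -> P (y - z) -> P (x - z).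
Proof. by move=> sP Px Py; rewrite -(subrKA y); apply: subspaceD. Qed.

Lemma subspace_sym P x y : is_subspace P -> P (x - y) -> P (y - x).
Proof. by move=> sP Px; rewrite -opprB; apply: subspaceN. Qed.

Lemma subspaceBD P x y : is_subspace P -> P (x - y) -> P y -> P x.
Proof. by move=> sP Pxy Py; rewrite -[x](subrK y); apply: subspaceD. Qed.

Lemma subspace_sum P (I : eqType) (r : seq I) (p : pred I) (F : I -> V) :
  is_subspace P -> (forall i, i \in r -> p i -> P (F i)) -> P (\sum_(i <- r | p i) F i).
Proof.
move=> sP PF; rewrite big_seq_cond; elim/big_ind: _ => [|x y|i /andP[]].
- exact: subspace0.
- exact: subspaceD.
- exact: PF.
Qed.

Lemma subspace_eq0 : is_subspace (fun x : V => x = 0).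
Proof. by split=> // c x y -> ->; rewrite scaler0 addr0. Qed.

(* A variant rather than a product, so that [apply:] does not unfold it. *)
Variant lspan (X : V -> Prop) (x : V) : Prop :=
  LSpan of forall P, is_subspace P -> (forall y, X y -> P y) -> P x.

Lemma lspan_min (X P : V -> Prop) x :
  is_subspace P -> (forall y, X y -> P y) -> lspan X x -> P x.
Proof. by move=> sP XP [sx]; apply: sx. Qed.

Lemma lspan_subspace X : is_subspace (lspan X).
Proof.
split=> [|c x y [sx] [sy]]; first by split=> P [].
split=> P sP XP; case: (sP) => _ PD; apply: PD; [exact: sx|exact: sy].
Qed.

Lemma lspan_gen (X : V -> Prop) x : X x -> lspan X x.
Proof. by move=> Xx; split=> P _; apply. Qed.

Lemma lspan_mono (X Y : V -> Prop) : (forall x, X x -> Y x) -> forall x, lspan X x -> lspan Y x.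
Proof.
move=> XY x; apply: lspan_min; first exact: lspan_subspace.
by move=> y /XY; apply: lspan_gen.
Qed.

Lemma lspan_sum (X : V -> Prop) x : lspan X x ->
  exists r : seq (k * V), x = \sum_(ax <- r) ax.1 *: ax.2 /\
    forall ax, ax \in r -> X ax.2.
Proof.
apply: (lspan_min (P := fun x => exists r : seq (k * V), x = \sum_(ax <- r) ax.1 *: ax.2 /\
    forall ax, ax \in r -> X ax.2)) => [|y Xy]; last first.
  exists [:: (1, y)]; rewrite big_seq1 scale1r; split=> // ax.
  by rewrite inE => /eqP ->.
split=> [|c y z [r [-> rX]] [r' [-> r'X]]]; first by exists [::]; rewrite big_nil.
exists ([seq (c * ax.1, ax.2) | ax <- r] ++ r'); split.
  rewrite big_cat big_map scaler_sumr; congr (_ + _).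
  by apply: eq_bigr => ax _; rewrite scalerA.
by move=> ax; rewrite mem_cat => /orP[/mapP[bx bxr ->]|]; [exact: (rX bx)|exact: r'X].
Qed.

Lemma sum_lspan (X : V -> Prop) (r : seq (k * V)) :
  (forall ax, ax \in r -> X ax.2) -> lspan X (\sum_(ax <- r) ax.1 *: ax.2).
Proof.
move=> rX; apply: subspace_sum (lspan_subspace X) _ => ax axr _.
apply: subspaceZ (lspan_subspace X) _; apply: lspan_gen.
exact: (rX ax axr).
Qed.

End Subspaces.

Section LinearFunctions.
Context {k : fieldType} {U V : lmodType k} {f : U -> V} (fL : linear f).

Lemma lin0 : f 0 = 0.
Proof. by have := fL (-1) 0 0; rewrite scaler0 addr0 scaleN1r addNr. Qed.
Lemma linZ c x : f (c *: x) = c *: f x.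
Proof. by rewrite -[c *: x]addr0 fL lin0 addr0. Qed.
Lemma linD x y : f (x + y) = f x + f y.
Proof. by rewrite -[x]scale1r fL !scale1r. Qed.
Lemma linN x : f (- x) = - f x.
Proof. by rewrite -scaleN1r linZ scaleN1r. Qed.
Lemma linB x y : f (x - y) = f x - f y.
Proof. by rewrite linD linN. Qed.
Lemma lin_sum I (r : seq I) p (F : I -> U) :
  f (\sum_(i <- r | p i) F i) = \sum_(i <- r | p i) f (F i).
Proof. by elim/big_rec2: _ => [|i x y _ <-]; rewrite ?lin0 // linD. Qed.

Lemma lspan_map (X : U -> Prop) (P : V -> Prop) x :
  is_subspace P -> (forall y, X y -> P (f y)) -> lspan X x -> P (f x).
Proof.
move=> sP XP; apply: (lspan_min (P := fun x => P (f x))) => //; split=> [|c y z Py Pz].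
  by rewrite lin0; apply: subspace0.
by rewrite fL; case: sP => _; apply.
Qed.

End LinearFunctions.

(** * Alternating binomial sums as expansions of powers of a difference *)

Section AlternatingSums.
Context {k : fieldType} {n : nat}.
Implicit Types (m s : mindex n).

(** Read [f p s] as X^p Y^s: then [bsum m f] is the expansion of (X - Y)^m. With [p = m - s] as a
    separate argument, the identities below become polynomial identities. *)
Definition bsum (V : lmodType k) m (f : mindex n -> mindex n -> V) : V :=
  \sum_(s <- mbelow m) ((-1) ^+ mdeg s * (mbin m s)%:R) *: f (msub m s) s.

Lemma mbinD1 m s i :
  mbin (m + munit i) s = (mbin m s + (0 < s i) * mbin m (msub s (munit i)))%N.
Proof.
rewrite /mbin !(bigD1 (P := predT) i) //=.
have E (F : mindex n) : (\prod_(j < n | j != i) 'C(m j, msub F (munit i) j) =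
    \prod_(j < n | j != i) 'C(m j, F j))%N.
  by apply: eq_bigr => j /negPf ji; rewrite !mE ji subn0.
have -> : (\prod_(j < n | j != i) 'C((m + munit i)%R j, s j) =
    \prod_(j < n | j != i) 'C(m j, s j))%N.
  by apply: eq_bigr => j /negPf ji; rewrite !mE ji addn0.
rewrite E !mE eqxx addn1; case: (s i) => [|t] /=; first by rewrite !bin0 mul0n addn0.
by rewrite subn1 /= binS mul1n mulnDl.
Qed.

Lemma bsum0 (V : lmodType k) (f : mindex n -> mindex n -> V) : bsum 0 f = f 0 0.
Proof.
have E : perm_eq (mbelow (0 : mindex n)) [:: 0].
  apply: uniq_perm => [||s]; rewrite ?mbelow_uniq // mem_mbelow inE.
  apply/idP/eqP => [s0|->]; last exact: mle_refl.
  exact: mle_anti s0 (mle0 s).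
rewrite /bsum (perm_big _ E) big_seq1 mdeg0 expr0 mul1r msub0 /mbin big1 ?scale1r // => i _.
by rewrite mzeroE bin0.
Qed.

(** Multiplication of (X - Y)^m by one more factor X_i - Y_i. Pascal's rule splits the sum into the
    [s <= m] and, shifted by [e], the [s] with [s i > 0]. *)
Lemma bsumS (V : lmodType k) m i (f : mindex n -> mindex n -> V) :
  bsum (m + munit i) f =
  bsum m (fun p s => f (p + munit i) s - f p (s + munit i)).
Proof.
set e := munit i; rewrite /bsum.
under eq_bigr do rewrite mbinD1 natrD mulrDr scalerDl.
rewrite big_split /=.
under [RHS]eq_bigr do rewrite scalerBr.
rewrite sumrB; congr (_ + _).
  rewrite (bigID (fun s => mle s m)) /= [X in _ + X]big1 ?addr0; last first.
    by move=> s; rewrite -mbin_neq0 negbK => /eqP ->; rewrite mulr0 scale0r.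
  rewrite -big_filter; have E : perm_eq [seq s <- mbelow (m + e) | mle s m] (mbelow m).
    apply: uniq_perm => [||s]; [by rewrite filter_uniq ?mbelow_uniq|exact: mbelow_uniq|].
    rewrite mem_filter !mem_mbelow.
    by apply/andP/idP => [[]//|sm]; split=> //; apply: mle_trans sm (mle_addr _ _).
  rewrite (perm_big _ E); apply: eq_big_seq => s; rewrite mem_mbelow => /mleP sm.
  rewrite (_ : msub (m + e) s = msub m s + e) //.
  by apply: mindexP => j; rewrite !mE addnBAC ?sm.
rewrite (bigID (fun s : mindex n => 0 < s i)%N) /= [X in _ + X]big1 ?addr0; last first.
  by move=> s /negPf->; rewrite mul0n mulr0 scale0r.
rewrite -big_filter.
have E : perm_eq [seq s : mindex n <- mbelow (m + e) | (0 < s i)%N] [seq s + e | s <- mbelow m].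
  apply: uniq_perm => [||s].
  - by rewrite filter_uniq ?mbelow_uniq.
  - by rewrite map_inj_uniq ?mbelow_uniq //; apply: madd_inj.
  rewrite mem_filter mem_mbelow; apply/andP/mapP => [[si /mleP sm]|[t]].
    exists (msub s e); last by rewrite /e msubK // munit_le.
    by rewrite mem_mbelow; apply/mleP => j; have := sm j; rewrite !mE leq_subLR addnC.
  rewrite mem_mbelow => /mleP tm ->; split; first by rewrite !mE eqxx addn1.
  by apply/mleP => j; rewrite !mE leq_add2r.
rewrite (perm_big _ E) big_map -sumrN; apply: eq_bigr => s _.
rewrite !mE eqxx addn1 /= mul1n maddK mdegD mdeg_munit addn1 exprS mulN1r mulNr scaleNr.
rewrite (_ : msub (m + e) (s + e) = msub m s) //.
by apply: mindexP => j; rewrite !mE subnDr.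
Qed.

Lemma eq_bsum (V : lmodType k) m (f g : mindex n -> mindex n -> V) :
  (forall p s, p + s = m -> f p s = g p s) -> bsum m f = bsum m g.
Proof.
move=> fg; apply: eq_big_seq => s; rewrite mem_mbelow => sm.
by rewrite fg // msubK.
Qed.

Lemma bsumB (V : lmodType k) m (f g : mindex n -> mindex n -> V) :
  bsum m (fun p s => f p s - g p s) = bsum m f - bsum m g.
Proof. by rewrite -sumrB; apply: eq_bigr => s _; rewrite scalerBr. Qed.

Lemma bsumD (V : lmodType k) m (f g : mindex n -> mindex n -> V) :
  bsum m (fun p s => f p s + g p s) = bsum m f + bsum m g.
Proof. by rewrite -big_split; apply: eq_bigr => s _; rewrite /= scalerDr. Qed.

Lemma bsumZ (V : lmodType k) m c (f : mindex n -> mindex n -> V) :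
  bsum m (fun p s => c *: f p s) = c *: bsum m f.
Proof.
by rewrite scaler_sumr; apply: eq_bigr => s _; rewrite !scalerA mulrC.
Qed.

Lemma lin_bsum (U V : lmodType k) (g : U -> V) m (f : mindex n -> mindex n -> U) :
  linear g -> g (bsum m f) = bsum m (fun p s => g (f p s)).
Proof.
move=> gL; rewrite /bsum (lin_sum gL); apply: eq_bigr => s _.
by rewrite (linZ gL).
Qed.

Lemma bsum_in (V : lmodType k) (P : V -> Prop) m (f : mindex n -> mindex n -> V) :
  is_subspace P -> (forall s, mle s m -> P (f (msub m s) s)) -> P (bsum m f).
Proof.
move=> sP Pf; apply: subspace_sum => // s; rewrite mem_mbelow => sm _.
by apply: subspaceZ => //; apply: Pf.
Qed.

Lemma bsum_lead (V : lmodType k) m (f : mindex n -> mindex n -> V) :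
  bsum m f = f m 0 + \sum_(s <- mbelow m | s != 0)
    ((-1) ^+ mdeg s * (mbin m s)%:R) *: f (msub m s) s.
Proof.
rewrite /bsum (bigD1_seq 0) ?mbelow_uniq ?mem_mbelow ?mle0 //= mdeg0 expr0 mul1r msub0.
by rewrite /mbin big1 ?scale1r // => i _; rewrite mzeroE bin0.
Qed.

(* The relation expresses [P m m'] by the [Q (m - s) (m' + s)] with leading
   coefficient 1, so it can be inverted by recursion on [m]. *)
Lemma bsum_inv (V : lmodType k) (X : V -> Prop) (P Q : mindex n -> mindex n -> V) m m' :
  is_subspace X -> (forall m m', P m m' = bsum m (fun p s => Q p (m' + s))) ->
  (forall s, mle s m -> X (P (msub m s) (m' + s))) -> X (Q m m').
Proof.
move=> sX PQ; have [r] := ubnP (mdeg m); elim: r m m' => // r IH m m'.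
rewrite ltnS => mr Ps; have := Ps 0 (mle0 _); rewrite msub0 addr0 PQ bsum_lead addr0.
move=> XP.
set y := \sum_(_ <- _ | _) _ in XP.
rewrite -[Q m m'](addrK y); apply: subspaceB => //.
apply: subspace_sum => // s; rewrite mem_mbelow => sm s0.
apply: subspaceZ => //; apply: IH => [|t tm].
  apply: leq_trans mr; rewrite -[in leqRHS](msubK sm) mdegD -[ltnLHS]addn0 ltn_add2l.
  by rewrite lt0n mdeg_eq0.
rewrite msubA -addrA; apply: Ps; rewrite -(msubK sm) addrC.
by apply/mleP => i; move/mleP: tm => /(_ i); rewrite !mE leq_add2r.
Qed.

End AlternatingSums.

(** * Derivations and associativity in an n-conformal algebra *)

Section ConformalTheory.
Context {k : fieldType} {n : nat} {C : nconformal k n}.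
Implicit Types (a b c x y z : C) (m s : mindex n) (i j : 'I_n) (P : C -> Prop).

Lemma cprod0l m x : 0 ⟨m⟩ x = 0. Proof. exact: (lin0 (cprod_linearl m x)). Qed.
Lemma cprod0r m x : x ⟨m⟩ 0 = 0. Proof. exact: (lin0 (cprod_linearr m x)). Qed.
Lemma cprodDl m x y z : (x + y) ⟨m⟩ z = x ⟨m⟩ z + y ⟨m⟩ z.
Proof. exact: (linD (cprod_linearl m z)). Qed.
Lemma cprodZl m (c : k) x z : (c *: x) ⟨m⟩ z = c *: (x ⟨m⟩ z).
Proof. exact: (linZ (cprod_linearl m z)). Qed.
Lemma cder_prodr i m x y :
  x ⟨m⟩ cder i y = cder i (x ⟨m⟩ y) + (m i)%:R *: (x ⟨msub m (munit i)⟩ y).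
Proof. by rewrite cder_prod cprod_der addrAC addNr add0r. Qed.

Lemma cder_iter i j r x : cder i (iter r (cder j) x) = iter r (cder j) (cder i x).
Proof. by elim: r => //= r IH; rewrite cderC IH. Qed.

Lemma Dpow0 x : Dpow 0 x = x.
Proof. by rewrite /Dpow; elim: (enum _) => //= j r ->; rewrite mzeroE. Qed.

Lemma DpowS m i x : Dpow (m + munit i) x = cder i (Dpow m x).
Proof.
rewrite /Dpow; have := enum_uniq 'I_n; have := mem_enum 'I_n i; rewrite inE.
elim: (enum _) => //= j r IH; rewrite inE !mE => /orP[/eqP<-|ir] /andP[jr ur].
  rewrite eqxx addn1 /=; congr (cder _ (iter _ _ _)).
  elim: r {IH ur} jr => //= l r IH; rewrite inE negb_or => /andP[il /IH ->].
  by rewrite !mE eq_sym (negPf il) addn0.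
rewrite (_ : j == i = false) ?addn0; last by apply: contraNF jr => /eqP->.
by rewrite IH // cder_iter.
Qed.

Lemma DpowD m l x : Dpow (m + l) x = Dpow m (Dpow l x).
Proof.
elim/(@mindex_ind n): m => [|m i IH]; first by rewrite add0r Dpow0.
by rewrite addrAC !DpowS IH.
Qed.

Lemma Dpow_linear m : linear (Dpow m : C -> C).
Proof.
move=> c x y; elim/(@mindex_ind n): m => [|m i IH]; first by rewrite !Dpow0.
by rewrite !DpowS IH (cder_linear i).
Qed.

(** A derivation moves from the right factor to the outside at the cost of a term with a lower
    index; hence the stability of [P] and the quantification over all [m]. On the left factor, in
    [cprod_Dpowl], a derivation is absorbed by the index. *)
Lemma cprod_Dpowr P x y : is_subspace P -> (forall i z, P z -> P (cder i z)) ->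
  (forall m, P (x ⟨m⟩ y)) -> forall (i : mindex n) m, P (x ⟨m⟩ Dpow i y).
Proof.
move=> sP PD Pxy; elim/(@mindex_ind n)=> [|i j IH] m; first by rewrite Dpow0.
rewrite DpowS cder_prodr; apply: subspaceD => //; first exact: PD.
exact: subspaceZ.
Qed.

Lemma cprod_Dpowl P x y : is_subspace P ->
  (forall m, P (x ⟨m⟩ y)) -> forall (i : mindex n) m, P (Dpow i x ⟨m⟩ y).
Proof.
move=> sP Pxy; elim/(@mindex_ind n)=> [|i j IH] m; first by rewrite Dpow0.
by rewrite DpowS cprod_der; apply: subspaceN => //; apply: subspaceZ.
Qed.

Lemma bracket_linear {d : Order.disp_t} {B : orderType d} (iota : B -> C) p : linear (bracket iota p).
Proof.
elim: p => [|[a m] p IH] c x y //=.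
by rewrite IH (cprod_linearr m).
Qed.

Lemma bracket_cat {d : Order.disp_t} {B : orderType d} (iota : B -> C) p q x :
  bracket iota (p ++ q) x = bracket iota p (bracket iota q x).
Proof. by rewrite /bracket foldr_cat. Qed.

Context (assoc : cassociative C).

Lemma assocE m m' a b c :
  (a ⟨m⟩ b) ⟨m'⟩ c = bsum m (fun p s => a ⟨p⟩ (b ⟨m' + s⟩ c)).
Proof. exact: assoc. Qed.

Lemma assoc_in P m m' a b c : is_subspace P ->
  (forall s, mle s m -> P (a ⟨msub m s⟩ (b ⟨m' + s⟩ c))) -> P ((a ⟨m⟩ b) ⟨m'⟩ c).
Proof. by move=> sP Ps; rewrite assocE; apply: bsum_in. Qed.

(** The term [s = 0] is the right-normed product; the hypothesis concerns only the corrections,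
    whose first index [m - s] is strictly lower. *)
Lemma assoc_lead P m m' a b c : is_subspace P ->
  (forall s, mle s m -> s != 0 -> P (a ⟨msub m s⟩ (b ⟨m' + s⟩ c))) ->
  P ((a ⟨m⟩ b) ⟨m'⟩ c - a ⟨m⟩ (b ⟨m'⟩ c)).
Proof.
move=> sP Ps; rewrite assocE bsum_lead addr0 [_ + \sum_(_ <- _ | _) _]addrC addrK.
apply: subspace_sum => // s; rewrite mem_mbelow => sm s0.
by apply: subspaceZ => //; apply: Ps.
Qed.

Lemma assoc_inv P m m' a b c : is_subspace P ->
  (forall s, mle s m -> P ((a ⟨msub m s⟩ b) ⟨m' + s⟩ c)) -> P (a ⟨m⟩ (b ⟨m'⟩ c)).
Proof.
move=> sP Ps.
by apply: (@bsum_inv _ _ _ P (fun m m' => (a ⟨m⟩ b) ⟨m'⟩ c) (fun m m' => a ⟨m⟩ (b ⟨m'⟩ c))) => //.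
Qed.

(* A product with a forbidden index m becomes a combination of products with
   admissible indices, because [x<m-s>b] vanishes when [m - s] is forbidden. *)
Lemma cprod_reduce (N : mindex n) (M P : C -> Prop) x b y : is_subspace P ->
  (forall m, ~~ prec m N -> x ⟨m⟩ b = 0) ->
  (forall m, M (b ⟨m⟩ y)) ->
  (forall m z, prec m N -> M z -> P (x ⟨m⟩ z)) ->
  forall m m', P (x ⟨m⟩ (b ⟨m'⟩ y)).
Proof.
move=> sP xb0 My MP m m'; apply: assoc_inv => // s _.
have [ms|/xb0->] := boolP (prec (msub m s) N); last by rewrite cprod0l; apply: subspace0.
by apply: assoc_in => // t _; apply: MP => //; apply: prec_sub.
Qed.

End ConformalTheory.

(** * Independence of the normal words *)

Section SubspaceType.
Context {k : fieldType} {V : lmodType k} {P : V -> Prop} (sP : is_subspace P).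

(** The dummy mention of [sP] keeps this proof as a parameter after the section closes, so that the
    closure instance can be attached to the predicate. *)
Definition subspace_pred : {pred V} := [pred x | let _ := sP in `[< P x >]].

Lemma subspace_predE x : (x \in subspace_pred) = `[< P x >].
Proof. by []. Qed.

Lemma subspace_pred_closed : submod_closed subspace_pred.
Proof.
case: (sP) => P0 PD; split=> [|c x y]; rewrite !subspace_predE; first exact/asboolP.
by move=> /asboolP Px /asboolP Py; apply/asboolP/PD.
Qed.

HB.instance Definition _ := GRing.isSubmodClosed.Build k V subspace_pred subspace_pred_closed.

Record subspace_type := SubspaceType {
  subspace_val : V;
  _ : subspace_val \in subspace_pred
}.

HB.instance Definition _ := [isSub for subspace_val].
HB.instance Definition _ := [Choice of subspace_type by <:].
HB.instance Definition _ := [SubChoice_isSubLmodule of subspace_type by <:].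

Definition to_subspace x (Px : P x) : subspace_type :=
  @SubspaceType x (introT (asboolP _) Px).

Lemma to_subspaceK x (Px : P x) : subspace_val (to_subspace Px) = x.
Proof. by []. Qed.

Lemma subspace_valP x : P (subspace_val x).
Proof. by apply/asboolP; case: x. Qed.

Lemma subspace_val_inj : injective subspace_val.
Proof. exact: val_inj. Qed.

Lemma subspace_valZD c x y :
  subspace_val (c *: x + y) = c *: subspace_val x + subspace_val y.
Proof. by []. Qed.

Lemma subspace_valD x y : subspace_val (x + y) = subspace_val x + subspace_val y.
Proof. by []. Qed.

Lemma subspace_valN x : subspace_val (- x) = - subspace_val x.
Proof. by []. Qed.

Lemma subspace_valZ (c : k) x : subspace_val (c *: x) = c *: subspace_val x.
Proof. by []. Qed.

End SubspaceType.

(* The formal distributions acting on V, given by their sequences of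
   coefficients; composition is in reverse order, so V is a right module. *)
Section Distributions.
Context {k : fieldType} {n : nat} {V : lmodType k}.

Local Notation distr := (mindex n -> V -> V).
Implicit Types (a b c x y z : distr) (m s l q : mindex n) (i j : 'I_n).

(** For series x(z) with coefficients x_m at z^(-m-1), this is the coefficient form of Res_z (z -
    w)^m x(z) y(w); [dder] is the partial derivative in the same notation. *)
Definition dprod m x y : distr := fun m' v => bsum m (fun p s => y (m' + s) (x p v)).

Definition dder i x : distr := fun m v => - ((m i)%:R *: x (msub m (munit i)) v).

Lemma distrP x y : (forall m v, x m v = y m v) -> x = y.
Proof. by move=> xy; apply/funext => m; apply/funext => v. Qed.

Lemma distrZD (c : k) x y m v : (c *: x + y : distr) m v = c *: x m v + y m v.
Proof. by []. Qed.

Lemma dprod_linearr m x : linear (dprod m x).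
Proof. by move=> c y z; apply: distrP => m' v; rewrite distrZD /dprod -bsumZ -bsumD. Qed.

Lemma dprod_linearl m y : (forall m, linear (y m)) -> linear (fun x => dprod m x y).
Proof.
move=> yL c x z; apply: distrP => m' v; rewrite distrZD /dprod -bsumZ -bsumD.
by apply: eq_bsum => p s _; rewrite distrZD yL.
Qed.

Lemma dder_linear i : linear (dder i).
Proof.
move=> c x y; apply: distrP => m v; rewrite distrZD /dder distrZD scalerDr opprD.
by rewrite scalerN !scalerA mulrC.
Qed.

Lemma dderC i j x : dder i (dder j x) = dder j (dder i x).
Proof.
apply: distrP => m v; rewrite /dder !scalerN !scalerA; congr (- - _).
rewrite !msubA addrC -!natrM; congr (_%:R *: _).
by rewrite !mE; case: (eqVneq i j) => [->//|ij]; rewrite !subn0 mulnC.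
Qed.

(* The Leibniz rule for the truncated "derivative" [p |-> p_i g(p - e_i)]. *)
Lemma msub_munit_shift (W : lmodType k) (g : mindex n -> W) m i j :
  ((m + munit j)%R i)%:R *: g (msub (m + munit j) (munit i)) =
  (m i)%:R *: g (msub m (munit i) + munit j) + (i == j)%:R *: g m.
Proof.
case: (eqVneq i j) => [->|ij]; last first.
  rewrite scale0r addr0 !mE (negPf ij) addn0.
  case: (posnP (m i)) => [->|mi]; first by rewrite !scale0r.
  congr (_ *: g _); apply: mindexP => l; rewrite !mE.
  by case: (eqVneq l i) => [->|_]; rewrite ?(negPf ij) ?addn0 // !subn0.
rewrite maddK !mE eqxx addn1 -natr1 scalerDl; congr (_ + _).
case: (posnP (m j)) => [->|mj]; first by rewrite !scale0r.
by rewrite msubK // munit_le.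
Qed.

(** The derivative of (X - Y)^m in X_i is m_i (X - Y)^(m - e_i). *)
Lemma bsum_der m i (f : mindex n -> mindex n -> V) :
  bsum m (fun p s => (p i)%:R *: f (msub p (munit i)) s) =
  (m i)%:R *: bsum (msub m (munit i)) f.
Proof.
elim/(@mindex_ind n): m f => [|m j IH] f.
  by rewrite bsum0 !mE !scale0r.
rewrite bsumS (msub_munit_shift (fun q => bsum q f)) bsumS -IH -bsumZ -bsumD.
apply: eq_bsum => p s _; rewrite (msub_munit_shift (fun q => f q s)) scalerBr.
by rewrite addrAC.
Qed.

Lemma dprod_der i m x y : (forall m, linear (y m)) ->
  dprod m (dder i x) y = - ((m i)%:R *: dprod (msub m (munit i)) x y).
Proof.
move=> yL; apply: distrP => m' v; rewrite /dprod /dder.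
rewrite [RHS](_ : _ = - ((m i)%:R *: bsum (msub m (munit i))
  (fun p s => y (m' + s) (x p v)))) //.
rewrite -bsum_der -scaleN1r -bsumZ; apply: eq_bsum => p s _.
by rewrite (linN (yL _)) (linZ (yL _)) scaleN1r.
Qed.

(** Read [h p q] as X^p Y^q. The derivation d/dX_i + d/dY_i annihilates X - Y, so in (X - Y)^m Y^m'
    it acts on Y^m' only. *)
Lemma bsum_der2 m m' i (h : mindex n -> mindex n -> V) :
  bsum m (fun p s => (p i)%:R *: h (msub p (munit i)) (m' + s) +
                     ((m' + s)%R i)%:R *: h p (msub (m' + s) (munit i))) =
  (m' i)%:R *: bsum m (fun p s => h p (msub m' (munit i) + s)).
Proof.
elim/(@mindex_ind n): m h => [|m j IH] h.
  by rewrite !bsum0 !addr0 mzeroE scale0r add0r.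
rewrite !bsumS -[in RHS](eq_bsum (f := fun p s => h (p + munit j) (msub m' (munit i) + s)
  - h p (msub m' (munit i) + s + munit j))); last by move=> p s _; rewrite addrA.
rewrite -(IH (fun p q => h (p + munit j) q - h p (q + munit j))).
apply: eq_bsum => p s _; rewrite addrA.
rewrite (msub_munit_shift (fun r => h r (m' + s))) (msub_munit_shift (h p)).
rewrite !scalerBr [X in X - _]addrAC [X in _ - X]addrA.
by rewrite opprD addrACA subrr addr0 opprD addrACA.
Qed.

Lemma dder_prod i m x y : (forall m, linear (y m)) ->
  dder i (dprod m x y) = dprod m (dder i x) y + dprod m x (dder i y).
Proof.
move=> yL; apply: distrP => m' v; rewrite /dder /dprod.
rewrite [RHS](_ : _ = bsum m (fun p s => y (m' + s) (- ((p i)%:R *: x (msub p (munit i)) v))) +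
  bsum m (fun p s => - (((m' + s)%R i)%:R *: y (msub (m' + s) (munit i)) (x p v)))) //.
rewrite -(bsum_der2 m m' i (fun p q => y q (x p v))) -bsumD -scaleN1r -bsumZ.
apply: eq_bsum => p s _.
by rewrite (linN (yL _)) (linZ (yL _)) scalerDr !scaleN1r.
Qed.

(** Read [G p q r] as X^p Y^q Z^r. Both sides are (X - Y)^m (Y - Z)^m' Z^m'', and the right one
    expands X - Y as (X - Z) - (Y - Z). *)
Lemma bsum_assoc m m' m'' (G : mindex n -> mindex n -> mindex n -> V) :
  bsum m' (fun p' s' => bsum m (fun p s => G p (p' + s) (m'' + s'))) =
  bsum m (fun p s => bsum p (fun p1 s1 => bsum (m' + s) (fun p2 s2 => G p1 p2 (m'' + s1 + s2)))).
Proof.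
elim/(@mindex_ind n): m G => [|m j IH] G.
  rewrite bsum0 bsum0 !addr0; apply: eq_bsum => p' s' _.
  by rewrite bsum0 addr0.
transitivity (bsum m' (fun p' s' => bsum m (fun p s =>
    G (p + munit j) (p' + s) (m'' + s') - G p (p' + s + munit j) (m'' + s')))).
  apply: eq_bsum => p' s' _; rewrite bsumS; apply: eq_bsum => p s _.
  by rewrite addrA.
rewrite (IH (fun p q r => G (p + munit j) q r - G p (q + munit j) r)) bsumS.
apply: eq_bsum => p s _; rewrite bsumS -bsumB; apply: eq_bsum => p1 s1 _.
rewrite [m' + (s + _)]addrA bsumS -!bsumB; apply: eq_bsum => p2 s2 _.
by rewrite [m'' + (s1 + _)]addrA [m'' + s1 + _ + s2]addrAC [m'' + s1 + (s2 + _)]addrA opprB subrKA.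
Qed.

Lemma dprodA m m' x y z : (forall m, linear (y m)) -> (forall m, linear (z m)) ->
  dprod m' (dprod m x y) z = bsum m (fun p s => dprod p x (dprod (m' + s) y z)).
Proof.
move=> yL zL; apply: distrP => m'' v.
have E r (f : mindex n -> mindex n -> distr) q u :
    (bsum r f : distr) q u = bsum r (fun p s => f p s q u).
  exact: (lin_bsum (g := fun x : distr => x q u)).
rewrite E -(bsum_assoc m m' m'' (fun p1 p2 p3 => z p3 (y p2 (x p1 v)))).
rewrite /dprod; apply: eq_bsum => p s _.
by rewrite (lin_bsum _ _ (zL _)).
Qed.

Definition local l x y : Prop := forall m, ~~ prec m l -> dprod m x y = 0.

Definition mutually_local x y : Prop := exists l, local l x y.

Lemma local_prodl l m x y z : (forall m, linear (x m)) ->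
  (forall m, linear (y m)) -> (forall m, linear (z m)) ->
  local l y z -> local l (dprod m x y) z.
Proof.
move=> xL yL zL yz m' m'l; rewrite dprodA //.
apply: (bsum_in (subspace_eq0 (V := [the lmodType k of distr]))) => s _; rewrite yz ?(precF_add_r) //.
  exact: (lin0 (dprod_linearr _ _)).
Qed.

(** The harder half of Dong's lemma. Inverted associativity leaves terms [(x<m'-s>y)<m+s>z]. A
    nonzero one needs [m' - s] admissible for [l] and, after expanding again, some [m + s + t]
    admissible for [l']; then [s <= l'], and [m'] is admissible for [l + l']. *)
Lemma local_prodr l l' m x y z : (forall m, linear (y m)) -> (forall m, linear (z m)) ->
  local l x y -> local l' y z -> local (l + l') x (dprod m y z).
Proof.
move=> yL zL xy yz m' m'l.
apply: (@bsum_inv _ _ _ (fun x => x = 0) (fun m m' => dprod m' (dprod m x y) z)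
  (fun m m' => dprod m x (dprod m' y z)) m' m) => // [|p q|s sm'].
- exact: subspace_eq0.
- exact: dprodA.
have [ms|ms] := boolP (prec (msub m' s) l); last first.
  by rewrite xy //; exact: (lin0 (dprod_linearl _ zL)).
rewrite dprodA //; apply: (bsum_in (subspace_eq0 (V := [the lmodType k of distr]))) => t _.
rewrite yz; first exact: (lin0 (dprod_linearr _ _)).
apply: contra m'l => h; rewrite -(msubK sm'); apply: prec_add ms _.
apply: mle_trans (_ : mle _ (m + s + t)) _; last by case/andP: h.
by rewrite addrAC; apply: mle_addl.
Qed.

Lemma local_lin l l' (c : k) x y z : (forall m, linear (z m)) ->
  local l x z -> local l' y z -> local (l + l') (c *: x + y) z.
Proof.
move=> zL xz yz m ml; rewrite (dprod_linearl _ zL) xz ?yz ?scaler0 ?addr0 //.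
  by apply: contra ml; rewrite addrC; apply: prec_addr.
by apply: contra ml; apply: prec_addr.
Qed.

Lemma local_linr l l' (c : k) x y z :
  local l z x -> local l' z y -> local (l + l') z (c *: x + y).
Proof.
move=> xz yz m ml; rewrite dprod_linearr xz ?yz ?scaler0 ?addr0 //.
  by apply: contra ml; rewrite addrC; apply: prec_addr.
by apply: contra ml; apply: prec_addr.
Qed.

Lemma local_derl l i x y : (forall m, linear (y m)) ->
  local l x y -> local (l + munit i) (dder i x) y.
Proof.
move=> yL xy m ml; rewrite dprod_der //.
have [->|mi] := posnP (m i); first by rewrite scale0r oppr0.
rewrite xy ?scaler0 ?oppr0 //; apply: contra ml => h.
by have := prec_add h (mle_refl (munit i)); rewrite msubK ?munit_le.
Qed.

Lemma local_derr l i x y : (forall m, linear (y m)) ->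
  local l x y -> local (l + munit i) x (dder i y).
Proof.
move=> yL xy m ml; have := dder_prod i m x yL.
rewrite (local_derl yL xy ml) add0r => <-; rewrite xy ?(lin0 (dder_linear i)) //.
by apply: contra ml; apply: prec_addr.
Qed.

End Distributions.

(** * The n-conformal algebra generated by mutually local distributions *)

Section DistributionAlgebra.
Context {k : fieldType} {n : nat} {V : lmodType k}.
Local Notation distr := (mindex n -> V -> V).
Implicit Types (x y z : distr) (m l : mindex n).

Context (L : distr -> Prop) (L_linear : forall x, L x -> forall m, linear (x m))
  (L_local : forall x y, L x -> L y -> mutually_local x y).

Inductive generated : distr -> Prop :=
| generated_gen x of L x : generated x
| generated_0 : generated 0
| generated_lin (c : k) x y of generated x & generated y : generated (c *: x + y)
| generated_prod m x y of generated x & generated y : generated (dprod m x y)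
| generated_der i x of generated x : generated (dder i x).

Lemma generated_linear x : generated x -> forall m, linear (x m).
Proof.
elim=> {x} [x /L_linear//|m c u v|c x y _ xL _ yL m c' u v|
  m x y _ xL _ yL m' c u v|i x _ xL m c u v].
- by rewrite scaler0 addr0.
- rewrite !distrZD xL yL !scalerDr !scalerA [c * c']mulrC -!addrA; congr (_ + _).
  by rewrite addrCA.
- rewrite /dprod -bsumZ -bsumD; apply: eq_bsum => p s _.
  by rewrite xL yL.
- rewrite /dder xL scalerDr opprD scalerN !scalerA; congr (- (_ *: _) + _).
  exact: mulrC.
Qed.

(** The induction on [y] quantifies over all [x]: for a product [y<m>z], Dong's lemma needs locality
    of [x] with [y] and of [y] with [z], and the latter is the hypothesis on [z] applied to [y].
    When [y] is a generator, an inner induction builds up [x]. *)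
Lemma generated_local x y : generated x -> generated y -> mutually_local x y.
Proof.
move=> gx gy; elim: gy x gx => {y} [y Ly|x gx|c y z gy IHy gz IHz x gx|
    m y z gy IHy gz IHz x gx|i y gy IHy x gx].
- have gy := generated_gen Ly; have yL := generated_linear gy.
  move=> x; elim=> {x} [x Lx||c x z _ [l xl] _ [l' zl]|m x z gx _ gz [l zl]|i x _ [l xl]].
  + exact: L_local.
  + by exists 0 => m _; apply: (lin0 (dprod_linearl _ yL)).
  + by exists (l + l'); apply: local_lin.
  + by exists l; apply: local_prodl zl => //; apply: generated_linear.
  + by exists (l + munit i); apply: local_derl.
- by exists 0 => m _; apply: (lin0 (dprod_linearr _ _)).
- have [l yl] := IHy x gx; have [l' zl] := IHz x gx.
  by exists (l + l'); apply: local_linr.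
- have [l yl] := IHy x gx; have [l' zl] := IHz y gy.
  by exists (l + l'); apply: local_prodr yl zl; apply: generated_linear.
- have [l yl] := IHy x gx; exists (l + munit i).
  by apply: local_derr yl; apply: generated_linear.
Qed.

Lemma generated_subspace : is_subspace (generated : (mindex n -> V -> V) -> Prop).
Proof. by split; [apply: generated_0|apply: generated_lin]. Qed.

Definition dalg : lmodType k := subspace_type generated_subspace.
Implicit Types (a b : dalg).

Definition dalg_prod m a b : dalg := to_subspace generated_subspace
  (generated_prod m (subspace_valP a) (subspace_valP b)).
Definition dalg_der i a : dalg := to_subspace generated_subspace
  (generated_der i (subspace_valP a)).

Lemma dalg_linear a m : linear (subspace_val a m).
Proof. exact/generated_linear/subspace_valP. Qed.

Lemma dalg_prodE m a b :
  subspace_val (dalg_prod m a b) = dprod m (subspace_val a) (subspace_val b).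
Proof. exact: to_subspaceK. Qed.
Lemma dalg_derE i a : subspace_val (dalg_der i a) = dder i (subspace_val a).
Proof. exact: to_subspaceK. Qed.

Lemma dalg_prod_linearl m b : linear (fun a => dalg_prod m a b).
Proof.
move=> c a a'; apply: subspace_val_inj.
rewrite subspace_valZD !dalg_prodE subspace_valZD.
by rewrite (dprod_linearl m (dalg_linear b)).
Qed.
Lemma dalg_prod_linearr m a : linear (dalg_prod m a).
Proof.
move=> c b b'; apply: subspace_val_inj.
by rewrite subspace_valZD !dalg_prodE subspace_valZD dprod_linearr.
Qed.
Lemma dalg_der_linear i : linear (dalg_der i).
Proof.
move=> c a a'; apply: subspace_val_inj.
by rewrite subspace_valZD !dalg_derE subspace_valZD dder_linear.
Qed.
Lemma dalg_derC i j a : dalg_der i (dalg_der j a) = dalg_der j (dalg_der i a).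
Proof. by apply: subspace_val_inj; rewrite !dalg_derE dderC. Qed.
Lemma dalg_locality a b : exists N : mindex n, forall m, ~~ prec m N -> dalg_prod m a b = 0.
Proof.
have [l abl] := generated_local (subspace_valP a) (subspace_valP b).
by exists l => m ml; apply: subspace_val_inj; rewrite dalg_prodE abl.
Qed.
Lemma dalg_der_prod i m a b : dalg_der i (dalg_prod m a b) =
  dalg_prod m (dalg_der i a) b + dalg_prod m a (dalg_der i b).
Proof.
apply: subspace_val_inj; rewrite subspace_valD !(dalg_prodE, dalg_derE).
exact: (dder_prod i m _ (dalg_linear b)).
Qed.
Lemma dalg_prod_der i m a b : dalg_prod m (dalg_der i a) b =
  - ((m i)%:R *: dalg_prod (msub m (munit i)) a b).
Proof.
apply: subspace_val_inj; rewrite subspace_valN subspace_valZ !(dalg_prodE, dalg_derE).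
exact: (dprod_der i m _ (dalg_linear b)).
Qed.

Definition dconformal : nconformal k n :=
  NConformal dalg_prod_linearl dalg_prod_linearr dalg_der_linear dalg_derC
    dalg_locality dalg_der_prod dalg_prod_der.

Lemma dconformal_assoc : cassociative dconformal.
Proof.
move=> a b c m m'; apply: subspace_val_inj.
have vL : linear (fun x : dalg => subspace_val x) by move=> ? ? ?; rewrite subspace_valZD.
rewrite [RHS](lin_bsum _ (fun p s => dalg_prod p a (dalg_prod (m' + s) b c)) vL).
rewrite !dalg_prodE (dprodA m m' _ (dalg_linear b) (dalg_linear c)).
by apply: eq_bsum => p s _; rewrite !dalg_prodE.
Qed.

End DistributionAlgebra.

(** * Functionals separating the normal words *)

Section Separation.
Context {k : fieldType} {n : nat} (N : mindex n).
Context {d : Order.disp_t} {B : orderType d}.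
Local Notation letters := (seq (B * mindex n)).
Implicit Types (m l q s : mindex n) (t w p : letters) (a b : B).

(** These functions annihilate the two-sided ideal generated by the coefficients of the [a<l>b], [l]
    forbidden, in the free associative algebra on the symbols a(m); [p] and [w] are the surrounding
    monomials. *)
Definition locfun (F : letters -> k^o) : Prop := forall p a b l m w, ~~ prec l N ->
  bsum l (fun r s => F (p ++ [:: (a, r), (b, m + s) & w])) = 0.

Lemma locfun_subspace : is_subspace (locfun : (letters -> k^o) -> Prop).
Proof.
split=> [p a b l m w lN|c F G FL GL p a b l m w lN].
  by rewrite /bsum big1 // => s _; rewrite scaler0.
transitivity (c *: bsum l (fun r s => F (p ++ [:: (a, r), (b, m + s) & w])) +
  bsum l (fun r s => G (p ++ [:: (a, r), (b, m + s) & w]))).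
  by rewrite -bsumZ -bsumD.
by rewrite FL // GL // scaler0 addr0.
Qed.

Definition locmod : lmodType k := subspace_type locfun_subspace.

Lemma locfun_cons a m (F : letters -> k^o) : locfun F -> locfun (fun w => F ((a, m) :: w)).
Proof. by move=> FL p b c l m' w lN; apply: (FL ((a, m) :: p)). Qed.

Definition letter a m (F : locmod) : locmod :=
  to_subspace locfun_subspace (locfun_cons a m (subspace_valP F)).

Lemma letter_linear a m : linear (letter a m).
Proof. by move=> c F G; apply: subspace_val_inj. Qed.

Lemma letter_local a b : local N (letter a) (letter b).
Proof.
move=> m mN; apply: distrP => m' F; apply: subspace_val_inj; apply/funext => w.
have vL : linear (fun F : locmod => subspace_val F w) by move=> ? ? ?; rewrite subspace_valZD.
rewrite [LHS](lin_bsum _ _ vL); exact: (subspace_valP F [::] a b m m' w mN).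
Qed.

(* [cf [:: (b_1, t_1); ...; (b_r, t_r)] q [:: (b_1, m_1); ...; (b_r, m_r)]] is the
   coefficient of [y_1^t_1 ... y_r^t_r] in
   [(y_1 + ... + y_r)^(m_1 + q) (y_2 + ... + y_r)^m_2 ... y_r^m_r], i.e. in
   [x_1^(m_1 + q) x_2^m_2 ... x_r^m_r] for [y_j = x_j - x_(j+1)]. Hence it kills
   [(x_j - x_(j+1))^l] unless l <= t_j. *)
Fixpoint cf t q w : k :=
  match t, w with
  | [::], [::] => (q == 0)%:R
  | (b, l) :: t', (a, m) :: w' =>
      (a == b)%:R * (mbin (m + q) l)%:R * cf t' (msub (m + q) l) w'
  | _, _ => 0
  end.

Lemma cf_shift t q a m w : cf t q ((a, m) :: w) = cf t (m + q) ((a, 0) :: w).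
Proof. by case: t => //= -[b l] t; rewrite add0r. Qed.

(** An iterated finite difference of binomial coefficients: each step lowers one coordinate of [t],
    and a step at a coordinate that is already 0 gives 0. *)
Lemma bsum_mbin l q (t : mindex n) (c : k^o) : ~~ mle l t ->
  bsum l (fun r s => (mbin (r + q) t)%:R *: c) = 0.
Proof.
elim/(@mindex_ind n): l t => [|l i IH] t lt; first by rewrite mle0 in lt.
have [ti|ti] := posnP (t i).
  rewrite bsumS /bsum big1 // => s _; rewrite addrAC mbinD1 ti mul0n addn0 subrr.
  exact: scaler0.
rewrite bsumS -[RHS](IH (msub t (munit i))).
  apply: eq_bsum => p s _; rewrite addrAC mbinD1 ti mul1n natrD scalerDl.
  by rewrite addrAC subrr add0r.
apply: contra lt => /mleP lt; apply/mleP => j; have := lt j; rewrite !mE.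
by case: eqP => [->|_]; rewrite ?subn0 ?addn0 // leq_subRL // addnC.
Qed.

(** Once the prefix is peeled off, [cf_shift] merges the two summed indices: as [r + s = l], the sum
    depends on [r] only through [mbin (r + q) l1]. The finite difference vanishes, because [l <= l1]
    would make [l] admissible. *)
Lemma cf_locfun t b q : left_factor N t -> locfun (cf (rcons t (b, 0)) q : letters -> k^o).
Proof.
move=> tN p; elim: p t q tN => [|[c m0] p IH] t q tN a a' l m w lN.
  case: t tN => [_|[b1 l1] t /andP[/= l1N tN]] /=.
    by rewrite /bsum big1 // => s _; rewrite mulr0 scaler0.
  have [_|_] := eqVneq a b1; last first.
    by rewrite /bsum big1 // => s _; rewrite !mul0r scaler0.
  rewrite -[RHS](@bsum_mbin l q l1 (cf (rcons t (b, 0)) (msub (m + l + q) l1) ((a', 0) :: w))).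
    apply: eq_bsum => r s rs; rewrite mul1r cf_shift.
    have [rl|rl] := boolP (mle l1 (r + q)); last first.
      by rewrite mbin_eq0 // mul0r scale0r.
    congr (_ * cf _ _ _); apply: mindexP => i; move/mleP: rl => /(_ i).
    by rewrite -rs !mE; lia.
  by apply: contra lN => ll1; apply: prec_down l1N.
case: t tN => [_|[b1 l1] t /andP[/= l1N tN]] /=.
  rewrite /bsum big1 // => s _; case: p {IH} => [|[? ?] ?] /=; by rewrite mulr0 scaler0.
rewrite [LHS](bsumZ (V := k^o)) (IH _ _ tN) // ; exact: scaler0.
Qed.

Lemma cf_size t q w : size t != size w -> cf t q w = 0.
Proof.
elim: t q w => [|[b l] t IH] q [|[a m] w] //= /IH ->.
exact: mulr0.
Qed.

(* The matrix coefficient, between F and the empty word, of the m-th coefficient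
   of the normal word [p D^i a], with [D^i x] acting as [dc m *: x (m - i)]. *)
Fixpoint wval p (dc : mindex n -> k) i a m (F : letters -> k^o) : k^o :=
  if p is (a1, m1) :: p' then
    bsum m1 (fun r s => wval p' dc i a (m + s) (fun w => F ((a1, r) :: w)))
  else dc m * F [:: (a, msub m i)].

Lemma wvalZ p dc i a m c F : wval p dc i a m (fun w => c * F w) = c * wval p dc i a m F.
Proof.
elim: p m F => [|[a1 m1] p IH] m F /=; first by rewrite mulrCA.
by rewrite -[RHS](bsumZ (V := k^o)); apply: eq_bsum => r s _; apply: IH.
Qed.

Lemma wval0 p dc i a m F : (forall w, size w = (size p).+1 -> F w = 0) ->
  wval p dc i a m F = 0.
Proof.
elim: p m F => [|[a1 m1] p IH] m F F0 /=; first by rewrite F0 ?mulr0.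
rewrite /bsum big1 // => s _; rewrite IH ?scaler0 // => w sw.
by rewrite F0 //= sw.
Qed.

Lemma wval_cf_cons a1 m1 p b1 l1 t b dc i a m :
  wval ((a1, m1) :: p) dc i a m (cf ((b1, l1) :: rcons t (b, 0)) 0) =
  bsum m1 (fun r s => (a1 == b1)%:R * (mbin r l1)%:R *
     wval p dc i a (m + s) (cf (rcons t (b, 0)) (msub r l1))).
Proof. by apply: eq_bsum => r s _ /=; rewrite addr0; apply: wvalZ. Qed.

(** A nonzero term needs [l1 <= m1 - s], and [l1 != m1] would make [t] the smaller sequence. So
    [l1 = m1], [s = 0], and [m] reaches the last letter unchanged, where [dc] forces [i <= m] and
    [cf] forces [m - i = 0]. *)
Lemma wval_cf p t a b i m dc : (forall m, ~~ mle i m -> dc m = 0) -> size t = size p ->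
  ~~ ((p == t) && (a == b) && (i == m)) -> ~~ tuplelt t b m p a i ->
  wval p dc i a m (cf (rcons t (b, 0)) 0) = 0.
Proof.
move=> dc0; elim: p t m => [|[a1 m1] p IH] [|[b1 l1] t] m //= => [_|[st]].
  have [->|ab] /= := eqVneq a b; last by rewrite !mul0r mulr0.
  move=> im _; have [im'|/dc0->] := boolP (mle i m); last by rewrite mul0r.
  rewrite (_ : _ == 0 = false) ?mulr0 //; apply: contraNF im => /eqP.
  by rewrite addr0 msub0 -[in i == m](msubK im') => ->; rewrite add0r.
rewrite eqseq_cons xpair_eqE => pt lt; rewrite [LHS]wval_cf_cons.
have [e1|_] := eqVneq a1 b1; last by rewrite /bsum big1 // => s _; rewrite !mul0r scaler0.
rewrite e1 eqxx ltxx /= in pt lt *.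
apply: (bsum_in (subspace_eq0 (V := k^o))) => s sm; rewrite mul1r.
have [lm|lm] := boolP (mle l1 (msub m1 s)); last first.
  by rewrite mbin_eq0 // mul0r.
have lm1 : mle l1 m1 by apply: mle_trans lm (mle_sub _ _).
have [e2|ml] := eqVneq l1 m1; last first.
  by rewrite (mle_mlexlt lm1 ml) in lt.
have s0 : s = 0.
  by apply: mindexP => j; move/mleP: lm => /(_ j); move/mleP: sm => /(_ j); rewrite e2 !mE; lia.
rewrite s0 msub0 addr0 e2 msubb.
rewrite e2 eqxx mlexlt_irr /= in pt lt.
by rewrite (IH t m st) ?mulr0.
Qed.

(** Only [s = 0] survives at each letter, so the value is [dc i]. *)
Lemma wval_cf_diag p a i dc : dc i != 0 ->
  wval p dc i a i (cf (rcons p (a, 0)) 0) != 0.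
Proof.
move=> dci; elim: p => [|[a1 m1] p IH] /=.
  rewrite eqxx msubb.
  rewrite addr0 msub0 eqxx !mulr1 mul1r mulf_neq0 // /mbin big1 ?oner_eq0 // => j _.
  by rewrite mzeroE bin0.
rewrite [X in X != 0]wval_cf_cons eqxx bsum_lead addr0 big1 => [|s s0].
  rewrite addr0 msubb.
  rewrite mul1r /mbin big1 ?mul1r // => j _.
  by rewrite binn.
rewrite mul1r; have [sm|sm] := boolP (mle s m1); last first.
  by rewrite (mbin_eq0 sm) mulr0 scale0r.
rewrite (@mbin_eq0 _ (msub m1 s) m1) ?mul0r ?scaler0 //; apply/negP => ms.
have e : msub m1 s = m1 by apply: mle_anti ms; apply: mle_sub.
by have := mlexlt_sub sm s0; rewrite e mlexlt_irr.
Qed.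

Context (char0 : [pchar k] =i pred0) {C : nconformal k n} (iota : B -> C)
  (C_free : is_free N iota).

(** The recursion makes [dc m] equal to (-1)^|i| times the product of the falling factorials m_j
    (m_j - 1) ... (m_j - i_j + 1); hence [dc i] is i! up to sign. *)
Lemma Dpow_coef i : exists dc : mindex n -> k,
  [/\ forall m, ~~ mle i m -> dc m = 0, dc i != 0 &
   forall (V : lmodType k) (L : (mindex n -> V -> V) -> Prop)
     (LL : forall x, L x -> forall m, linear (x m))
     (Ll : forall x y, L x -> L y -> mutually_local x y)
     (x : dconformal LL Ll) m v,
     subspace_val (Dpow i x : dalg L) m v = dc m *: subspace_val (x : dalg L) (msub m i) v].
Proof.
elim/(@mindex_ind n): i => [|i j [dc [dc0 dci IH]]].
  exists (fun=> 1); split=> [m||V L LL Ll x m v]; rewrite ?mle0 ?oner_eq0 //.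
  by rewrite Dpow0 msub0 scale1r.
exists (fun m => - ((m j)%:R * dc (msub m (munit j)))); split.
- move=> m im; have [->|mj] := posnP (m j); first by rewrite mul0r oppr0.
  rewrite dc0 ?mulr0 ?oppr0 //; apply: contra im => im.
  rewrite -(msubK (m := m) (s := munit j)) ?munit_le //.
  by apply/mleP => l; move/mleP: im => /(_ l); rewrite !mE leq_add2r.
- rewrite maddK oppr_eq0 mulf_neq0 // !mE eqxx.
  by move/pcharf0P: char0 => ->; rewrite addn1.
- move=> V L LL Ll x m v; rewrite DpowS.
  transitivity (dder j (subspace_val (Dpow i x : dalg L)) m v); first by [].
  by rewrite /dder IH scalerA scaleNr msubA [munit j + i]addrC.
Qed.

(** The universal property maps [C] to the distributions generated by the letters. The functional
    [ev u] takes the coefficient of index [wexp u], applies it to the dual function [cf] of the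
    prefix and last letter of [u], and evaluates at the empty list. *)
Lemma word_functionals : exists ev : word B n -> C -> k^o, forall u, in_T N u ->
  [/\ linear (ev u), ev u (nword iota u) != 0
    & forall v, v != u -> ~~ wlt u v -> ev u (nword iota v) = 0].
Proof.
pose L x := exists a, x = letter a.
have LL x : L x -> forall m, linear (x m) by case=> a -> m; apply: letter_linear.
have Ll x y : L x -> L y -> mutually_local x y.
  by case=> a -> [b ->]; exists N; apply: letter_local.
pose A := dconformal LL Ll.
pose eps a : A := to_subspace (generated_subspace L) (generated_gen (ex_intro _ a erefl)).
have [_ _ _ /(_ A eps (@dconformal_assoc _ _ _ L LL Ll))[]] := C_free.
  by move=> a b m mN; apply: subspace_val_inj; apply: letter_local.
move=> phi [[phiL phiP phiD] phi_iota _].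
pose pv (x : C) m (F : locmod) w : k^o := subspace_val (subspace_val (phi x : dalg L) m F) w.
have phiDp i x : phi (Dpow i x) = Dpow i (phi x).
  by elim/(@mindex_ind n): i => [|i j IH]; rewrite ?Dpow0 // !DpowS phiD IH.
have pvE p i a : exists dc, [/\ forall m, ~~ mle i m -> dc m = 0, dc i != 0 &
    forall m F, pv (nword iota (Word p i a)) m F [::] = wval p dc i a m (subspace_val F)].
  have [dc [dc0 dci dcE]] := Dpow_coef i; exists dc; split=> //.
  elim: p => [|[a1 m1] p IH] m F.
    by rewrite /pv /nword /= phiDp (dcE _ _ LL Ll) phi_iota.
  rewrite /pv /nword /= phiP phi_iota.
  have vL : linear (fun F : locmod => subspace_val F [::]) by move=> ? ? ?; rewrite subspace_valZD.
  rewrite [LHS](lin_bsum _ _ vL); apply: eq_bsum => r s _.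
  exact: (IH (m + s) (letter a1 r F)).
have cfL u : in_T N u -> locfun (cf (rcons (wpre u) (wlast u, 0)) 0 : letters -> k^o).
  exact: cf_locfun.
(* Outside [T] the value 0 is only a default. *)
pose ev u x : k^o := if pselect (in_T N u) is left uT
  then pv x (wexp u) (to_subspace locfun_subspace (cfL u uT)) [::] else 0.
exists ev => u uT; rewrite /ev; case: pselect => // {}uT; split.
- move=> c x y; rewrite /pv phiL.
  have E := subspace_valZD (c : k) (phi x : dalg L) (phi y : dalg L).
  have {}E m F := congr1 (fun f : mindex n -> locmod -> locmod => subspace_val (f m F) [::]) E.
  by rewrite [LHS]E.
- case: (u) uT => p i a uT; have [dc [_ dci ->]] := pvE p i a.
  exact: wval_cf_diag.
- case=> p i a vu uv; have [dc [dc0 _ ->]] := pvE p i a.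
  have [szu|szu] := eqVneq (size (wpre u)) (size p); last first.
    by apply: wval0 => w sw; rewrite /= cf_size // size_rcons sw eqSS.
  apply: wval_cf => //; last first.
    by apply: contra uv; rewrite /wlt /wlen /= szu eqxx => ->; rewrite orbT.
  apply: contra vu => /andP[/andP[/eqP-> /eqP->] /eqP->]; by case: (u).
Qed.

End Separation.

(** * Leading words *)

Section TaggedSpan.
Context {k : fieldType} {n : nat} (N : mindex n).
Context {d : Order.disp_t} {B : orderType d} {C : nconformal k n} (iota : B -> C).
Implicit Types (x y z : C) (u v w : word B n) (p q : seq (B * mindex n)).
Implicit Types (m s : mindex n) (Q R : word B n -> Prop).

(** Here [G x w] says that the generator [x] carries the word [w], and [Q] bounds these words. An
    abstract [G] lets the same estimates serve normal words and normal S-words. *)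
Definition tspan (G : C -> word B n -> Prop) Q : C -> Prop :=
  lspan (fun x => exists w, G x w /\ Q w).

Context (G : C -> word B n -> Prop).

Lemma tspan_subspace Q : is_subspace (tspan G Q).
Proof. exact: lspan_subspace. Qed.

Lemma tspan0 Q : tspan G Q 0.
Proof. exact: subspace0 (tspan_subspace Q). Qed.

Lemma tspanD Q x y : tspan G Q x -> tspan G Q y -> tspan G Q (x + y).
Proof. exact: subspaceD (tspan_subspace Q). Qed.

Lemma tspanN Q x : tspan G Q x -> tspan G Q (- x).
Proof. exact: subspaceN (tspan_subspace Q). Qed.

Lemma tspanZ Q c x : tspan G Q x -> tspan G Q (c *: x).
Proof. exact: subspaceZ (tspan_subspace Q). Qed.

Lemma tspanBD Q x y : tspan G Q (x - y) -> tspan G Q y -> tspan G Q x.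
Proof. exact: subspaceBD (tspan_subspace Q). Qed.

Lemma tspan_trans Q x y z : tspan G Q (x - y) -> tspan G Q (y - z) -> tspan G Q (x - z).
Proof. exact: subspace_trans (tspan_subspace Q). Qed.

Lemma tspan_sym Q x y : tspan G Q (x - y) -> tspan G Q (y - x).
Proof. exact: subspace_sym (tspan_subspace Q). Qed.

Lemma tspan_gen Q x w : G x w -> Q w -> tspan G Q x.
Proof. by move=> Gx Qw; apply: lspan_gen; exists w. Qed.

Lemma tspan_map Q R (f : C -> C) x : linear f ->
  (forall y w, G y w -> Q w -> tspan G R (f y)) -> tspan G Q x -> tspan G R (f x).
Proof.
move=> fL fQ; apply: (lspan_map fL); first exact: tspan_subspace.
by move=> y [w [Gy Qw]]; apply: fQ Gy Qw.
Qed.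

Lemma tspan_mono Q R x : (forall w, Q w -> R w) -> tspan G Q x -> tspan G R x.
Proof. by move=> QR; apply: lspan_mono => y [w [Gy Qw]]; exists w; split=> //; apply: QR. Qed.

Definition len_le l w := (wlen w <= l)%N.
Definition below w v := wlt v w.

Lemma tspan_below_len w x : tspan G (below w) x -> tspan G (len_le (wlen w)) x.
Proof. by apply: tspan_mono => v; apply: wlt_len. Qed.

Lemma tspan_len_leq l l' x : (l <= l')%N -> tspan G (len_le l) x -> tspan G (len_le l') x.
Proof. by move=> ll'; apply: tspan_mono => w wl; apply: leq_trans ll'. Qed.

Context (assoc : cassociative C).
Context (G_prefix : forall x w a m, G x w -> prec m N ->
  G (iota a ⟨m⟩ x) (lcat [:: (a, m)] w)).

Lemma bracket_prefix x w p : G x w -> left_factor N p ->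
  G (bracket iota p x) (lcat p w).
Proof.
move=> Gx; elim: p => [_|[a m] p IH /andP[/= mN /IH Gp]]; first by rewrite lcat0.
by rewrite -[lcat (_ :: _) _](lcatA [:: (a, m)] p); apply: G_prefix.
Qed.

Lemma tspan_bracket Q R p x : left_factor N p -> (forall w, Q w -> R (lcat p w)) ->
  tspan G Q x -> tspan G R (bracket iota p x).
Proof.
move=> pN QR; apply: tspan_map; first exact: bracket_linear.
by move=> y w Gy Qw; apply: tspan_gen (bracket_prefix Gy pN) _; apply: QR.
Qed.

Lemma tspan_prefix Q R a m x : prec m N -> (forall w, Q w -> R (lcat [:: (a, m)] w)) ->
  tspan G Q x -> tspan G R (iota a ⟨m⟩ x).
Proof. by move=> mN QR; apply: (@tspan_bracket Q R [:: (a, m)]); rewrite // /left_factor /= mN. Qed.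

Lemma tspan_bracket_below p w x : left_factor N p -> tspan G (below w) x ->
  tspan G (below (lcat p w)) (bracket iota p x).
Proof. by move=> pN; apply: tspan_bracket => // v; rewrite /below wlt_lcat. Qed.

Lemma tspan_prefix_len l a m x : prec m N -> tspan G (len_le l) x ->
  tspan G (len_le l.+1) (iota a ⟨m⟩ x).
Proof. by move=> mN; apply: tspan_prefix => // w; rewrite /len_le wlen_lcat add1n ltnS. Qed.

Lemma tspan_head_below a m m' w x : prec m' N -> mlexlt m' m ->
  tspan G (len_le (wlen w)) x -> tspan G (below (lcat [:: (a, m)] w)) (iota a ⟨m'⟩ x).
Proof. by move=> mN mm'; apply: tspan_prefix => // v vw; apply: wlt_head. Qed.

Context (G_left : forall x w a m, G x w ->
  tspan G (len_le (wlen w).+1) (iota a ⟨m⟩ x)).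

Lemma tspan_left l a m x : tspan G (len_le l) x -> tspan G (len_le l.+1) (iota a ⟨m⟩ x).
Proof.
apply: tspan_map; first exact: (cprod_linearr m (iota a)).
by move=> y w Gy wl; apply: tspan_len_leq (G_left a m Gy); rewrite ltnS.
Qed.

Lemma tspan_nword_prod l u m x : in_T N u -> tspan G (len_le l) x ->
  tspan G (len_le (wlen u + l)) (nword iota u ⟨m⟩ x).
Proof.
case: u => p i a; rewrite /in_T /nword /wlen /= => pN xl.
elim: p m pN => [|[b m1] p IH] m => [_|/andP[/= m1N pN]].
  by apply: cprod_Dpowl => [|m']; [apply: tspan_subspace|apply: tspan_left].
apply: assoc_in => // [|s _]; first exact: tspan_subspace.
apply: tspan_prefix_len; first exact: prec_sub.
exact: IH.
Qed.

Lemma tspan_nword_lead u m x w : in_T N u -> wexp u = 0 -> tspan G (len_le (wlen w)) x ->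
  tspan G (below (wcat u m w))
    (nword iota u ⟨m⟩ x - bracket iota (rcons (wpre u) (wlast u, m)) x).
Proof.
case: u => p i a /=; rewrite /in_T /nword /= => pN -> xl.
elim: p m pN => [|[b m1] p IH] m /= => [_|/andP[/= m1N pN]].
  by rewrite Dpow0 subrr; exact: tspan0.
pose y := bracket iota p (Dpow 0 (iota a)).
apply: (@tspan_trans _ _ (iota b ⟨m1⟩ (y ⟨m⟩ x))).
  have -> : wcat (Word ((b, m1) :: p) 0 a) m w = lcat [:: (b, m1)] (wcat (Word p 0 a) m w) by [].
  apply: assoc_lead => // [|s sm s0]; first exact: tspan_subspace.
  apply: tspan_head_below; [exact: prec_sub|exact: mlexlt_sub|].
  by rewrite wlen_wcat; apply: (tspan_nword_prod (u := Word p 0 a)).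
rewrite -cprodBr; apply: tspan_prefix (IH m pN) => // v.
by rewrite /below -(wlt_lcat [:: (b, m1)]).
Qed.

(** In the Leibniz rule a derivation hitting a letter of [p] lowers the index after it, so only the
    term reaching [x] counts; [y] is any representative of [cder i x] modulo smaller words. *)
Lemma tspan_cder_bracket p i x y w : left_factor N p -> G x w ->
  tspan G (below (wD w (munit i))) (cder i x - y) ->
  tspan G (below (lcat p (wD w (munit i)))) (cder i (bracket iota p x) - bracket iota p y).
Proof.
move=> pN Gx xy; elim: p pN => [|[b m] p IH] => [_|/andP[/= mN pN]]; first by rewrite lcat0.
rewrite cder_prod -addrA -cprodBr cprod_der.
have -> : lcat ((b, m) :: p) (wD w (munit i)) = lcat [:: (b, m)] (wD (lcat p w) (munit i)) by [].
apply: tspanD; last by apply: tspan_prefix (IH pN) => // v; rewrite /below wD_lcat wlt_lcat.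
have [->|mi] := posnP (m i); first by rewrite scale0r oppr0; apply: tspan0.
apply/tspanN/tspanZ/tspan_head_below; first exact: prec_sub; last first.
  by apply: tspan_gen (bracket_prefix Gx pN) _; apply: leqnn.
apply: mlexlt_sub; rewrite ?munit_le //.
by apply/eqP => /(congr1 mdeg); rewrite mdeg_munit mdeg0.
Qed.

Context (G_cder : forall x w i, G x w -> exists y, G y (wD w (munit i)) /\
  tspan G (below (wD w (munit i))) (cder i x - y)).

Lemma tspan_cder_below i w x : tspan G (below w) x ->
  tspan G (below (wD w (munit i))) (cder i x).
Proof.
apply: tspan_map; first exact: cder_linear.
move=> y v Gy vw; have [z [Gz yz]] := G_cder i Gy.
have vw' : below (wD w (munit i)) (wD v (munit i)) by apply: wlt_wD.
apply: tspanBD (tspan_gen Gz vw').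
by apply: tspan_mono yz => u uv; apply: wlt_trans vw'.
Qed.

Lemma tspan_cder_len l i x : tspan G (len_le l) x -> tspan G (len_le l) (cder i x).
Proof.
apply: tspan_map; first exact: cder_linear.
move=> y v Gy vl; have [z [Gz yz]] := G_cder i Gy.
apply: tspanBD (tspan_gen Gz _); last exact: vl.
by apply: tspan_len_leq (tspan_below_len yz).
Qed.

Lemma tspan_Dpow_below i w x : tspan G (below w) x -> tspan G (below (wD w i)) (Dpow i x).
Proof.
move=> xw; elim/(@mindex_ind n): i => [|i j IH]; first by rewrite wD0 Dpow0.
by rewrite -wDD DpowS; apply: tspan_cder_below.
Qed.

Lemma tspan_Dpow_lead (F : mindex n -> C) w :
  (forall i j, tspan G (below (wD w (i + munit j))) (cder j (F i) - F (i + munit j))) ->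
  forall i, tspan G (below (wD w i)) (Dpow i (F 0) - F i).
Proof.
move=> FS; elim/(@mindex_ind n)=> [|i j IH]; first by rewrite Dpow0 subrr; apply: tspan0.
apply: tspan_trans (FS i j); rewrite DpowS -cderB -wDD.
exact: tspan_cder_below.
Qed.

End TaggedSpan.

(** * Expansions in normal words and leading terms *)

Section NormalWords.
Context {k : fieldType} (char0 : [pchar k] =i pred0) {n : nat} {N : mindex n}.
Context {d : Order.disp_t} {B : orderType d} {C : nconformal k n} {iota : B -> C}.
Context (C_free : is_free N iota).
Implicit Types (x y z f g : C) (u v w : word B n) (p q : seq (B * mindex n)).
Implicit Types (m s : mindex n) (Q R : word B n -> Prop) (r : seq (word B n)).

Lemma free_assoc : cassociative C. Proof. by case: C_free. Qed.
Lemma free_local : local_on N iota. Proof. by case: C_free. Qed.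

(** The proposition [dfree] is a switch: [True] restricts to D-free words, [False] admits all words,
    and generic statements prove both versions at once. *)
Definition is_nword (dfree : Prop) x u : Prop :=
  [/\ in_T N u, dfree -> wexp u = 0 & x = nword iota u].

Local Notation wspan dfree := (tspan (is_nword dfree)).

Lemma wspan_nword (dfree : Prop) Q u : in_T N u -> (dfree -> wexp u = 0) -> Q u ->
  wspan dfree Q (nword iota u).
Proof. by move=> uT u0; apply: tspan_gen. Qed.

Lemma is_nword_prefix dfree x w a m : is_nword dfree x w -> prec m N ->
  is_nword dfree (iota a ⟨m⟩ x) (lcat [:: (a, m)] w).
Proof. by move=> [wT w0 ->] mN; split=> //; rewrite in_T_lcat /left_factor /= mN. Qed.

Lemma cder_nword u i : in_T N u -> wspan False (below (wD u (munit i)))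
  (cder i (nword iota u) - nword iota (wD u (munit i))).
Proof.
case: u => p j a pN.
have nw := @tspan_cder_bracket _ _ N _ _ _ iota (is_nword False) _ p i (Dpow j (iota a))
  (Dpow (j + munit i) (iota a)) (Word [::] j a) pN.
have -> : wD (Word p j a) (munit i) = lcat p (wD (Word [::] j a) (munit i)).
  by rewrite /lcat /= cats0.
by rewrite /nword /= cats0; apply: nw => //; first exact: is_nword_prefix;
  rewrite DpowS subrr; apply: tspan0.
Qed.

Lemma is_nword_cder x w i : is_nword False x w -> exists y,
  is_nword False y (wD w (munit i)) /\
  wspan False (below (wD w (munit i))) (cder i x - y).
Proof.
move=> [wT _ ->]; exists (nword iota (wD w (munit i))); split=> //.
exact: cder_nword.
Qed.

(** Single letters obey locality; for longer words [cprod_reduce] trades a forbidden index for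
    admissible ones without lengthening the word. *)
Lemma is_nword_left dfree x w a m : is_nword dfree x w ->
  wspan dfree (len_le (wlen w).+1) (iota a ⟨m⟩ x).
Proof.
case: w => p i b [pN i0 ->] {x}; rewrite /in_T /= in pN i0.
have sP l : is_subspace (wspan dfree (len_le l)) by apply: tspan_subspace.
elim: p pN a m => [_|[b1 m1] p IH /andP[/= m1N pN]] a m.
  have ab m' : wspan dfree (len_le 2) (iota a ⟨m'⟩ iota b).
    have [m'N|/free_local->] := boolP (prec m' N); last exact: subspace0.
    rewrite -[iota b]Dpow0; apply: (@wspan_nword _ _ (Word [:: (a, m')] 0 b)) => //.
    by rewrite /in_T /left_factor /= m'N.
  have [i00|i00] := eqVneq i 0; first by rewrite /nword /= i00 Dpow0.
  (* A nonzero exponent is only possible when [dfree] fails, and then the span is stable under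
     derivations. *)
  have dF : dfree -> False by move/i0/eqP; rewrite (negPf i00).
  have dE : wspan dfree = wspan False.
    by rewrite (_ : dfree = False) //; apply: propext; split.
  rewrite dE in ab *; apply: cprod_Dpowr => //; first exact: tspan_subspace.
  by move=> j z; apply: (tspan_cder_len is_nword_cder).
apply: (cprod_reduce free_assoc (N := N) (M := wspan dfree (len_le (size p).+2))) => //.
- by move=> q qN; apply: free_local.
- by move=> q; apply: IH.
- by move=> q z qN zM; apply: (tspan_prefix_len (N := N)) zM => // *; apply: is_nword_prefix.
Qed.

Lemma wspan_left dfree l a m x : wspan dfree (len_le l) x ->
  wspan dfree (len_le l.+1) (iota a ⟨m⟩ x).
Proof. by apply: tspan_left => y w b q; apply: is_nword_left. Qed.

(** Derivations in the left factor are absorbed by the index, so D-freeness of the product depends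
    on [y] only. *)
Lemma wspan_prod dfree l l' m x y : wspan False (len_le l) x -> wspan dfree (len_le l') y ->
  wspan dfree (len_le (l + l')) (x ⟨m⟩ y).
Proof.
move=> xl yl; apply: (lspan_map (cprod_linearl m y)) xl; first exact: tspan_subspace.
move=> z [w [[wT _ ->] wl]]; apply: (@tspan_len_leq _ _ _ _ _ _ (wlen w + l')).
  by rewrite leq_add2r; exact: wl.
apply: (tspan_nword_prod (N := N)) => //; first exact: free_assoc.
  by move=> *; apply: is_nword_prefix.
by move=> *; apply: is_nword_left.
Qed.

Lemma nword_lcat p u : nword iota (lcat p u) = bracket iota p (nword iota u).
Proof. by rewrite /nword /= bracket_cat. Qed.

Lemma Dpow_nword u i : in_T N u ->
  wspan False (below (wD u i)) (Dpow i (nword iota u) - nword iota (wD u i)).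
Proof.
move=> uT; have := @tspan_Dpow_lead _ _ _ _ _ (is_nword False) is_nword_cder
  (fun i => nword iota (wD u i)) u _ i.
rewrite wD0; apply=> {}i j; rewrite -wDD.
exact: (cder_nword (u := wD u i)).
Qed.

Lemma nword_prod u m v : in_T N u -> wexp u = 0 -> in_T N v ->
  wspan False (below (wcat u m v)) (nword iota u ⟨m⟩ nword iota v - nword iota (wcat u m v)).
Proof.
move=> uT u0 vT; rewrite nword_lcat; apply: (tspan_nword_lead (N := N)) => //.
- exact: free_assoc.
- by move=> *; apply: is_nword_prefix.
- by move=> *; apply: is_nword_left.
- by apply: wspan_nword => //; apply: leqnn.
Qed.

Definition anyword (w : word B n) := True.

Lemma wspan_all x : wspan False anyword x.
Proof.
have [_ gen _ _] := C_free; apply: (gen (wspan False anyword)) => {x} [|b]; last first.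
  by rewrite -[iota b]Dpow0; apply: (@wspan_nword _ _ (Word [::] 0 b)).
have sP : is_subspace (wspan False anyword) by apply: tspan_subspace.
split=> // [m x y xW|i x].
  apply: (lspan_map (cprod_linearr m x)) => // _ [v [[vT _ ->] _]].
  apply: (lspan_map (cprod_linearl m _) (P := wspan False anyword)) xW => // _ [u [[uT _ ->] _]].
  apply: (@tspan_mono _ _ _ _ _ _ (len_le (wlen u + wlen v))) => //.
  by apply: wspan_prod; apply: wspan_nword => //; apply: leqnn.
apply: tspan_map => [|_ w [wT _ ->] _]; first exact: cder_linear.
apply: (@tspan_mono _ _ _ _ _ _ (len_le (wlen w))) => //.
apply: (tspan_cder_len is_nword_cder).
by apply: wspan_nword => //; apply: leqnn.
Qed.

Lemma restricted_sum (r r1 : seq (word B n)) (c : word B n -> k) :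
  uniq r -> uniq r1 -> {subset r1 <= r} ->
  \sum_(u <- r) (if u \in r1 then c u else 0) *: nword iota u =
  \sum_(u <- r1) c u *: nword iota u.
Proof.
move=> ur ur1 sub; under eq_bigr => u _.
  rewrite (_ : _ *: _ = if u \in r1 then c u *: nword iota u else 0); last first.
    by case: ifP; rewrite ?scale0r.
over.
rewrite -big_mkcond -big_filter; apply: perm_big; apply: uniq_perm => [||u] //.
  exact: filter_uniq.
by rewrite mem_filter; apply: andb_idr; apply: sub.
Qed.

Lemma wspan_expansion Q x : wspan False Q x ->
  exists r c, expansion N iota x r c /\ forall u, u \in r -> Q u.
Proof.
move=> xQ; suff [r [c [ur rQ ->]]] : exists r (c : word B n -> k), [/\ uniq r,
    forall u, u \in r -> in_T N u /\ Q u & x = \sum_(u <- r) c u *: nword iota u].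
  exists [seq u <- r | c u != 0], c; split; last first.
    by move=> u; rewrite mem_filter => /andP[_ /rQ[]].
  split; first exact: filter_uniq.
    by move=> u; rewrite mem_filter => /andP[cu /rQ[]].
  rewrite big_filter [RHS]big_mkcond; apply: eq_bigr => u _ /=.
  by case: eqP => // ->; rewrite scale0r.
apply: (lspan_min (P := fun x => exists r (c : word B n -> k), [/\ uniq r,
    forall u, u \in r -> in_T N u /\ Q u & x = \sum_(u <- r) c u *: nword iota u])) xQ;
    last first.
  move=> y [u [[uT _ ->] Qu]]; exists [:: u], (fun=> 1).
  by split=> // [v|]; rewrite ?inE ?big_seq1 ?scale1r // => /eqP->.
split=> [|a y z [r1 [c1 [ur1 r1Q ->]]] [r2 [c2 [ur2 r2Q ->]]]].
  by exists [::], (fun=> 0); split; rewrite ?big_nil.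
pose r := undup (r1 ++ r2).
exists r, (fun u => a * (if u \in r1 then c1 u else 0) + (if u \in r2 then c2 u else 0)).
have ur : uniq r by apply: undup_uniq.
split=> // [u|]; first by rewrite mem_undup mem_cat => /orP[/r1Q|/r2Q].
under [RHS]eq_bigr do rewrite scalerDl -scalerA.
rewrite big_split -scaler_sumr !restricted_sum // => u ur'; by rewrite mem_undup mem_cat ur' ?orbT.
Qed.

Lemma exists_max_word r : r != [::] ->
  exists2 u, u \in r & forall v, v \in r -> v != u -> wlt v u.
Proof.
elim: r => // u r IH _; have [r0|/IH[v vr vmax]] := eqVneq r [::].
  by exists u; rewrite r0 ?inE // => v; rewrite inE => ->.
case/or3P: (wlt_total u v) => [/eqP uv|uv|vu].
- exists v; first by rewrite inE vr orbT.
  by move=> w; rewrite inE uv => /orP[->//|/vmax].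
- exists v; first by rewrite inE vr orbT.
  by move=> w; rewrite inE => /orP[/eqP->//|/vmax].
- exists u; first by rewrite inE eqxx.
  move=> w; rewrite inE => /orP[->//|wr _].
  by have [->//|/(vmax _ wr)/wlt_trans] := eqVneq w v; apply.
Qed.

(** The functional of the largest word with nonzero coefficient annihilates all the other terms. *)
Lemma nword_free r (c : word B n -> k) : uniq r -> (forall u, u \in r -> in_T N u) ->
  \sum_(u <- r) c u *: nword iota u = 0 -> forall u, u \in r -> c u = 0.
Proof.
move=> ur rT sum0 u ru; apply/eqP/negPn/negP => cu.
have : [seq v <- r | c v != 0] != [::].
  by apply/eqP => /(congr1 (fun l : seq (word B n) => u \in l)); rewrite mem_filter cu ru.
case/exists_max_word => v; rewrite mem_filter => /andP[cv vr] vmax.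
have [ev evP] := word_functionals char0 C_free; have [evL evv ev0] := evP v (rT v vr).
have := congr1 (ev v) sum0; rewrite (lin0 evL) (lin_sum evL) (bigD1_seq v) //= big1_seq.
  by move/eqP; rewrite addr0 (linZ evL) scaler_eq0 (negPf cv) (negPf evv).
move=> w /andP[wv wr]; rewrite (linZ evL); have [->|cw] := eqVneq (c w) 0; first exact: scale0r.
rewrite ev0 ?scaler0 //; apply: wlt_asym; apply: vmax wv.
by rewrite mem_filter cw.
Qed.

Lemma expansion_sub x r c r' c' : expansion N iota x r c -> expansion N iota x r' c' ->
  forall u, u \in r -> u \in r' /\ c u = c' u.
Proof.
move=> [ur rT xr] [ur' r'T xr'].
pose R := undup (r ++ r'); have uR : uniq R by apply: undup_uniq.
have sr : {subset r <= R} by move=> u ru; rewrite mem_undup mem_cat ru.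
have sr' : {subset r' <= R} by move=> u ru; rewrite mem_undup mem_cat ru orbT.
have := @nword_free R (fun u => (if u \in r then c u else 0) - (if u \in r' then c' u else 0)) uR.
under [X in X = 0 -> _]eq_bigr do rewrite scalerBl.
rewrite sumrB !restricted_sum // -xr -xr' subrr => h u ru.
have := h _ erefl u (sr u ru); rewrite ru => {}h.
have [r'u|r'u] := boolP (u \in r').
  split=> //; apply/eqP; rewrite -subr_eq0; apply/eqP; move: h; rewrite r'u; apply.
  by move=> v; rewrite mem_undup mem_cat => /orP[/rT[]|/r'T[]].
have [_ /eqP[]] := rT u ru; rewrite (negPf r'u) subr0 in h; apply: h.
by move=> v; rewrite mem_undup mem_cat => /orP[/rT[]|/r'T[]].
Qed.

Lemma wspan_occurs Q x u : wspan False Q x -> occurs N iota x u -> Q u.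
Proof.
move=> /wspan_expansion[r' [c' [xr' r'Q]]] [r [c [xr ru]]].
by have [/r'Q] := expansion_sub xr xr' ru.
Qed.

Lemma expansion_wspan x r c Q : expansion N iota x r c -> (forall u, u \in r -> Q u) ->
  wspan False Q x.
Proof.
move=> [_ rT ->] rQ; apply: subspace_sum; first exact: tspan_subspace.
move=> u ru _; apply: tspanZ; apply: wspan_nword => //; last exact: rQ.
by case: (rT u ru).
Qed.

Lemma occurs_wspan Q x : (forall u, occurs N iota x u -> Q u) -> wspan False Q x.
Proof.
move=> xQ; have [r [c [xr _]]] := wspan_expansion (wspan_all x).
apply: (expansion_wspan xr) => u ru; apply: xQ; by exists r, c.
Qed.

(** Uniqueness of expansions turns a condition on occurring words into membership in a span, which
    is easy to propagate through the operations. *)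
Lemma DfreeP x : Dfree N iota x <-> wspan True anyword x.
Proof.
split=> [x0|xs u].
  have := @occurs_wspan (fun u => wexp u = 0) x x0.
  by apply: lspan_mono => y [w [[wT _ ->] w0]]; exists w.
apply: (@wspan_occurs (fun u => wexp u = 0)); move: xs.
by apply: lspan_mono => y [w [[wT w0 ->] _]]; exists w; split; [split|apply: w0].
Qed.

Lemma Dfree_wspan Q x : Dfree N iota x -> wspan False Q x -> wspan True Q x.
Proof.
move=> x0 xQ; have := @occurs_wspan (fun u => wexp u = 0 /\ Q u) x.
suff h : forall u, occurs N iota x u -> wexp u = 0 /\ Q u.
  move/(_ h); by apply: lspan_mono => y [w [[wT _ ->] [w0 wQ]]]; exists w.
by move=> u xu; split; [exact: x0|exact: wspan_occurs xQ xu].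
Qed.

Lemma Dfree_subspace : is_subspace (Dfree N iota).
Proof.
have [h0 hD] := tspan_subspace (is_nword True) anyword.
by split=> [|c x y /DfreeP x0 /DfreeP y0]; apply/DfreeP; [exact: h0|exact: hD].
Qed.

(** The leading term without reference to an expansion, in a form suited to congruences modulo
    smaller words. *)
Definition lterm x u (a : k) : Prop :=
  [/\ in_T N u, a != 0 & wspan False (below u) (x - a *: nword iota u)].

Lemma leading_termP x u a : leading_term N iota x u a <-> lterm x u a.
Proof.
split=> [[r [c [xr ru rmax <-]]]|[uT a0 xu]].
  have [ur rT xE] := xr; have [uT cu] := rT u ru; split=> //.
  rewrite xE (bigD1_seq u) //= addrAC subrr add0r.
  apply: subspace_sum; first exact: tspan_subspace.
  move=> v vr vu; apply: tspanZ; apply: wspan_nword => //; last exact: rmax.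
  by case: (rT v vr).
have [r [c [[ur rT xE] rQ]]] := wspan_expansion xu.
have ur' : u \notin r by apply/negP => /rQ; rewrite /below wlt_irr.
exists (u :: r), (fun v => if v == u then a else c v); split.
- split=> [|v|]; rewrite /= ?ur' ?ur //.
    by rewrite inE; case: eqVneq => [->//|_ /= /rT].
  rewrite big_cons eqxx; apply/eqP; rewrite addrC -subr_eq xE; apply/eqP.
  apply: eq_big_seq => v vr; case: eqP => // vu; by rewrite -vu vr in ur'.
- exact: mem_head.
- by move=> v; rewrite inE => /orP[/eqP->|/rQ//]; rewrite eqxx.
- by rewrite eqxx.
Qed.

(** If the words differed, the functional of the larger one would vanish on [x] by one description
    and not by the other; if they agree, it compares the coefficients. *)
Lemma lterm_inj x u a v b : lterm x u a -> lterm x v b -> u = v /\ a = b.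
Proof.
have [ev evP] := word_functionals char0 C_free.
have low_ev u' y : in_T N u' -> wspan False (below u') y -> ev u' y = 0.
  move=> uT; have [evL _ ev0] := evP u' uT.
  apply: (lspan_min (P := fun y => ev u' y = 0)) => [|_ [w [[wT _ ->] wu]]]; last first.
    by apply: ev0; [apply: wlt_neq wu|apply: wlt_asym wu].
  by split=> [|c z t z0 t0]; rewrite ?(lin0 evL) // evL z0 t0 scaler0 addr0.
have evE u' a' y : lterm y u' a' -> ev u' y = a' *: ev u' (nword iota u').
  move=> [uT _ yu]; have [evL _ _] := evP u' uT.
  by apply/eqP; rewrite -subr_eq0 -(linZ evL) -(linB evL) low_ev.
have nlt u' a' v' b' : lterm x u' a' -> lterm x v' b' -> ~~ wlt u' v'.
  move=> [uT _ xu] xv; apply/negP => uv.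
  have [vT b0 _] := xv; have [evL evv _] := evP v' vT.
  have /eqP := evE _ _ _ xv; rewrite low_ev //; last first.
    apply: (tspanBD (y := a' *: nword iota u')).
      by apply: tspan_mono xu => w wu; apply: wlt_trans uv.
    by apply: tspanZ; apply: wspan_nword.
  by rewrite eq_sym scaler_eq0 (negPf b0) (negPf evv).
move=> xu xv; case/or3P: (wlt_total u v) => [/eqP uv|uv|vu].
- split=> //; rewrite -uv in xv; have [uT _ _] := xu; have [_ evu _] := evP u uT.
  have := evE _ _ _ xu; rewrite (evE _ _ _ xv) => /eqP.
  by rewrite -subr_eq0 -scalerBl scaler_eq0 (negPf evu) orbF subr_eq0 eq_sym => /eqP.
- by have := nlt _ _ _ _ xu xv; rewrite uv.
- by have := nlt _ _ _ _ xv xu; rewrite vu.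
Qed.

Lemma leading_inj x u v : leading N iota x u -> leading N iota x v -> u = v.
Proof.
by move=> [a /leading_termP xu] [b /leading_termP xv]; have [] := lterm_inj xu xv.
Qed.

Lemma leading_monic x u : is_monic N iota x -> leading N iota x u -> lterm x u 1.
Proof.
move=> [v /leading_termP xv] [a /leading_termP xu].
by have [-> _] := lterm_inj xu xv.
Qed.

Lemma exists_lterm Q x : wspan False Q x -> x != 0 -> exists u a, Q u /\ lterm x u a.
Proof.
move=> /wspan_expansion[r [c [xr rQ]]] x0; have [ur rT xE] := xr.
have : r != [::] by apply: contra x0 => /eqP r0; rewrite xE r0 big_nil.
case/exists_max_word => u ru umax; exists u, (c u); split; first exact: rQ.
by apply/leading_termP; exists r, c.
Qed.

Lemma lterm_occurs x u a : lterm x u a -> occurs N iota x u.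
Proof. by move=> /leading_termP[r [c [xr ru _ _]]]; exists r, c. Qed.

Lemma lterm_leading x u a : lterm x u a -> leading N iota x u.
Proof. by move=> xu; exists a; apply/leading_termP. Qed.

Lemma lterm_mem Q x u a : wspan False Q x -> lterm x u a -> Q u.
Proof. by move=> xQ /lterm_occurs; apply: wspan_occurs. Qed.

Lemma lterm_len x u a : lterm x u a -> wspan False (len_le (wlen u)) x.
Proof.
move=> [uT _ xu]; apply: tspanBD (tspan_below_len xu) _.
by apply: tspanZ; apply: wspan_nword => //; apply: leqnn.
Qed.

End NormalWords.

(** * The ideal spanned by the normal S-words *)

Section SWords.
Context {k : fieldType} (char0 : [pchar k] =i pred0) {n : nat} {N : mindex n}.
Context {d : Order.disp_t} {B : orderType d} {C : nconformal k n} {iota : B -> C}.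
Context (C_free : is_free N iota) {S : C -> Prop}.
Context (S_monic : forall s, S s -> is_monic N iota s).
Implicit Types (x y z f g h s : C) (u v w sb : word B n) (p q : seq (B * mindex n)).
Implicit Types (m i : mindex n) (Q R : word B n -> Prop) (r : seq (word B n)).
Local Notation wspan dfree := (tspan (is_nword (N := N) (iota := iota) dfree)).
Local Notation sspan := (tspan (nSword N iota S)).
Local Notation lterm := (lterm (N := N) (iota := iota)).

(* The normal S-words with empty left factor, first kind with b empty being
   second kind with i = 0. *)
Variant nScore : C -> word B n -> Prop :=
| NScore1 s sb m v of S s & Dfree N iota s & leading N iota s sb & prec m N & in_T N v :
    nScore (s ⟨m⟩ nword iota v) (wcat sb m v)
| NScore2 s sb i of S s & leading N iota s sb : nScore (Dpow i s) (wD sb i).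

Lemma nSwordP x w : nSword N iota S x w <-> exists p y v,
  [/\ left_factor N p, nScore y v, x = bracket iota p y & w = lcat p v].
Proof.
split=> [[p s sb [[m v]|] Ss s0 ssb pN /= tN|p s sb i Ss ssb pN]|].
- exists p, (s ⟨m⟩ nword iota v), (wcat sb m v); split=> //.
  by case/andP: tN; apply: NScore1.
- exists p, (Dpow 0 s), (wD sb 0); split; rewrite ?Dpow0 ?wD0 //.
  by rewrite -{1}[s]Dpow0 -[sb in X in _ X]wD0; apply: NScore2.
- by exists p, (Dpow i s), (wD sb i); split=> //; apply: NScore2.
move=> [p [y [v [pN [s sb m {}v Ss s0 ssb mN vT|s sb i Ss ssb] -> ->]]]].
  by apply: (NSword1 (t := Some (m, v))) => //=; rewrite mN.
exact: NSword2.
Qed.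

Lemma nScore_nSword x w : nScore x w -> nSword N iota S x w.
Proof. by move=> xw; apply/nSwordP; exists [::], x, w; rewrite lcat0. Qed.

Lemma nSword_prefix x w a m : nSword N iota S x w -> prec m N ->
  nSword N iota S (iota a ⟨m⟩ x) (lcat [:: (a, m)] w).
Proof.
move=> /nSwordP[p [y [v [pN yv -> ->]]]] mN; apply/nSwordP.
by exists ((a, m) :: p), y, v; split=> //; rewrite /left_factor /= mN.
Qed.

Lemma nSword_bracket x w p : nSword N iota S x w -> left_factor N p ->
  nSword N iota S (bracket iota p x) (lcat p w).
Proof. by move=> xw; apply: bracket_prefix xw => *; apply: nSword_prefix. Qed.

Lemma Scombination_lspan h (Q : C -> word B n -> Prop) :
  Scombination N iota S h Q <->
  lspan (fun x => exists w, nSword N iota S x w /\ Q x w) h.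
Proof.
split=> [[r [-> rQ]]|/lspan_sum[r [-> rQ]]]; last by exists r.
exact: sum_lspan.
Qed.

Lemma S_lterm s sb : S s -> leading N iota s sb -> lterm s sb 1.
Proof. by move/S_monic; apply: leading_monic. Qed.

Lemma lterm_below x u a : lterm x u a -> wspan False (below u) (x - a *: nword iota u).
Proof. by case. Qed.

Lemma S_below s sb : S s -> leading N iota s sb -> wspan False (below sb) (s - nword iota sb).
Proof. by move=> Ss /(S_lterm Ss) /lterm_below; rewrite scale1r. Qed.

Lemma S_in_T s sb : S s -> leading N iota s sb -> in_T N sb.
Proof. by move=> Ss /(S_lterm Ss)[]. Qed.

Lemma S_len s sb : S s -> leading N iota s sb -> wspan False (len_le (wlen sb)) s.
Proof. by move=> Ss /(S_lterm Ss)/lterm_len. Qed.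

Lemma Dfree_leading s sb : Dfree N iota s -> leading N iota s sb -> wexp sb = 0.
Proof. by move=> s0 [a /leading_termP/lterm_occurs/s0]. Qed.

Lemma S_below_Dfree s sb : S s -> Dfree N iota s -> leading N iota s sb ->
  wspan True (below sb) (s - nword iota sb).
Proof.
move=> Ss s0 ssb; apply: (Dfree_wspan char0 C_free); last exact: S_below.
apply: (subspaceB (Dfree_subspace char0 C_free) s0); apply/(DfreeP char0 C_free).
apply: wspan_nword => // [|_]; first exact: S_in_T Ss ssb.
exact: Dfree_leading s0 ssb.
Qed.

(** For the first kind, the lower terms of [s] are D-free, so their products with [v] are led by
    concatenations, and D-freeness of [sb] keeps these below [wcat sb m v]. *)
Lemma nScore_below x w : nScore x w ->
  in_T N w /\ wspan False (below w) (x - nword iota w).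
Proof.
case=> [s sb m v Ss s0 ssb mN vT|s sb i Ss ssb]; have sbT := S_in_T Ss ssb.
  split; first by rewrite in_T_wcat mN sbT.
  have sb0 := Dfree_leading s0 ssb.
  apply: (tspan_trans (y := nword iota sb ⟨m⟩ nword iota v)); last exact: nword_prod.
  rewrite -cprodBl; apply: (lspan_map (cprod_linearl m _)) (S_below_Dfree Ss s0 ssb).
    exact: tspan_subspace.
  move=> _ [u [[uT u0 ->] usb]]; have lt : wlt (wcat u m v) (wcat sb m v) by apply: wlt_wcatl.
  apply: (tspanBD (y := nword iota (wcat u m v))).
    apply: tspan_mono (nword_prod C_free m uT (u0 I) vT) => u' u'u.
    exact: wlt_trans u'u lt.
  by apply: wspan_nword; rewrite // in_T_wcat mN uT.
split; first by [].
apply: (tspan_trans (y := Dpow i (nword iota sb))); last exact: Dpow_nword.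
rewrite -(linB (Dpow_linear i)); apply: tspan_Dpow_below; last exact: S_below.
by move=> *; apply: is_nword_cder.
Qed.

Lemma nSword_below x w : nSword N iota S x w ->
  in_T N w /\ wspan False (below w) (x - nword iota w).
Proof.
move=> /nSwordP[p [y [v [pN /nScore_below[vT yv] -> ->]]]]; split; first by rewrite in_T_lcat pN.
rewrite nword_lcat -(linB (bracket_linear iota p)).
by apply: (tspan_bracket_below (N := N)) yv => // *; apply: is_nword_prefix.
Qed.

Lemma nSword_lterm x w : nSword N iota S x w -> lterm x w 1.
Proof. by move=> /nSword_below[wT xw]; split; rewrite ?oner_eq0 ?scale1r. Qed.

Lemma nSword_leading x w : nSword N iota S x w -> leading N iota x w.
Proof. by move/nSword_lterm/lterm_leading. Qed.

Lemma sspan_wspan Q x : (forall u w, Q w -> wlt u w -> Q u) ->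
  sspan Q x -> wspan False Q x.
Proof.
move=> Qdown; apply: lspan_min => [|y [w [/nSword_below[wT yw] Qw]]].
  exact: tspan_subspace.
apply: (tspanBD (y := nword iota w)); last exact: wspan_nword.
by apply: tspan_mono yw => u; apply: Qdown.
Qed.

Lemma wlt_wcat_index (u : word B n) m m' v v' : (wlen v <= wlen v')%N -> mlexlt m m' ->
  wlt (wcat u m v) (wcat u m' v').
Proof.
move=> vv' mm'; rewrite /wcat -!cats1 -!lcatA wlt_lcat.
exact: wlt_head.
Qed.

Lemma nScore1_span Q R s sb m y : S s -> Dfree N iota s -> leading N iota s sb ->
  prec m N -> (forall v, Q v -> R (wcat sb m v)) -> wspan False Q y -> sspan R (s ⟨m⟩ y).
Proof.
move=> Ss s0 ssb mN QR; apply: (lspan_map (cprod_linearr m s)); first exact: tspan_subspace.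
move=> _ [v [[vT _ ->] Qv]]; apply: tspan_gen (QR _ Qv).
by apply: nScore_nSword; apply: NScore1.
Qed.

Lemma nScore1_cder s sb m v i (j : 'I_n) : S s -> Dfree N iota s -> leading N iota s sb ->
  prec m N -> in_T N v -> sspan (below (wD (wcat sb m (wD v i)) (munit j)))
    (cder j (s ⟨m⟩ nword iota (wD v i)) - s ⟨m⟩ nword iota (wD v (i + munit j))).
Proof.
move=> Ss s0 ssb mN vT; rewrite -wDD cder_prod -addrA -cprodBr cprod_der.
apply: tspanD; last first.
  apply: (nScore1_span Ss s0 ssb mN _ (cder_nword (u := wD v i) j vT)) => w.
  by rewrite wD_wcat /below wlt_lcat.
have [->|mj] := posnP (m j); first by rewrite scale0r oppr0; apply: tspan0.
apply/tspanN/tspanZ/(tspan_gen (w := wcat sb (msub m (munit j)) (wD v i))).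
  by apply: nScore_nSword; apply: NScore1 => //; apply: prec_sub.
rewrite /below wD_wcat; apply: wlt_wcat_index => //; apply: mlexlt_sub; rewrite ?munit_le //.
by apply/eqP => /(congr1 mdeg); rewrite mdeg_munit mdeg0.
Qed.

Lemma nSword_cder x w (j : 'I_n) : nSword N iota S x w -> exists y,
  nSword N iota S y (wD w (munit j)) /\ sspan (below (wD w (munit j))) (cder j x - y).
Proof.
move=> /nSwordP[p [y [v [pN yv -> ->]]]].
suff [z [zv yz]] : exists z, nScore z (wD v (munit j)) /\
    sspan (below (wD v (munit j))) (cder j y - z).
  exists (bracket iota p z); split.
    by rewrite wD_lcat; apply: nSword_bracket => //; apply: nScore_nSword.
  rewrite wD_lcat; apply: (tspan_cder_bracket (N := N)) pN _ yz.
    by move=> *; apply: nSword_prefix.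
  exact: nScore_nSword.
case: yv => [s sb m {}v Ss s0 ssb mN vT|s sb i Ss ssb].
  exists (s ⟨m⟩ nword iota (wD v (munit j))); split.
    by rewrite wD_wcat; apply: NScore1.
  by have := nScore1_cder 0 j Ss s0 ssb mN vT; rewrite wD0 add0r.
exists (Dpow (i + munit j) s); split; first by rewrite wDD; apply: NScore2.
by rewrite DpowS subrr; apply: tspan0.
Qed.

(** Only the length is controlled, but for every [m], forbidden indices included. *)
Definition right_bounded x (l : nat) := forall m v, in_T N v ->
  sspan (len_le (l + wlen v)) (x ⟨m⟩ nword iota v).

Lemma right_bounded_wspan x l l' m y : right_bounded x l -> wspan False (len_le l') y ->
  sspan (len_le (l + l')) (x ⟨m⟩ y).
Proof.
move=> xl; apply: (lspan_map (cprod_linearr m x)); first exact: tspan_subspace.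
move=> _ [v [[vT _ ->] vl]]; apply: tspan_len_leq (xl m v vT).
by rewrite leq_add2l; apply: vl.
Qed.

(** The last letter decides: associativity only raises the index between it and [b], and a forbidden
    index stays forbidden. *)
Lemma Dfree_local s m b : Dfree N iota s -> ~~ prec m N -> s ⟨m⟩ iota b = 0.
Proof.
move=> /(DfreeP char0 C_free) s0 mN.
have key p a : (bracket iota p (iota a)) ⟨m⟩ iota b = 0.
  elim: p m mN => [|[c m'] p IH] m mN /=; first exact: (free_local C_free).
  apply: (assoc_in (free_assoc C_free) (subspace_eq0 (V := C))) => t _.
  by rewrite IH ?cprod0r //; apply: precF_add_r.
apply: (lspan_min (P := fun s => s ⟨m⟩ iota b = 0)) s0 => [|_ [u [[_ u0 ->] _]]].
  by split=> [|c x y x0 y0]; rewrite ?cprod0l // cprodDl cprodZl x0 y0 scaler0 addr0.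
by rewrite /nword u0 // Dpow0.
Qed.

(** By [Dfree_local], [s] can play the part of a letter in [cprod_reduce]; the products with
    admissible index that remain are S-words of the first kind, and no composition enters. *)
Lemma right_bounded_Dfree s sb : S s -> Dfree N iota s -> leading N iota s sb ->
  right_bounded s (wlen sb).
Proof.
move=> Ss s0 ssb m [[|[b m'] p] i c] vT.
  apply: cprod_Dpowr => [|j z|{}m]; first exact: tspan_subspace.
    by apply: tspan_cder_len => *; apply: nSword_cder.
  have [mN|mN] := boolP (prec m N); last by rewrite Dfree_local //; apply: tspan0.
  rewrite -[iota c]Dpow0 -[Dpow 0 _]/(nword iota (Word [::] 0 c)).
  apply: (tspan_gen (w := wcat sb m (Word [::] 0 c))); last by rewrite /len_le wlen_wcat.
  by apply: nScore_nSword; apply: NScore1.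
case/andP: vT => [/= m'N pN].
apply: (cprod_reduce (free_assoc C_free) (N := N) (M := wspan False (len_le (size p).+2))).
- exact: tspan_subspace.
- by move=> q qN; apply: Dfree_local.
- by move=> q; apply: (is_nword_left C_free (w := Word p i c)).
- move=> q z qN; apply: (nScore1_span Ss s0 ssb qN) => v vl.
  by rewrite /len_le wlen_wcat leq_add2l.
Qed.

(** Associativity moves the multiplication inward to [s], and derivations on [s] are absorbed by the
    index, so only the elements of [S] have to be examined. *)
Lemma right_bounded_nSword x w : nSword N iota S x w ->
  (forall s sb, S s -> leading N iota s sb -> right_bounded s (wlen sb)) ->
  right_bounded x (wlen w).
Proof.
move=> /nSwordP[p [y [v [pN yv -> ->]]]] Sb.
suff {pN} : right_bounded y (wlen v).
  move=> yb; elim: p pN => [_|[a m1] p IH /andP[/= m1N pN]]; first by rewrite lcat0.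
  move=> m u uT; apply: (assoc_in (free_assoc C_free)) => [|t _]; first exact: tspan_subspace.
  apply: (tspan_prefix_len (N := N)); [by move=> *; apply: nSword_prefix|exact: prec_sub|].
  exact: IH.
case: yv => [s sb m1 {}v Ss s0 ssb m1N vT|s sb i Ss ssb] m u uT.
  apply: (assoc_in (free_assoc C_free)) => [|t _]; first exact: tspan_subspace.
  rewrite wlen_wcat -addnA; apply: right_bounded_wspan; first exact: right_bounded_Dfree ssb.
  by apply: (wspan_prod C_free); apply: wspan_nword => //; apply: leqnn.
apply: cprod_Dpowl; first exact: tspan_subspace.
by move=> q; apply: (Sb s sb Ss ssb q u uT).
Qed.

End SWords.

(** * Stability of the span of the normal S-words under multiplication *)

Section SWordIdeal.
Context {k : fieldType} (char0 : [pchar k] =i pred0) {n : nat} {N : mindex n}.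
Context {d : Order.disp_t} {B : orderType d} {C : nconformal k n} {iota : B -> C}.
Context (C_free : is_free N iota).
Implicit Types (x y z f g h s : C) (u v w sb : word B n) (p q : seq (B * mindex n)).
Implicit Types (m i : mindex n) (Q R : word B n -> Prop) (r : seq (word B n)) (S : C -> Prop).

Lemma lcat_inj p : injective (lcat (B := B) (n := n) p).
Proof.
move=> [q1 i1 a1] [q2 i2 a2] [/eqP]; rewrite eqseq_cat // eqxx /= => /eqP-> -> ->.
by [].
Qed.

Lemma expansion_bracket p x r c : left_factor N p -> expansion N iota x r c ->
  expansion N iota (bracket iota p x) (map (lcat p) r)
    (fun w => c (Word (drop (size p) (wpre w)) (wexp w) (wlast w))).
Proof.
move=> pN [ur rT xE]; have E u : Word (drop (size p) (wpre (lcat p u))) (wexp u) (wlast u) = u.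
  by rewrite drop_size_cat //; case: u.
split=> [|_ /mapP[u ru ->]|]; first by rewrite map_inj_uniq //; apply: lcat_inj.
  by rewrite in_T_lcat pN E; apply: rT.
rewrite big_map xE (lin_sum (bracket_linear iota p)); apply: eq_bigr => u _.
by rewrite E nword_lcat (linZ (bracket_linear iota p)).
Qed.

Lemma Dfree_bracket p x : left_factor N p -> Dfree N iota (bracket iota p x) -> Dfree N iota x.
Proof.
move=> pN px u [r [c [xr ru]]]; apply: (px (lcat p u)).
by have := expansion_bracket pN xr => pxr; do 2!eexists; split; [exact: pxr|apply: map_f].
Qed.

Lemma nSword_sub (S S' : C -> Prop) x w : (forall s, S' s -> S s) ->
  nSword N iota S' x w -> nSword N iota S x w.
Proof. by move=> SS [p s sb t /SS|p s sb i /SS] *; [apply: NSword1|apply: NSword2]. Qed.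

Context {S : C -> Prop} (S_monic : forall s, S s -> is_monic N iota s).
Local Notation wspan dfree := (tspan (is_nword (N := N) (iota := iota) dfree)).
Local Notation sspan := (tspan (nSword N iota S)).

(** For the second kind the exponent of [w] is that of [sb] plus [i]; its vanishing gives [i = 0],
    and a left factor does not change exponents, so [s] is D-free. *)
Lemma nSword_Dfree x w : nSword N iota S x w -> Dfree N iota x ->
  nSword N iota (fun s => S s /\ Dfree N iota s) x w.
Proof.
move=> xw x0; have w0 := Dfree_leading x0 (nSword_leading char0 C_free S_monic xw).
case: xw x0 w0 => [p s sb t Ss s0 ssb pN tN _ _|p s sb i Ss ssb pN x0 /madd_eq0[_ i0]].
  exact: NSword1.
by apply: NSword2 => //; split=> //; apply: (Dfree_bracket pN); rewrite i0 Dpow0 in x0.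
Qed.

Lemma right_bounded_nSword_Dfree x w : nSword N iota S x w -> Dfree N iota x ->
  right_bounded (N := N) (iota := iota) (S := S) x (wlen w).
Proof.
move=> xw x0 m v vT; have xw' := nSword_Dfree xw x0.
(* The previous bound is applied to the subset of D-free elements of [S], so that it does not rest
   on right multiplication compositions. *)
have := right_bounded_nSword char0 C_free xw' _ m vT.
case=> [s sb [Ss s0] ssb|h]; first exact: (right_bounded_Dfree char0 C_free).
apply: (lspan_min _ _ (LSpan h)); first exact: tspan_subspace.
move=> y [u [yu ul]]; apply: tspan_gen ul; by apply: nSword_sub yu => s [].
Qed.

Context (GS : GSbasis N iota S).

(** Triviality bounds the S-words by the leading word of the product, and [wspan_prod] bounds that
    word by the length of [sb] plus 1. A zero product has no leading word and is set apart. *)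
Lemma right_mul_span s sb m a : S s -> leading N iota s sb -> ~ Dfree N iota s ->
  lspan (fun x => exists w, nSword N iota S x w /\ len_le (wlen sb).+1 w /\ Dfree N iota x)
    (s ⟨m⟩ iota a).
Proof.
move=> Ss ssb s0; have [_ _ GSr] := GS.
have [h0|h0] := eqVneq (s ⟨m⟩ iota a) 0.
  by rewrite h0; apply: subspace0; apply: lspan_subspace.
have : right_mul_comp N iota s (s ⟨m⟩ iota a) by split=> //; exists a, m.
move=> /(GSr _ _ Ss)/Scombination_lspan; apply: lspan_mono => x [w [xw [wh x0]]].
exists w; split=> //; split=> //.
have sa : wspan False (len_le (wlen sb + 1)) (s ⟨m⟩ iota a).
  apply: (wspan_prod C_free); first exact: (S_len char0 C_free S_monic).
  rewrite -[iota a]Dpow0; apply: (wspan_nword (u := Word [::] 0 a)) => //.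
have [hb [c [hbl /lterm_leading/wh whb]]] := exists_lterm sa h0.
by apply: leq_trans whb _; rewrite -addn1.
Qed.

Lemma left_mul_span s sb m a : S s -> leading N iota s sb ->
  sspan (len_le (wlen sb).+1) (iota a ⟨m⟩ s).
Proof.
move=> Ss ssb; have [_ GSl _] := GS.
have [mN|mN] := boolP (prec m N).
  apply: (tspan_prefix_len (N := N)) => //; first by move=> *; apply: nSword_prefix.
  apply: (tspan_gen (w := sb)); last exact: leqnn.
  by apply: nScore_nSword; rewrite -{1}[s]Dpow0 -{1}[sb]wD0; apply: NScore2.
have [h0|h0] := eqVneq (iota a ⟨m⟩ s) 0; first by rewrite h0; apply: tspan0.
have : left_mul_comp N iota s (iota a ⟨m⟩ s) by exists a, m.
move=> /(GSl _ _ Ss)/Scombination_lspan; apply: lspan_mono => x [w [xw [wh x0]]].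
exists w; split=> //.
have sa : wspan False (len_le (wlen sb).+1) (iota a ⟨m⟩ s).
  by apply: (wspan_left C_free); apply: (S_len char0 C_free S_monic).
have [hb [c [hbl /lterm_leading/wh whb]]] := exists_lterm sa h0.
exact: leq_trans whb _.
Qed.

(** For [s] not D-free, a product of [s] with [b<m'>z] is regrouped into terms [(s<.>b)<.>z]. The
    right multiplication compositions express [s<.>b] by D-free S-words, and D-freeness is what
    allows the further multiplication by [z]. *)
Lemma nSword_right x w : nSword N iota S x w ->
  right_bounded (N := N) (iota := iota) (S := S) x (wlen w).
Proof.
move=> xw; apply: (right_bounded_nSword char0 C_free xw) => s sb Ss ssb.
have [s0|s0] := pselect (Dfree N iota s); first exact: (right_bounded_Dfree char0 C_free).
move=> m [[|[b m'] p] i c] vT.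
  apply: cprod_Dpowr => [|j z|{}m]; first exact: tspan_subspace.
    by apply: tspan_cder_len => *; apply: nSword_cder.
  apply: lspan_mono (right_mul_span m c Ss ssb s0) => y [v [yv [vl _]]].
  by exists v; rewrite /len_le addn1.
case/andP: vT => [/= m'N pN].
apply: (assoc_inv (free_assoc C_free)) => [|t _]; first exact: tspan_subspace.
have := right_mul_span (msub m t) b Ss ssb s0.
apply: (lspan_map (cprod_linearl _ _)); first exact: tspan_subspace.
move=> y [v [yv [vl y0]]]; apply: tspan_len_leq
  (right_bounded_nSword_Dfree yv y0 _ (v := Word p i c) pN).
rewrite -[wlen (Word (_ :: _) _ _)]/(wlen (Word p i c)).+1 addnS -addSn leq_add2r.
exact: vl.
Qed.

(** For the first kind, [a<m>(s<m'>v)] is regrouped into terms [(a<.>s)<.>v]: a left multiplication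
    composition or an S-word, followed by right multiplication. *)
Lemma nSword_left x w a m : nSword N iota S x w ->
  sspan (len_le (wlen w).+1) (iota a ⟨m⟩ x).
Proof.
move=> /nSwordP[p [y [v [pN yv -> ->]]]]; elim: p pN a m => [_|[b m'] p IH /andP[/= m'N pN]] a m.
  rewrite lcat0; case: yv => {y v} [s sb m' v Ss s0 ssb m'N vT|s sb i Ss ssb].
    apply: (assoc_inv (free_assoc C_free)) => [|t _]; first exact: tspan_subspace.
    apply: (lspan_map (cprod_linearl _ _)) (left_mul_span (msub m t) a Ss ssb).
      exact: tspan_subspace.
    move=> y [u [yu ul]]; apply: tspan_len_leq (nSword_right yu _ vT).
    by rewrite wlen_wcat -addSn leq_add2r; apply: ul.
  apply: cprod_Dpowr => [|j z|{}m]; first exact: tspan_subspace.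
    by apply: tspan_cder_len => *; apply: nSword_cder.
  exact: (left_mul_span m a Ss ssb).
apply: (cprod_reduce (free_assoc C_free) (N := N) (M := sspan (len_le (wlen (lcat p v)).+1))).
- exact: tspan_subspace.
- by move=> q; apply: (free_local C_free).
- by move=> q; apply: IH.
- move=> q z qN; apply: (tspan_prefix_len (N := N)) => //.
  by move=> *; apply: nSword_prefix.
Qed.

Lemma sspan_ideal : is_ideal (sspan anyword).
Proof.
have anyP l x : sspan (len_le l) x -> sspan anyword x by apply: tspan_mono.
have sP : is_subspace (sspan anyword) by apply: tspan_subspace.
split=> // [m x y|m x y|i x].
- have [_ gen _ _] := C_free; move: m y.
  (* The elements whose left multiplications preserve the span form a subalgebra, so the generators
     suffice. *)
  apply: (gen (fun x => forall m y, sspan anyword y -> sspan anyword (x ⟨m⟩ y))) => {x} [|b m y].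
    split=> [|m x x' xP x'P m' y yP|i x xP m y yP].
    + split=> [m y _|c x x' xP x'P m y yP]; first by rewrite cprod0l; apply: tspan0.
      by rewrite cprodDl cprodZl; apply: tspanD; [apply/tspanZ/xP|apply: x'P].
    + by apply: (assoc_in (free_assoc C_free)) => // t _; apply/xP/x'P.
    + by rewrite cprod_der; apply/tspanN/tspanZ/xP.
  apply: tspan_map; first exact: (cprod_linearr m (iota b)).
  by move=> z w zw _; apply: anyP; apply: nSword_left zw.
- apply: (lspan_map (cprod_linearl m y)) => // z [w [zw _]].
  apply: (lspan_map (cprod_linearr m z)) (wspan_all C_free y) => // _ [v [[vT _ ->] _]].
  by apply: anyP; apply: nSword_right zw _ _ vT.
- apply: tspan_map => [|z w zw _]; first exact: cder_linear.
  apply: (anyP (wlen w)); apply: tspan_cder_len; first by move=> *; apply: nSword_cder.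
  by apply: tspan_gen zw _; apply: leqnn.
Qed.

Lemma Id_sspan x : Id_Domega S x -> sspan anyword x.
Proof.
apply; first exact: sspan_ideal.
move=> _ [s [i [Ss ->]]]; have [sb /(ex_intro _ 1) ssb] := S_monic Ss.
by apply: (tspan_gen (w := wD sb i)) => //; apply: nScore_nSword; apply: NScore2.
Qed.

End SWordIdeal.

Section SIdeal.
Context {k : fieldType} {n : nat} {N : mindex n}.
Context {d : Order.disp_t} {B : orderType d} {C : nconformal k n} {iota : B -> C}.
Context {S : C -> Prop}.
Implicit Types (x y s : C) (w : word B n).

Lemma Id_Dpow s i : S s -> Id_Domega S (Dpow i s).
Proof. by move=> Ss P _; apply; exists s, i. Qed.

Lemma Id_mem s : S s -> Id_Domega S s.
Proof. by move=> Ss; rewrite -[s]Dpow0; apply: Id_Dpow. Qed.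

Lemma Id_subspace : is_subspace (Id_Domega S).
Proof. by have [] := idealP (Id_Domega S). Qed.

Lemma Id_prodl m x y : Id_Domega S y -> Id_Domega S (x ⟨m⟩ y).
Proof. by have [_ h _ _] := idealP (Id_Domega S); apply: h. Qed.

Lemma Id_prodr m x y : Id_Domega S x -> Id_Domega S (x ⟨m⟩ y).
Proof. by have [_ _ h _] := idealP (Id_Domega S); apply: h. Qed.

Lemma Id_bracket (p : seq (B * mindex n)) x : Id_Domega S x -> Id_Domega S (bracket iota p x).
Proof. by move=> Ix; elim: p => //= -[a m] p IH; apply: Id_prodl. Qed.

Lemma nSword_Id x w : nSword N iota S x w -> Id_Domega S x.
Proof.
case=> [p s sb [[m v]|] Ss _ _ _ _|p s sb i Ss _ _]; apply: Id_bracket.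
- by apply: Id_prodr; apply: Id_mem.
- exact: Id_mem.
- exact: Id_Dpow.
Qed.

End SIdeal.

(** * Normal S-words with the same leading word *)

Lemma cat_split (T : eqType) (p q x y : seq T) : p ++ x = q ++ y -> (size p <= size q)%N ->
  exists c, q = p ++ c /\ x = c ++ y.
Proof.
move=> pq pq_size; exists (drop (size p) q).
have E : q = p ++ drop (size p) q.
  by rewrite -[LHS](cat_take_drop (size p)) -(takel_cat y pq_size) -pq take_size_cat.
split=> //; have := congr1 (drop (size p)) pq.
by rewrite E -catA !drop_size_cat // drop_size_cat.
Qed.

(** * Disjoint exponents and the permutations in right inclusions *)

Section ExponentSplitting.
Context {n : nat}.
Implicit Types (m lo hi : mindex n).

Lemma sum_munit (sg : 'S_n) (F : 'I_n -> nat) (P : pred 'I_n) j :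
  (\sum_(t < n | P t) munit (sg t) *+ F t : mindex n) j =
  (P (sg^-1%g j) * F (sg^-1%g j))%N.
Proof.
have E (G : mindex n) c : (G *+ c) j = (G j * c)%N.
  elim: c => [|c IH]; first by rewrite mulr0n mE muln0.
  by rewrite mulrS mE IH mulnS.
rewrite sum_ffunE; under eq_bigr do rewrite E munitE.
rewrite big_mkcond (bigD1 (sg^-1%g j)) //= permKV eqxx mul1n big1 ?addr0.
  by case: (P _); rewrite ?mul1n ?mul0n.
move=> t tj; rewrite (_ : (j == sg t) = false) ?mul0n ?if_same //.
by apply: contraNF tj => /eqP->; rewrite permK.
Qed.

Lemma expo_disjoint (sg : 'S_n) l i j : expo_lo sg l i j = 0%N \/ expo_hi sg l i j = 0%N.
Proof.
rewrite /expo_lo /expo_hi !sum_munit /=.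
by case: (ltnP (sg^-1%g j) l) => _; [right|left].
Qed.

(* The permutation lists the support of lo first. *)
Lemma expo_split lo hi : (forall j, lo j = 0%N \/ hi j = 0%N) ->
  exists (sg : 'S_n) (l : nat) (i : mindex n),
    [/\ (l <= n)%N, expo_lo sg l i = lo & expo_hi sg l i = hi].
Proof.
move=> lohi; pose a := fun j : 'I_n => (0 < lo j)%N.
pose e := [seq j <- enum 'I_n | a j] ++ [seq j <- enum 'I_n | ~~ a j].
have pe : perm_eq e (enum 'I_n) by rewrite perm_filterC.
have se : size e = n by rewrite (perm_size pe) size_enum_ord.
have ue : uniq e by rewrite (perm_uniq pe) enum_uniq.
pose f (t : 'I_n) := nth t e t.
have fE (t t' : 'I_n) : f t = nth t' e t.
  by apply: set_nth_default; rewrite se.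
have finj : injective f.
  move=> t t'; rewrite (fE t t') => /eqP; rewrite nth_uniq ?se //.
  by move/eqP/val_inj.
pose sg := perm finj; pose l := size [seq j <- enum 'I_n | a j].
have afl (t : 'I_n) : a (f t) = (t < l)%N.
  rewrite /f nth_cat -/l; case: ltnP => tl.
    by have := mem_nth t tl; rewrite mem_filter => /andP[].
  have tl' : (t - l < size [seq j <- enum 'I_n | ~~ a j])%N.
    by rewrite ltn_subLR // -size_cat se.
  by have := mem_nth t tl'; rewrite mem_filter => /andP[/negbTE].
have sgE (t : 'I_n) : sg t = f t by rewrite permE.
(* At each place one of the two summands vanishes, so the sum encodes both exponents. *)
exists sg, l, [ffun t => (lo (sg t) + hi (sg t))%N]; split.
- by rewrite /l -[leqRHS]size_enum_ord size_filter count_size.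
- apply: mindexP => j; rewrite [LHS]sum_munit ffunE permKV.
  have := afl (sg^-1%g j); rewrite -sgE permKV /a => <-.
  by case: (lohi j) => ->; rewrite ?addn0 //; case: (posnP (lo j)) => [->|]; rewrite ?mul1n.
- apply: mindexP => j; rewrite [LHS]sum_munit ffunE permKV leqNgt.
  have := afl (sg^-1%g j); rewrite -sgE permKV /a => <-.
  by case: (lohi j) => ->; rewrite ?mul1n ?addn0 //; case: (posnP (lo j)) => [->|]; rewrite ?mul0n.
Qed.

End ExponentSplitting.

(** * Congruences obtained from each kind of composition *)

Section Compositions.
Context {k : fieldType} (char0 : [pchar k] =i pred0) {n : nat} {N : mindex n}.
Context {d : Order.disp_t} {B : orderType d} {C : nconformal k n} {iota : B -> C}.
Context (C_free : is_free N iota).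
Context {S : C -> Prop} (S_monic : forall s, S s -> is_monic N iota s).
Context (GS : GSbasis N iota S).
Implicit Types (x y z f g h s : C) (u v w sb : word B n) (p q : seq (B * mindex n)).
Implicit Types (m i : mindex n) (Q R : word B n -> Prop) (r : seq (word B n)).
Local Notation wspan dfree := (tspan (is_nword (N := N) (iota := iota) dfree)).
Local Notation sspan := (tspan (nSword N iota S)).

Let assoc := free_assoc C_free.
Let S_prefix := @nSword_prefix _ _ N _ _ _ iota S.
Let S_left := @nSword_left _ char0 _ _ _ _ _ _ C_free _ S_monic GS.
Let S_right := @nSword_right _ char0 _ _ _ _ _ _ C_free _ S_monic GS.
Let S_cder := @nSword_cder _ _ N _ _ _ iota S.

Lemma right_bracket p x w m v : nSword N iota S x w -> left_factor N p -> in_T N v ->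
  sspan (below (lcat p (wcat w m v)))
    ((bracket iota p x) ⟨m⟩ nword iota v - bracket iota p (x ⟨m⟩ nword iota v)).
Proof.
move=> xw pN vT; elim: p pN => [_|[a m1] p IH /andP[/= m1N pN]].
  by rewrite subrr; apply: tspan0.
apply: (tspan_trans (y := iota a ⟨m1⟩ (bracket iota p x ⟨m⟩ nword iota v))).
  apply: (assoc_lead assoc) => [|t tm t0]; first exact: tspan_subspace.
  rewrite -[lcat (_ :: _) _](lcatA [:: (a, m1)] p).
  apply: (tspan_head_below (N := N)) => //; [exact: prec_sub|exact: mlexlt_sub|].
  rewrite -wcat_lcat wlen_wcat.
  by apply: S_right => //; apply: nSword_bracket.
rewrite -cprodBr -[lcat (_ :: _) _](lcatA [:: (a, m1)] p).
by apply: (tspan_bracket_below (N := N) S_prefix (p := [:: (a, m1)])) (IH pN); rewrite /left_factor /= m1N.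
Qed.

Lemma right_core s sb m v m' v' : S s -> Dfree N iota s -> leading N iota s sb ->
  prec m N -> in_T N v -> wexp v = 0 -> prec m' N -> in_T N v' ->
  sspan (below (wcat sb m (wcat v m' v')))
    ((s ⟨m⟩ nword iota v) ⟨m'⟩ nword iota v' - s ⟨m⟩ nword iota (wcat v m' v')).
Proof.
move=> Ss s0 ssb mN vT v0 m'N v'T.
apply: (tspan_trans (y := s ⟨m⟩ (nword iota v ⟨m'⟩ nword iota v'))).
  apply: (assoc_lead assoc) => [|t tm t0]; first exact: tspan_subspace.
  apply: (nScore1_span Ss s0 ssb (prec_sub t mN) (Q := len_le (wlen v + wlen v'))) => [u uv|].
    by apply: wlt_wcat_index; [rewrite wlen_wcat|apply: mlexlt_sub].
  by apply: (wspan_prod C_free); apply: wspan_nword => //; apply: leqnn.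
rewrite -cprodBr; apply: (nScore1_span Ss s0 ssb mN) (nword_prod C_free m' vT v0 v'T).
by move=> u uv; apply: wlt_wcatr.
Qed.

(** A D-free S-word involves a D-free element of [S] and ends without derivations, so appending [v]
    gives an S-word of the first kind, up to smaller ones. *)
Lemma right_nSword_Dfree x w m v : nSword N iota S x w -> Dfree N iota x ->
  prec m N -> in_T N v -> exists y, nSword N iota S y (wcat w m v) /\
    sspan (below (wcat w m v)) (x ⟨m⟩ nword iota v - y).
Proof.
move=> xw x0 mN vT; have w0 := Dfree_leading x0 (nSword_leading char0 C_free S_monic xw).
have [p [y [w' [pN yw' -> wE]]]] := (nSwordP _ _).1 (nSword_Dfree char0 C_free S_monic xw x0).
rewrite {w xw}wE in w0 *; have {w0}w'0 : wexp w' = 0 by [].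
suff [z [zw' yz]] : exists z, nSword N iota S z (wcat w' m v) /\
    sspan (below (wcat w' m v)) (y ⟨m⟩ nword iota v - z).
  exists (bracket iota p z); rewrite wcat_lcat; split; first exact: nSword_bracket.
  apply: tspan_trans (right_bracket _ _ pN vT) _.
    by apply: nSword_sub (nScore_nSword yw') => s [].
  rewrite -(linB (bracket_linear iota p)).
  exact: (tspan_bracket_below (N := N) S_prefix) yz.
case: yw' w'0 => [s sb m1 u [Ss s0] _ ssb m1N uT u0|s sb i [Ss s0] ssb /madd_eq0[_ ->]].
  exists (s ⟨m1⟩ nword iota (wcat u m v)); rewrite wcatA; split; last exact: right_core.
  by apply: nScore_nSword; apply: NScore1; rewrite // in_T_wcat mN uT.
exists (s ⟨m⟩ nword iota v); rewrite wD0 Dpow0 subrr; split; last exact: tspan0.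
by apply: nScore_nSword; apply: NScore1.
Qed.

(** The use made of the D-free clause in triviality: smaller S-words stay smaller after [v] is
    appended. *)
Lemma right_below_Dfree h w m v : wexp w = 0 -> prec m N -> in_T N v ->
  lspan (fun x => exists w', nSword N iota S x w' /\ below w w' /\ Dfree N iota x) h ->
  sspan (below (wcat w m v)) (h ⟨m⟩ nword iota v).
Proof.
move=> w0 mN vT; apply: (lspan_map (cprod_linearl m _)); first exact: tspan_subspace.
move=> x [w' [xw' [w'w x0]]]; have [y [yw' xy]] := right_nSword_Dfree xw' x0 mN vT.
have lt : wlt (wcat w' m v) (wcat w m v) by apply: wlt_wcatl.
apply: tspanBD (tspan_gen yw' lt).
by apply: tspan_mono xy => u uw; apply: wlt_trans uw lt.
Qed.

Lemma Dpow_core1 p s sb m v i : S s -> Dfree N iota s -> leading N iota s sb ->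
  left_factor N p -> prec m N -> in_T N v ->
  sspan (below (wD (lcat p (wcat sb m v)) i))
    (Dpow i (bracket iota p (s ⟨m⟩ nword iota v)) - bracket iota p (s ⟨m⟩ nword iota (wD v i))).
Proof.
move=> Ss s0 ssb pN mN vT.
have := @tspan_Dpow_lead _ _ _ _ _ (nSword N iota S) S_cder
  (fun i => bracket iota p (s ⟨m⟩ nword iota (wD v i))) (lcat p (wcat sb m v)) _ i.
rewrite wD0; apply=> {}i j.
have core := nScore1_cder i j Ss s0 ssb mN vT.
rewrite -[wD (lcat _ _) _]wDD.
apply: (tspan_cder_bracket (N := N) S_prefix pN (w := wcat sb m (wD v i)) _ core).
by apply: nScore_nSword; apply: NScore1.
Qed.

Lemma Dpow_core2 p s sb i c : S s -> leading N iota s sb -> left_factor N p ->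
  sspan (below (wD (lcat p (wD sb i)) c))
    (Dpow c (bracket iota p (Dpow i s)) - bracket iota p (Dpow (c + i) s)).
Proof.
move=> Ss ssb pN.
have := @tspan_Dpow_lead _ _ _ _ _ (nSword N iota S) S_cder
  (fun c => bracket iota p (Dpow (c + i) s)) (lcat p (wD sb i)) _ c.
rewrite add0r; apply=> {}c j; rewrite addrAC DpowS wD_lcat wDD addrA.
rewrite -wDD [i + c]addrC.
apply: (tspan_cder_bracket (N := N) S_prefix pN (x := Dpow (c + i) s) (w := wD sb (c + i))).
  by apply: nScore_nSword; apply: NScore2.
by rewrite subrr; apply: tspan0.
Qed.

(** The two occurrences do not overlap, so no inclusion or intersection is involved: both elements
    are compared with [s<m>y], where both leading words have been replaced. *)
Lemma disjoint_congr s sb m y v : S s -> Dfree N iota s -> leading N iota s sb ->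
  prec m N -> nSword N iota S y v ->
  sspan (below (wcat sb m v))
    (s ⟨m⟩ nword iota v - bracket iota (rcons (wpre sb) (wlast sb, m)) y).
Proof.
move=> Ss s0 ssb mN yv; have [vT yv_below] := nSword_below char0 C_free S_monic yv.
have sbT := S_in_T char0 C_free S_monic Ss ssb.
have yl : sspan (len_le (wlen v)) y by apply: tspan_gen yv _; apply: leqnn.
apply: (tspan_trans (y := s ⟨m⟩ y)).
  rewrite -cprodBr; apply: (nScore1_span Ss s0 ssb mN) (tspan_sym yv_below).
  by move=> u uv; apply: wlt_wcatr.
apply: (tspan_trans (y := nword iota sb ⟨m⟩ y)); last first.
  exact: (tspan_nword_lead assoc S_prefix S_left m sbT (Dfree_leading s0 ssb) yl).
rewrite -cprodBl.
apply: (lspan_map (cprod_linearl m y)) (S_below_Dfree char0 C_free S_monic Ss s0 ssb).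
  exact: tspan_subspace.
move=> _ [u [[uT u0 ->] usb]].
have lt : wlt (wcat u m v) (wcat sb m v) by apply: wlt_wcatl => //; apply: Dfree_leading ssb.
apply: (tspanBD (y := bracket iota (rcons (wpre u) (wlast u, m)) y)).
  apply: tspan_mono (tspan_nword_lead assoc S_prefix S_left m uT (u0 I) yl) => u' u'u.
  exact: wlt_trans u'u lt.
apply: tspan_gen lt; apply: nSword_bracket => //.
by rewrite left_factor_rcons mN.
Qed.

Lemma composition_trivial f g w h : S f -> S g ->
  inclusion_comp N iota f g w h \/ right_inclusion_comp N iota f g w h \/
    intersection_comp N iota f g w h ->
  sspan (below w) h.
Proof.
move=> Sf Sg fg; have [GSi _ _] := GS; have := GSi _ _ _ _ Sf Sg fg.
move/Scombination_lspan; apply: lspan_mono => x [w' [xw' [w'w _]]].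
by exists w'.
Qed.

Lemma composition_trivial_Dfree f g w h : S f -> S g -> Dfree N iota f -> Dfree N iota g ->
  inclusion_comp N iota f g w h \/ right_inclusion_comp N iota f g w h \/
    intersection_comp N iota f g w h ->
  lspan (fun x => exists w', nSword N iota S x w' /\ below w w' /\ Dfree N iota x) h.
Proof.
move=> Sf Sg f0 g0 fg; have [GSi _ _] := GS; have := GSi _ _ _ _ Sf Sg fg.
move/Scombination_lspan; apply: lspan_mono => x [w' [xw' [w'w x0]]].
by exists w'; do !split=> //; apply: x0.
Qed.

Lemma congr_right_inclusion s1 sb1 i1 s2 sb2 i2 q : S s1 -> leading N iota s1 sb1 ->
  S s2 -> leading N iota s2 sb2 -> left_factor N q -> wD sb1 i1 = lcat q (wD sb2 i2) ->
  sspan (below (wD sb1 i1)) (Dpow i1 s1 - bracket iota q (Dpow i2 s2)).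
Proof.
move=> Ss1 ssb1 Ss2 ssb2 qN E.
(* Right inclusion compositions involve disjoint exponents only; the common part [c] is removed and
   D^c applied to the composition afterwards. *)
pose c : mindex n := [ffun j => minn (i1 j) (i2 j)].
have i1E : i1 = c + msub i1 c by apply: mindexP => j; rewrite !mE !ffunE; lia.
have i2E : i2 = c + msub i2 c by apply: mindexP => j; rewrite !mE !ffunE; lia.
have [|sg [l [i [ln lo hi]]]] := @expo_split _ (msub i1 c) (msub i2 c).
  by move=> j; rewrite !mE !ffunE; lia.
have E0 : wD sb1 (msub i1 c) = lcat q (wD sb2 (msub i2 c)).
  case: E => e1 e e2; rewrite /wD /lcat /= e1 e2; congr Word; apply: (@madd_inj _ c).
  by rewrite -!addrA ![_ + c]addrC -i1E -i2E.
have comp : sspan (below (wD sb1 (msub i1 c)))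
    (Dpow (msub i1 c) s1 - bracket iota q (Dpow (msub i2 c) s2)).
  apply: (composition_trivial Ss1 Ss2); right; left.
  by exists sb1, sb2, q, sg, l, i; rewrite lo hi; split.
have := tspan_Dpow_below S_cder c comp.
rewrite wDD [_ + c]addrC -i1E (linB (Dpow_linear c)) -DpowD -i1E => comp'.
apply: (tspan_trans comp'); have := Dpow_core2 (msub i2 c) c Ss2 ssb2 qN.
by rewrite -i2E -E0 wDD [_ + c]addrC -i1E.
Qed.

Lemma congr_inclusion2 s1 sb1 i1 s2 sb2 m2 v2 q : S s1 -> leading N iota s1 sb1 ->
  S s2 -> Dfree N iota s2 -> leading N iota s2 sb2 -> prec m2 N -> in_T N v2 ->
  left_factor N q -> wD sb1 i1 = lcat q (wcat sb2 m2 v2) ->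
  sspan (below (wD sb1 i1)) (Dpow i1 s1 - bracket iota q (s2 ⟨m2⟩ nword iota v2)).
Proof.
move=> Ss1 ssb1 Ss2 s20 ssb2 m2N v2T qN E.
(* The word [v2] with the exponent of [sb1]: the inclusion is formed before D^i1 is applied. *)
pose v := Word (wpre v2) (wexp sb1) (wlast v2).
have v2E : v2 = wD v i1 by case: E => _ e _; rewrite /wD /= e; case: (v2).
have E0 : sb1 = lcat q (wcat sb2 m2 v).
  by case: E => e1 _ e2; rewrite /wcat /lcat /= -e1 -e2; case: (sb1).
have comp : sspan (below sb1) (s1 - bracket iota q (s2 ⟨m2⟩ nword iota v)).
  apply: (composition_trivial Ss1 Ss2); left.
  exists sb1, sb2, q, (Some (m2, v)); split=> //; split=> //=.
  by rewrite m2N.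
have := tspan_Dpow_below S_cder i1 comp; rewrite (linB (Dpow_linear i1)) => comp'.
apply: (tspan_trans comp'); rewrite v2E {1}E0.
exact: (Dpow_core1 i1 Ss2 s20 ssb2 qN m2N).
Qed.

Lemma congr_intersection2 s1 sb1 m1 v1 s2 sb2 i2 q : S s1 -> Dfree N iota s1 ->
  leading N iota s1 sb1 -> prec m1 N -> in_T N v1 -> S s2 -> leading N iota s2 sb2 ->
  left_factor N q -> (0 < size q < wlen sb1)%N -> wcat sb1 m1 v1 = lcat q (wD sb2 i2) ->
  sspan (below (wcat sb1 m1 v1)) (s1 ⟨m1⟩ nword iota v1 - bracket iota q (Dpow i2 s2)).
Proof.
move=> Ss1 s10 ssb1 m1N v1T Ss2 ssb2 qN /andP[q0 qs] E.
(* The word [v1] with the exponent of [sb2]: the intersection is formed before D^i2 is applied. *)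
pose v := Word (wpre v1) (wexp sb2) (wlast v1).
have v1E : v1 = wD v i2 by case: E => _ e _; rewrite /wD /= -e; case: (v1).
have E0 : wcat sb1 m1 v = lcat q sb2 by case: E => e1 _ e2; congr Word.
have comp : sspan (below (wcat sb1 m1 v)) (s1 ⟨m1⟩ nword iota v - bracket iota q s2).
  apply: (composition_trivial Ss1 Ss2); right; right.
  case/lastP: q q0 qs qN E E0 => // q [a m'] _ qs; rewrite left_factor_rcons => /andP[m'N qN] E E0.
  exists sb1, sb2, (Word q 0 a), v, m1, m'; split=> //; split=> //.
  by rewrite E0 wlen_lcat ltn_add2r.
have := tspan_Dpow_below S_cder i2 comp; rewrite (linB (Dpow_linear i2)) => comp'.
have W : wD (wcat sb1 m1 v) i2 = wcat sb1 m1 v1 by rewrite wD_wcat -v1E.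
rewrite W in comp'; apply: (tspan_trans (y := Dpow i2 (s1 ⟨m1⟩ nword iota v))).
  apply: tspan_sym; rewrite -W v1E.
  have := Dpow_core1 i2 Ss1 s10 ssb1 (p := [::]) isT m1N (v := v) v1T.
  by rewrite lcat0.
apply: (tspan_trans comp'); have := Dpow_core2 0 i2 Ss2 ssb2 qN.
by rewrite wD0 Dpow0 addr0 -E0 W.
Qed.

(** The inclusion composition at [sb1] is multiplied on the right by [v1]; since both polynomials
    are D-free, [right_below_Dfree] keeps it small. *)
Lemma congr_inclusion1 s1 sb1 m1 v1 s2 sb2 m2 v q : S s1 -> Dfree N iota s1 ->
  leading N iota s1 sb1 -> prec m1 N -> in_T N v1 ->
  S s2 -> Dfree N iota s2 -> leading N iota s2 sb2 -> prec m2 N -> in_T N v ->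
  left_factor N q -> sb1 = lcat q (wcat sb2 m2 v) ->
  sspan (below (wcat sb1 m1 v1))
    (s1 ⟨m1⟩ nword iota v1 - bracket iota q (s2 ⟨m2⟩ nword iota (wcat v m1 v1))).
Proof.
move=> Ss1 s10 ssb1 m1N v1T Ss2 s20 ssb2 m2N vT qN E.
have sb10 := Dfree_leading s10 ssb1.
have v0 : wexp v = 0 by rewrite -sb10 E.
pose x := bracket iota q (s2 ⟨m2⟩ nword iota v).
have comp := composition_trivial_Dfree (w := sb1) (h := s1 - x) Ss1 Ss2 s10 s20.
have {}comp := right_below_Dfree sb10 m1N v1T (comp _).
apply: (tspan_trans (y := x ⟨m1⟩ nword iota v1)).
  rewrite -cprodBl; apply: comp; left.
  by exists sb1, sb2, q, (Some (m2, v)); split=> //; split=> //=; rewrite m2N.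
have xw : nSword N iota S (s2 ⟨m2⟩ nword iota v) (wcat sb2 m2 v).
  by apply: nScore_nSword; apply: NScore1.
rewrite E wcat_lcat; apply: (tspan_trans (right_bracket m1 xw qN v1T)).
rewrite -(linB (bracket_linear iota q)); apply: (tspan_bracket_below (N := N) S_prefix) => //.
by rewrite wcatA; apply: right_core.
Qed.

Lemma congr_inclusion0 s1 sb1 m1 v1 s2 sb2 q : S s1 -> Dfree N iota s1 ->
  leading N iota s1 sb1 -> prec m1 N -> in_T N v1 ->
  S s2 -> Dfree N iota s2 -> leading N iota s2 sb2 ->
  left_factor N q -> sb1 = lcat q sb2 ->
  sspan (below (wcat sb1 m1 v1))
    (s1 ⟨m1⟩ nword iota v1 - bracket iota q (s2 ⟨m1⟩ nword iota v1)).
Proof.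
move=> Ss1 s10 ssb1 m1N v1T Ss2 s20 ssb2 qN E; have sb10 := Dfree_leading s10 ssb1.
pose x := bracket iota q s2.
have comp := composition_trivial_Dfree (w := sb1) (h := s1 - x) Ss1 Ss2 s10 s20.
have {}comp := right_below_Dfree sb10 m1N v1T (comp _).
apply: (tspan_trans (y := x ⟨m1⟩ nword iota v1)).
  rewrite -cprodBl; apply: comp; left.
  by exists sb1, sb2, q, None.
have sw : nSword N iota S s2 sb2.
  by apply: nScore_nSword; rewrite -{1}[s2]Dpow0 -{1}[sb2]wD0; apply: NScore2.
by rewrite E wcat_lcat; apply: right_bracket.
Qed.

Lemma congr_intersection1 s1 sb1 m1 v s2 sb2 m2 v2 q : S s1 -> Dfree N iota s1 ->
  leading N iota s1 sb1 -> prec m1 N -> in_T N v ->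
  S s2 -> Dfree N iota s2 -> leading N iota s2 sb2 -> prec m2 N -> in_T N v2 ->
  left_factor N q -> (0 < size q < wlen sb1)%N -> wcat sb1 m1 v = lcat q sb2 ->
  sspan (below (wcat sb1 m1 (wcat v m2 v2)))
    (s1 ⟨m1⟩ nword iota (wcat v m2 v2) - bracket iota q (s2 ⟨m2⟩ nword iota v2)).
Proof.
move=> Ss1 s10 ssb1 m1N vT Ss2 s20 ssb2 m2N v2T qN /andP[q0 qs] E.
have sb20 := Dfree_leading s20 ssb2.
have v0 : wexp v = 0 by case: E => _ -> _.
have w0 : wexp (wcat sb1 m1 v) = 0 by [].
have comp := composition_trivial_Dfree (w := wcat sb1 m1 v)
  (h := s1 ⟨m1⟩ nword iota v - bracket iota q s2) Ss1 Ss2 s10 s20.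
have {}comp := right_below_Dfree w0 m2N v2T (comp _).
rewrite wcatA in comp.
apply: (tspan_trans (y := (s1 ⟨m1⟩ nword iota v) ⟨m2⟩ nword iota v2)).
  by apply: tspan_sym; apply: right_core.
apply: (tspan_trans (y := bracket iota q s2 ⟨m2⟩ nword iota v2)).
  rewrite -cprodBl; apply: comp; right; right.
  case/lastP: q q0 qs qN E => // q [a m'] _ qs; rewrite left_factor_rcons => /andP[m'N qN] E.
  exists sb1, sb2, (Word q 0 a), v, m1, m'; split=> //; split=> //.
  by rewrite E wlen_lcat ltn_add2r.
have sw : nSword N iota S s2 sb2.
  by apply: nScore_nSword; rewrite -{1}[s2]Dpow0 -{1}[sb2]wD0; apply: NScore2.
by rewrite -wcatA E wcat_lcat; apply: right_bracket.
Qed.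

End Compositions.

(** * Comparison of S-words with one leading word, and leading words in the ideal *)

Section CompositionDiamond.
Context {k : fieldType} (char0 : [pchar k] =i pred0) {n : nat} {N : mindex n}.
Context {d : Order.disp_t} {B : orderType d} {C : nconformal k n} {iota : B -> C}.
Context (C_free : is_free N iota).
Context {S : C -> Prop} (S_monic : forall s, S s -> is_monic N iota s).
Context (GS : GSbasis N iota S).
Implicit Types (x y z f g h s : C) (u v w sb : word B n) (p q : seq (B * mindex n)).
Implicit Types (m i : mindex n) (Q R : word B n -> Prop) (r : seq (word B n)).
Local Notation wspan dfree := (tspan (is_nword (N := N) (iota := iota) dfree)).
Local Notation sspan := (tspan (nSword N iota S)).

Lemma word_eq u v : wpre u = wpre v -> wexp u = wexp v -> wlast u = wlast v -> u = v.
Proof. by case: u v => [p i a] [q j b] /= -> -> ->. Qed.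

(** A case distinction on how the leading word of the second element, placed after [q], lies
    relative to that of the first, placed at the beginning. For the second kind it extends to the
    last letter. *)
Lemma nScore_congr x1 w1 x2 w2 q : nScore (N := N) (iota := iota) (S := S) x1 w1 ->
  nScore (N := N) (iota := iota) (S := S) x2 w2 -> left_factor N q -> w1 = lcat q w2 ->
  sspan (below w1) (x1 - bracket iota q x2).
Proof.
case=> [s1 sb1 m1 v1 Ss1 s10 ssb1 m1N v1T|s1 sb1 i1 Ss1 ssb1] xw2 qN E; last first.
  case: xw2 E => [s2 sb2 m2 v2 Ss2 s20 ssb2 m2N v2T|s2 sb2 i2 Ss2 ssb2] E.
    exact: (congr_inclusion2 GS Ss1 ssb1 Ss2 s20 ssb2 m2N v2T qN E).
  exact: (congr_right_inclusion GS Ss1 ssb1 Ss2 ssb2 qN E).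
(* If [q] covers [sb1], the occurrences are disjoint. *)
have [qs|qs] := leqP (wlen sb1) (size q).
  have [||c [qE cE]] := @cat_split _ (rcons (wpre sb1) (wlast sb1, m1)) q (wpre v1) (wpre w2).
  - by case: E.
  - by rewrite size_rcons.
  have v1E : v1 = lcat c w2 by case: E => _ e1 e2; apply: word_eq.
  rewrite qE bracket_cat; apply: (disjoint_congr char0 C_free S_monic GS) => //.
  rewrite v1E; apply: nSword_bracket; first exact: nScore_nSword.
  by move: qN; rewrite qE left_factor_cat => /andP[].
case: xw2 E => [s2 sb2 m2 v2 Ss2 s20 ssb2 m2N v2T|s2 sb2 i2 Ss2 ssb2] E; last first.
  (* With [q] empty, [sb1] lies inside the second word and the roles are exchanged; otherwise the
     two properly overlap. *)
  have [q0|q0] := posnP (size q).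
    move/size0nil: q0 => q0; rewrite q0 lcat0 in E *; rewrite E /=.
    apply: tspan_sym; rewrite -[X in _ - X]/(bracket iota [::] _).
    by apply: (congr_inclusion2 GS Ss2 ssb2 Ss1 s10 ssb1 m1N); rewrite ?lcat0.
  apply: (congr_intersection2 GS Ss1 s10 ssb1 m1N v1T Ss2 ssb2 qN _ E).
  by rewrite q0.
have sb10 := Dfree_leading s10 ssb1; have sb20 := Dfree_leading s20 ssb2.
have sb1T := S_in_T char0 C_free S_monic Ss1 ssb1.
have sb2T := S_in_T char0 C_free S_monic Ss2 ssb2.
have Epre : rcons (wpre sb1) (wlast sb1, m1) ++ wpre v1 =
    (q ++ rcons (wpre sb2) (wlast sb2, m2)) ++ wpre v2 by rewrite -catA; case: E.
have Eexp : wexp v1 = wexp v2 by case: E.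
have Elast : wlast v1 = wlast v2 by case: E.
(* The ends are compared: [sb2] ends before, after, or together with [sb1]. *)
case: (ltngtP (size (q ++ rcons (wpre sb2) (wlast sb2, m2))) (wlen sb1)) => sz.
- have [|c [cE v2E]] := cat_split (esym Epre); first by rewrite size_rcons; apply: ltnW.
  case/lastP: c cE v2E => [cE|c [b m] cE v2E].
    by move: sz; rewrite /wlen -(size_rcons (wpre sb1) (wlast sb1, m1)) cE cats0 ltnn.
  move: cE; rewrite -rcons_cat => /rcons_inj[pre1 bE mE].
  rewrite -bE -mE in v2E => {b m bE mE}; pose v := Word c 0 (wlast sb1).
  have sb1E : sb1 = lcat q (wcat sb2 m2 v) by apply: word_eq; rewrite //= pre1 -catA.
  have v2E' : v2 = wcat v m1 v1 by apply: word_eq.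
  rewrite v2E'; apply: (congr_inclusion1 char0 C_free S_monic GS Ss1 s10 ssb1 m1N v1T
    Ss2 s20 ssb2 m2N _ qN sb1E).
  by move: sb1T; rewrite sb1E in_T_lcat in_T_wcat => /and4P[].
- have [|c [cE v1E]] := cat_split Epre; first by rewrite size_rcons; apply: ltnW.
  case/lastP: c cE v1E => [cE|c [b m] cE v1E].
    by move: sz; rewrite cE cats0 size_rcons ltnn.
  move: cE; rewrite -[in X in X -> _]rcons_cat -[in X in X -> _]rcons_cat.
  move=> /rcons_inj[pre1 bE mE].
  rewrite -bE -mE in v1E => {b m bE mE}; pose v := Word c 0 (wlast sb2).
  have v1E' : v1 = wcat v m2 v2 by apply: word_eq.
  have E0 : wcat sb1 m1 v = lcat q sb2 by apply: word_eq; rewrite //= -pre1.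
  have vT : in_T N v by move: v1T; rewrite v1E' in_T_wcat => /and3P[].
  have [q0|q0] := posnP (size q).
    move/size0nil: q0 => q0; rewrite q0 lcat0 in E E0 *; rewrite E /= v1E'.
    apply: tspan_sym; rewrite -[X in _ - X]/(bracket iota [::] _).
    apply: (congr_inclusion1 char0 C_free S_monic GS Ss2 s20 ssb2 m2N v2T Ss1 s10 ssb1 m1N vT
      (isT : left_factor N [::])).
    by rewrite lcat0 E0 lcat0.
  rewrite v1E'; apply: (congr_intersection1 char0 C_free S_monic GS Ss1 s10 ssb1 m1N vT
    Ss2 s20 ssb2 m2N v2T qN _ E0).
  by rewrite q0.
- have [|c [cE v1E]] := cat_split Epre; first by rewrite size_rcons sz.
  have c0 : c = [::].
    apply: size0nil; move: sz; rewrite cE size_cat size_rcons /wlen => /eqP.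
    by rewrite -[X in _ == X]addn0 eqn_add2l => /eqP.
  move: cE; rewrite c0 cats0 -rcons_cat => /rcons_inj[pre1 lE mE].
  have -> : v2 = v1 by apply: word_eq; rewrite // v1E c0.
  rewrite mE in E m1N *; apply: (congr_inclusion0 char0 C_free S_monic GS Ss1 s10 ssb1 m1N v1T
    Ss2 s20 ssb2 qN).
  by apply: word_eq; rewrite //= ?sb10 ?sb20.
Qed.

Lemma nSword_congr x1 x2 w : nSword N iota S x1 w -> nSword N iota S x2 w ->
  sspan (below w) (x1 - x2).
Proof.
move=> /nSwordP[p1 [y1 [w1 [p1N yw1 -> E1]]]] /nSwordP[p2 [y2 [w2 [p2N yw2 -> E2]]]].
have S_prefix := @nSword_prefix _ _ N _ _ _ iota S.
wlog p12 : p1 p2 y1 y2 w1 w2 p1N p2N yw1 yw2 E1 E2 / (size p1 <= size p2)%N.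
  move=> wl; have [p12|/ltnW p21] := leqP (size p1) (size p2);
    first exact: (wl p1 p2 y1 y2 w1 w2 p1N p2N yw1 yw2 E1 E2 p12).
  by apply: tspan_sym; apply: (wl p2 p1 y2 y1 w2 w1 p2N p1N yw2 yw1 E2 E1 p21).
rewrite E2 in E1; have [q [p2E w1E]] := cat_split (esym (congr1 (@wpre _ _) E1)) p12.
rewrite p2E bracket_cat -(linB (bracket_linear iota p1)) E2 E1.
apply: (tspan_bracket_below (N := N) S_prefix) => //.
have qN : left_factor N q by move: p2N; rewrite p2E left_factor_cat => /andP[].
apply: (nScore_congr yw1 yw2 qN).
by apply: word_eq; [|case: E1|case: E1].
Qed.

(** If two summands have the same top word, [nSword_congr] exchanges one S-word for the other.
    Coefficients may then cancel, so [a] may be 0 and [w] need not be the leading word of [f]. *)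
Lemma sspan_top Q f : sspan Q f -> f = 0 \/ exists w x a,
  [/\ Q w, nSword N iota S x w & sspan (below w) (f - a *: x)].
Proof.
apply: (lspan_min (P := fun f => f = 0 \/ exists w x a,
  [/\ Q w, nSword N iota S x w & sspan (below w) (f - a *: x)])); last first.
  move=> x [w [xw Qw]]; right; exists w, x, 1; split=> //.
  by rewrite scale1r subrr; apply: tspan0.
split=> [|c {}f g]; first by left.
case=> [->|[w [x [a [Qw xw fx]]]]]; first by rewrite scaler0 add0r.
case=> [->|[w' [x' [a' [Qw' xw' gx']]]]]; right.
  exists w, x, (c * a); split=> //.
  by rewrite addr0 -scalerA -scalerBr; apply: tspanZ.
have E b : c *: f + g - b = c *: (f - a *: x) + (g - a' *: x') + (c * a *: x + a' *: x' - b).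
  by rewrite scalerBr scalerA [X in _ = X + _]addrACA -opprD subrKA.
case/or3P: (wlt_total w w') => [/eqP ww'|ww'|w'w].
- exists w, x, (c * a + a'); split=> //; rewrite E; apply: tspanD.
    by rewrite ww' in fx *; apply: tspanD => //; apply: tspanZ.
  rewrite scalerDl opprD addrACA subrr add0r -scalerBr; apply/tspanZ/nSword_congr => //.
  by rewrite ww'.
- exists w', x', a'; split=> //; rewrite E; apply: tspanD.
    apply: tspanD => //; apply: tspanZ; apply: tspan_mono fx => u uw.
    exact: wlt_trans uw ww'.
  by rewrite addrK; apply/tspanZ/(tspan_gen xw).
- exists w, x, (c * a); split=> //; rewrite E; apply: tspanD.
    apply: tspanD; first exact: tspanZ.
    by apply: tspan_mono gx' => u uw; apply: wlt_trans uw w'w.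
  by rewrite addrAC subrr add0r; apply/tspanZ/(tspan_gen xw').
Qed.

Context (B_wf : well_founded (fun a b : B => (a < b)%O)).

(** Well-founded descent on [w]: a vanishing top coefficient puts [f] into the span below [w]. *)
Lemma sspan_leading Q f : sspan Q f -> f != 0 -> exists w x a,
  nSword N iota S x w /\ lterm (N := N) (iota := iota) f w a.
Proof.
move=> /sspan_top[->|[w [x [a [_ xw]]]]]; first by rewrite eqxx.
elim: (wlt_wf B_wf w) x a xw => {}w _ IH x a xw fx f0.
have [a0|a0] := eqVneq a 0.
  rewrite a0 scale0r subr0 in fx; case: (sspan_top fx) => [fE|[w' [x' [a' [w'w xw' fx']]]]].
    by rewrite fE eqxx in f0.
  exact: (IH w' w'w x' a').
exists w, x, a; split=> //; have [wT _ xw_below] := nSword_lterm char0 C_free S_monic xw.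
split=> //; apply: (tspan_trans (y := a *: x)).
  apply: (sspan_wspan char0 C_free S_monic) fx => u v vw uv; exact: wlt_trans uv vw.
by rewrite -scalerBr; apply: tspanZ; move: xw_below; rewrite scale1r.
Qed.

End CompositionDiamond.

(** * The two implications *)

Section Reduction.
Context {k : fieldType} (char0 : [pchar k] =i pred0) {n : nat} {N : mindex n}.
Context {d : Order.disp_t} {B : orderType d} {C : nconformal k n} {iota : B -> C}.
Context (C_free : is_free N iota).
Context {S : C -> Prop} (S_monic : forall s, S s -> is_monic N iota s).
Context (B_wf : well_founded (fun a b : B => (a < b)%O)).
Implicit Types (x y z f g h s : C) (u v w sb : word B n) (p q : seq (B * mindex n)).
Implicit Types (m i : mindex n) (Q R : word B n -> Prop) (r : seq (word B n)).
Local Notation wspan dfree := (tspan (is_nword (N := N) (iota := iota) dfree)).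
Local Notation sspan := (tspan (nSword N iota S)).

Lemma reducible_nSword u : in_T N u -> ~ Sirreducible N iota S u ->
  exists x, nSword N iota S x u.
Proof.
move=> uT uirr; apply: contrapT => nu; apply: uirr; split=> // -[p [s [sb]]].
  case=> [t [Ss s0 ssb [pN tN] uE]]; apply: nu; exists (sbracket iota p s t).
  by rewrite uE; apply: NSword1.
case=> [i [Ss ssb pN uE]]; apply: nu; exists (bracket iota p (Dpow i s)).
by rewrite uE; apply: NSword2.
Qed.

Lemma nSword_reducible x u : nSword N iota S x u -> ~ Sirreducible N iota S u.
Proof.
case=> [p s sb t Ss s0 ssb pN tN|p s sb i Ss ssb pN] [_ u1 u2].
  by apply: u1; exists p, s, sb, t.
by apply: u2; exists p, s, sb, i.
Qed.

Lemma nSword_is_Dfree x w : (forall s, S s -> Dfree N iota s) ->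
  nSword N iota S x w -> wexp w = 0 -> Dfree N iota x.
Proof.
move=> S0 /nSwordP[p [y [v [pN yv -> ->]]]] v0; apply/(DfreeP char0 C_free).
apply: (tspan_bracket (N := N) (@is_nword_prefix _ _ N _ _ _ iota True) (Q := anyword)) => //.
case: yv v0 => [s sb m {}v Ss s0 ssb mN vT v0|s sb i Ss ssb /madd_eq0[_ ->]].
  apply: (tspan_mono (Q := len_le (wlen sb + wlen v))) => //.
  apply: (wspan_prod C_free); first exact: (S_len char0 C_free S_monic).
  by apply: wspan_nword => //; apply: leqnn.
by rewrite Dpow0; apply/(DfreeP char0 C_free)/S0.
Qed.

(** Division by [S]: a reducible word is the leading word of an S-word, whose subtraction leaves
    smaller words. The switch [dfree] and the bound [Q] pass to the S-words subtracted. *)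
Lemma reduction (dfree : Prop) Q f : (dfree -> forall s, S s -> Dfree N iota s) ->
  (forall u w, Q w -> wlt u w -> Q u) -> wspan dfree Q f ->
  exists z g, [/\ f = z + g, wspan False (Sirreducible N iota S) z &
    lspan (fun x => exists w, nSword N iota S x w /\ Q w /\ (dfree -> Dfree N iota x)) g].
Proof.
move=> dS Qdown; pose P f := exists z g, [/\ f = z + g,
  wspan False (Sirreducible N iota S) z &
    lspan (fun x => exists w, nSword N iota S x w /\ Q w /\ (dfree -> Dfree N iota x)) g].
pose X x := exists w, nSword N iota S x w /\ Q w /\ (dfree -> Dfree N iota x).
have sP : is_subspace P.
  split=> [|c _ _ [z1 [g1 [-> zi1 gi1]]] [z2 [g2 [-> zi2 gi2]]]].
    exists 0, 0; split; [by rewrite addr0|exact: tspan0|].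
    by apply: subspace0; apply: lspan_subspace.
  exists (c *: z1 + z2), (c *: g1 + g2); split.
  - by rewrite scalerDr addrACA.
  - by apply: tspanD => //; apply: tspanZ.
  - by have [_] := lspan_subspace X; apply.
apply: (lspan_min sP) => _ [u [[uT u0 ->] Qu]].
elim: (wlt_wf B_wf u) uT u0 Qu => {}u _ IH uT u0 Qu.
have [ui|ui] := pselect (Sirreducible N iota S u).
  exists (nword iota u), 0; split; [by rewrite addr0|exact: wspan_nword|].
  by apply: subspace0; apply: lspan_subspace.
have [x xu] := reducible_nSword uT ui.
have [_ xu_below] := nSword_below char0 C_free S_monic xu.
have x0 : dfree -> Dfree N iota x.
  by move=> df; apply: nSword_is_Dfree (dS df) xu (u0 df).
suff [z [g [E zi gi]]] : P (nword iota u - x).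
  exists z, (g + x); split=> //; first by rewrite addrA -E subrK.
  apply: subspaceD gi _; first exact: lspan_subspace.
  by apply: lspan_gen; exists u.
have : wspan dfree (below u) (nword iota u - x).
  have [df|df] := pselect dfree; last first.
    rewrite (_ : dfree = False); first exact: tspan_sym.
    by apply: propext; split.
  rewrite (_ : dfree = True); last by apply: propext; split.
  apply: (Dfree_wspan char0 C_free); last exact: tspan_sym.
  apply: (subspaceB (Dfree_subspace char0 C_free)); last exact: x0.
  by apply/(DfreeP char0 C_free)/wspan_nword => // _; apply: u0.
apply: (lspan_min sP) => _ [v [[vT v0 ->] vu]].
by apply: IH => //; apply: Qdown vu.
Qed.

Lemma quo_sum r (c : word B n -> k) :
  quo (Id_Domega S) (\sum_(u <- r) c u *: nword iota u) =
  \sum_(u <- r) c u *: (quo (Id_Domega S) (nword iota u) : quotient_by S).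
Proof.
rewrite (lin_sum (V := quotient_by S) (quo_linear (Id_Domega S))).
by apply: eq_bigr => u _; rewrite (linZ (V := quotient_by S) (quo_linear (Id_Domega S))).
Qed.

Lemma quo_eq0 f : quo (Id_Domega S) f = (0 : quotient_by S) <-> Id_Domega S f.
Proof.
rewrite -[X in _ = X](lin0 (V := quotient_by S) (quo_linear (Id_Domega S))).
by split=> [/quoP|h]; [|apply/quoP]; rewrite subr0.
Qed.

Lemma GSbasis_basis : GSbasis N iota S -> Sirreducible_basis N iota S.
Proof.
move=> GS; split=> [x|r c ur ri].
  have [z [g [E zi gI]]] : exists z g, [/\ repr x = z + g,
      wspan False (Sirreducible N iota S) z & Id_Domega S g].
    have [z [g [E zi gi]]] := @reduction False anyword (repr x)
      (False_ind _) (fun _ _ _ _ => I) (wspan_all C_free _).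
    exists z, g; split=> //; apply: lspan_min gi; first exact: Id_subspace.
    by move=> y [w [/nSword_Id]].
  have [r [c [[ur rT zE] ri]]] := wspan_expansion zi.
  exists r, c; split=> //; rewrite -quo_sum -zE -[LHS]quo_repr.
  by apply/quoP; rewrite E addrAC subrr add0r.
rewrite -quo_sum => /quo_eq0 fI.
set f := \sum_(u <- r) _ in fI.
have rT u : u \in r -> in_T N u by move=> /ri[].
have [f0|f0] := eqVneq f 0; first exact: (nword_free char0 C_free ur rT f0).
(* The leading word of [f] would be reducible, while only irreducible words occur in [f]. *)
have [w [x [a [xw fw]]]] := sspan_leading char0 C_free S_monic GS B_wf
  (Id_sspan char0 C_free S_monic GS fI) f0.
have fi : wspan False (Sirreducible N iota S) f.
  apply: subspace_sum; first exact: tspan_subspace.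
  move=> u ur' _; apply: tspanZ; apply: wspan_nword => //; first exact: rT.
  exact: ri.
by case: (nSword_reducible xw); apply: (lterm_mem char0 C_free) fi fw.
Qed.

(** * The converse for D-free [S] *)

Context (S_Dfree : forall s, S s -> Dfree N iota s)
  (S_basis : Sirreducible_basis N iota S).

(** The irreducible remainder of the division lies in the ideal, so its coefficients vanish, and the
    subtracted S-words with their bounds are all that is left. *)
Lemma Id_Dfree_combination Q h : (forall u w, Q w -> wlt u w -> Q u) ->
  wspan True Q h -> Id_Domega S h ->
  lspan (fun x => exists w, nSword N iota S x w /\ Q w /\ Dfree N iota x) h.
Proof.
move=> Qdown hQ hI; have [z [g [E zi gi]]] := reduction (fun _ => S_Dfree) Qdown hQ.
have gI : Id_Domega S g.
  apply: lspan_min gi; first exact: Id_subspace.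
  by move=> y [w [/nSword_Id]].
have z0 : z = 0.
  have zI : Id_Domega S z.
    by rewrite -[z](addrK g) -E; apply: (subspaceB Id_subspace).
  have [r [c [[ur rT zE] ri]]] := wspan_expansion zi.
  have [_ /(_ r c ur ri)] := S_basis; rewrite -quo_sum -zE => /(_ ((quo_eq0 _).2 zI)) c0.
  by rewrite zE big_seq big1 // => u /c0 ->; rewrite scale0r.
rewrite E z0 add0r; apply: lspan_mono gi => y [w [yw [Qw y0]]].
by exists w; do !split=> //; apply: y0.
Qed.

(** Inclusion, right inclusion and intersection compositions are differences of two S-words with the
    same word [w]; the difference lies in the ideal and below [w]. *)
Lemma nSword_sub_trivial f g x1 x2 w : nSword N iota S x1 w -> nSword N iota S x2 w ->
  wexp w = 0 -> trivial_mod N iota S f g w (x1 - x2).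
Proof.
move=> x1w x2w w0; apply/Scombination_lspan.
have x10 := nSword_is_Dfree S_Dfree x1w w0; have x20 := nSword_is_Dfree S_Dfree x2w w0.
have [_ x1b] := nSword_below char0 C_free S_monic x1w.
have [_ x2b] := nSword_below char0 C_free S_monic x2w.
have h0 : wspan True (below w) (x1 - x2).
  apply: (Dfree_wspan char0 C_free).
    exact: (subspaceB (Dfree_subspace char0 C_free)).
  by apply: (tspan_trans x1b); apply: tspan_sym.
have hI : Id_Domega S (x1 - x2) by apply: (subspaceB Id_subspace); apply: nSword_Id; eassumption.
have := Id_Dfree_combination _ h0 hI.
case=> [u v vw uv|h]; first exact: wlt_trans uv vw.
apply: lspan_mono (LSpan h) => y [v [yv [vw y0]]]; exists v; do !split=> //.
Qed.

Lemma nSword_of_S s sb : S s -> leading N iota s sb -> nSword N iota S s sb.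
Proof.
move=> Ss ssb; apply: nScore_nSword; rewrite -{1}[s]Dpow0 -{1}[sb]wD0.
exact: NScore2.
Qed.

Lemma basis_GSbasis : GSbasis N iota S.
Proof.
split=> [f g w h0 Sf Sg|f h0 Sf [a [m [mN ->]]]|f h0 Sf [f0]]; last by case: f0; apply: S_Dfree.
  case=> [[fb [gb [p [t [[ffb ggb] g0 [pN tN] [-> fbE] ->]]]]]|[|]].
  - apply: nSword_sub_trivial; first exact: nSword_of_S.
      by rewrite fbE; apply: NSword1.
    exact: Dfree_leading (S_Dfree Sf) ffb.
  - move=> [fb [gb [p [sg [l [i [[ffb ggb] ln pN [wE wE'] ->]]]]]]].
    have fb0 := Dfree_leading (S_Dfree Sf) ffb.
    have gb0 := Dfree_leading (S_Dfree Sg) ggb.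
    apply: nSword_sub_trivial.
    + by rewrite wE; apply: nScore_nSword; apply: NScore2.
    + by rewrite wE'; apply: NSword2.
    (* Since [fb] and [gb] are D-free, both disjoint exponents equal that of [w], which is therefore
       0. *)
    have e1 : wexp w = expo_lo sg l i by rewrite wE /= fb0 add0r.
    have e2 : wexp w = expo_hi sg l i by rewrite wE' /= gb0 add0r.
    apply: mindexP => j; rewrite mzeroE.
    by have [e0|e0] := expo_disjoint sg l i j; rewrite ?e1 // -?e1 e2.
  - move=> [fb [gb [u [v [m [m' [[ffb ggb] f0 [uT vT u0 mN m'N] [wE wE' _] ->]]]]]]].
    apply: nSword_sub_trivial.
    + by rewrite wE; apply: nScore_nSword; apply: NScore1.
    + rewrite wE'; apply: nSword_bracket; first exact: nSword_of_S.
      by rewrite left_factor_rcons m'N.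
    by rewrite wE'; apply: Dfree_leading (S_Dfree Sg) ggb.
apply/Scombination_lspan; set h := iota a ⟨m⟩ f.
have hI : Id_Domega S h by apply: Id_prodl; apply: Id_mem.
have hD : Dfree N iota h.
  have [fb /(ex_intro _ 1) ffb] := S_monic Sf.
  apply/(DfreeP char0 C_free); apply: (tspan_mono (Q := len_le (wlen fb).+1)) => //.
  apply: (wspan_left C_free); apply: (Dfree_wspan char0 C_free); first exact: S_Dfree.
  exact: (S_len char0 C_free S_monic Sf ffb).
(* The bound is the length of the leading word of [h]; it holds for every word of [h]. *)
have hQ : wspan True (len_le_leading N iota h) h.
  have [->|hn0] := eqVneq h 0; first exact: tspan0.
  have [hb [c [_ hhb]]] := exists_lterm (wspan_all C_free h) hn0.
  apply: (Dfree_wspan char0 C_free hD); apply: tspan_mono (lterm_len hhb) => w wh hb' hhb'.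
  by rewrite (leading_inj char0 C_free hhb' (lterm_leading hhb)).
apply: lspan_mono (Id_Dfree_combination _ hQ hI) => [y [w [yw [wh y0]]]|u w wh uw hb hhb].
  by exists w; do !split=> //.
by apply: leq_trans (wlt_len uw) _; apply: wh.
Qed.

End Reduction.

Theorem theorem3p21 (k : fieldType) (char0 : [pchar k]%R =i pred0)
    (n : nat) (n_gt0 : (0 < n)%N) (N : mindex n)
    (d : Order.disp_t) (B : orderType d) (B_nonempty : inhabited B)
    (B_wf : well_founded (fun a b : B => (a < b)%O))
    (C : nconformal k n) (iota : B -> C) (C_free : is_free N iota)
    (S : C -> Prop) (S_monic : forall s, S s -> is_monic N iota s) :
  (GSbasis N iota S -> Sirreducible_basis N iota S) /\
  ((forall s, S s -> Dfree N iota s) ->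
   Sirreducible_basis N iota S -> GSbasis N iota S).
Proof.
split; first exact: GSbasis_basis.
by move=> S_Dfree; apply: basis_GSbasis.
Qed.
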